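(* Let $B$ be a body and let $P$ be the $G_{1B}$-structure on $B$, for $\beta=0$ and $\alpha,\gamma\neq0$, given by a two-dimensional distribution $D$, a nowhere vanishing tangent one-form $\omega|_D$ on $D$ (a section of the dual bundle $D^*$), and a volume form $\Omega$. Then $P$ is integrable if and only if $D$ is involutive and $d\omega|_D=0$.
   Context: A body is a $3$-dimensional smooth manifold which can be covered with one chart. In this case ($\beta=0$, $\alpha=-\gamma\neq 0$) $G_{1B}\subset GL(3,\mathbb{R})$ is the isotropy group of the subspace $\langle e_2,e_3\rangle$, of the covector $e^2$ restricted to this subspace, and of the tensor $e^1\wedge e^2\wedge e^3$, where $(e_i)$ is the canonical basis of $\mathbb{R}^3$ and $(e^i)$ its dual basis. The corresponding $G_{1B}$-structure $P$ is the set of linear frames $(v_1,v_2,v_3)$ at points $x\in B$ such that $v_2,v_3$ span $D_x$, $\omega|_D(v_2)=1$, $\omega|_D(v_3)=0$ and $\Omega(v_1,v_2,v_3)=1$. When $D$ is involutive, $d\omega|_D=0$ means that the one-form induced by $\omega|_D$ on each leaf of the foliation defined by $D$ is closed. A $G$-structure $P$ is integrable if around each point there are local coordinates $(x^1,x^2,x^3)$ whose coordinate frame is a section of $P$. *)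

(* Defs.v *)
From HB Require Import structures.
From mathcomp Require Import all_boot all_order all_algebra.
From mathcomp Require Import all_classical all_reals all_analysis.
From mathcomp Require Import ring.
From Stdlib Require Export Relations.Relation_Operators.

Set Implicit Arguments.
Unset Strict Implicit.
Unset Printing Implicit Defensive.

Import Order.TTheory GRing.Theory Num.Theory.
Import numFieldNormedType.Exports.

Local Open Scope classical_set_scope.
Local Open Scope ring_scope.

Section Calculus.
Context {R : realType} {n : nat} {V : normedModType R}.
Implicit Types (U : set 'rV[R]_n) (f : 'rV[R]_n -> V).

(* Only the values of [f] on [U] matter when [U] is open. *)
Fixpoint class_C (k : nat) U f : Prop :=
  if k is k'.+1 then
    (forall p, U p -> differentiable f p) /\
    (forall v : 'rV[R]_n, class_C k' U ('D_v f))
  else forall p, U p -> {for p, continuous f}.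

Definition smooth U f : Prop := forall k, class_C k U f.

End Calculus.

(* A 3-manifold covered by one chart: the chart is a homeomorphism onto an
   open subset of R^3, and the smooth structure is the one it generates. *)
Record body (R : realType) := Body {
  body_points :> topologicalType;
  chart : body_points -> 'rV[R]_3;
  chart_inj : injective chart;
  chart_continuous : continuous chart;
  chart_open : forall W : set body_points, open W -> open (chart @` W)
}.

Arguments chart {R b}.

(* The global chart trivializes the tangent bundle: a tangent vector at any
   point of [B] is given by its three components in the coordinate frame of
   [chart]. *)
Notation tangent R := 'rV[R]_3 (only parsing).

(* The indices of e_1, e_2, e_3. *)
Notation i1 := (@Ordinal 3 0 isT).
Notation i2 := (@Ordinal 3 1 isT).
Notation i3 := (@Ordinal 3 2 isT).

Definition basis_vec {R : realType} (i : 'I_3) : 'rV[R]_3 := delta_mx 0 i.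

Section Body.
Context {R : realType} {B : body R}.

Section Functions.
Context {V : normedModType R}.

(* f \o chart^-1, extended by 0 outside the range of the chart. *)
Definition in_chart (f : B -> V) (p : 'rV[R]_3) : V :=
  xget 0 (f @` [set x | chart x = p]).

Definition smooth_on (W : set B) (f : B -> V) : Prop :=
  smooth (chart @` W) (in_chart f).

End Functions.

(* [X, Y]^i = X^j d_j Y^i - Y^j d_j X^i in the coordinates of the chart. *)
Definition lie_bracket (X Y : B -> tangent R) (x : B) : tangent R :=
  'D_(X x) (in_chart Y) (chart x) - 'D_(Y x) (in_chart X) (chart x).

(* [z] is chart \o y^-1, so that y : W -> y(W) is a diffeomorphism onto an open
   set. *)
Definition local_coordinates (W : set B) (y : B -> 'rV[R]_3)
    (z : 'rV[R]_3 -> 'rV[R]_3) : Prop :=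
  [/\ open W, open (y @` W), smooth_on W y, smooth (y @` W) z &
      forall x, W x -> z (y x) = chart x].

(* A frame (v_1, v_2, v_3) is the matrix whose i-th row is v_i. *)
Definition coordinate_frame (y : B -> 'rV[R]_3) (z : 'rV[R]_3 -> 'rV[R]_3)
    (x : B) : 'M[R]_3 :=
  \matrix_i 'D_(basis_vec i) z (y x).

Definition integrable_structure (P : B -> set 'M[R]_3) : Prop :=
  forall x : B, exists W y z,
    [/\ local_coordinates W y z, W x &
        forall x', W x' -> P x' (coordinate_frame y z x')].

Section Distribution.
Variable D : B -> {vspace tangent R}.

Definition section_of (W : set B) (X : B -> tangent R) : Prop :=
  smooth_on W X /\ (forall x, W x -> X x \in D x).

Definition distribution2 : Prop :=
  (forall x, \dim (D x) = 2) /\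
  (forall x, exists (W : set B) (X Y : B -> tangent R),
    [/\ open W, W x, smooth_on W X, smooth_on W Y &
        forall x', W x' -> D x' = <<[:: X x'; Y x']>>%VS]).

Definition involutive_distribution : Prop :=
  forall (W : set B) (X Y : B -> tangent R), open W ->
    section_of W X -> section_of W Y ->
    forall x, W x -> lie_bracket X Y x \in D x.

(* [s] parametrizes, on [U], an immersed surface tangent to [D]; it is an
   immersion because [D] has rank 2. *)
Definition integral_surface (U : set 'rV[R]_2) (s : 'rV[R]_2 -> B) : Prop :=
  [/\ open U, smooth U (chart \o s) &
      forall u, U u -> forall X : tangent R,
        X \in D (s u) <-> exists v, X = 'D_v (chart \o s) u].

Definition same_plaque (x y : B) : Prop :=
  exists (U : set 'rV[R]_2) (s : 'rV[R]_2 -> B),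
    [/\ integral_surface U s, connected U, (s @` U) x & (s @` U) y].

(* Two points are on the same leaf when a finite chain of plaques joins them. *)
Definition leaf (x : B) : set B :=
  [set y | clos_refl_sym_trans B same_plaque x y].

(* [vsproj (D x) v] is [v] seen as an element of [D x], when [v \in D x]. *)
Definition dual_field := forall x : B, 'Hom(subvs_of (D x), R^o).

Variable w : dual_field.

Definition dual_eval (x : B) (v : tangent R) : R^o := w x (vsproj (D x) v).

Definition nonvanishing_dual_section : Prop :=
  (forall (W : set B) (X : B -> tangent R), open W -> section_of W X ->
     smooth_on W (fun x => dual_eval x (X x))) /\
  (forall x, exists2 v, v \in D x & dual_eval x v != 0).

Definition pullback (s : 'rV[R]_2 -> B) (u v : 'rV[R]_2) : R^o :=
  dual_eval (s u) ('D_v (chart \o s) u).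

(* The one-form induced on the leaf is closed: d a (v, v') =
   v (a (v')) - v' (a (v)) vanishes in every local parametrization. *)
Definition closed_on (L : set B) : Prop :=
  forall (U : set 'rV[R]_2) (s : 'rV[R]_2 -> B),
    integral_surface U s -> s @` U `<=` L ->
    forall u, U u -> forall v v' : 'rV[R]_2,
      'D_v (fun q => pullback s q v') u = 'D_v' (fun q => pullback s q v) u.

Definition leafwise_closed : Prop := forall x, closed_on (leaf x).

End Distribution.

Definition form3 := tangent R -> tangent R -> tangent R -> R^o.

Definition alternating3 (O : form3) : Prop :=
  [/\ forall v v', scalar (fun u => O u v v'),
      forall u v', scalar (fun v => O u v v'),
      forall u v, scalar (fun v' => O u v v') &
      forall u v, [/\ O u u v = 0, O u v u = 0 & O v u u = 0]].

Definition volume_form (O : B -> form3) : Prop :=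
  [/\ forall x, alternating3 (O x),
      forall (W : set B) (X Y Z : B -> tangent R), open W ->
        smooth_on W X -> smooth_on W Y -> smooth_on W Z ->
        smooth_on W (fun x => O x (X x) (Y x) (Z x)) &
      forall x, exists u v v', O x u v v' != 0].

Definition G1B_structure (D : B -> {vspace tangent R}) (w : dual_field D)
    (O : B -> form3) (x : B) : set 'M[R]_3 :=
  [set F | [/\ F \in unitmx,
               <<[:: row i2 F; row i3 F]>>%VS = D x,
               dual_eval w x (row i2 F) = 1,
               dual_eval w x (row i3 F) = 0 &
               O x (row i1 F) (row i2 F) (row i3 F) = 1]].

End Body.

(* A linear map of R^3 acts on row vectors by u |-> u *m g; composing a frame,
   seen as the map e_i |-> v_i with matrix F, with g gives g *m F. *)
Section Group.
Context {R : realType}.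

Definition E23 : {vspace 'rV[R]_3} :=
  <<[:: basis_vec i2; basis_vec i3]>>%VS.

Definition e123 (u v v' : 'rV[R]_3) : R^o :=
  \det (\matrix_(i < 3) [tuple u; v; v']`_i).

Definition G1B : set 'M[R]_3 :=
  [set g | [/\ g \in unitmx,
               forall u, (u *m g \in E23) = (u \in E23),
               forall u, u \in E23 -> (u *m g) 0 i2 = u 0 i2 &
               forall u v v', e123 (u *m g) (v *m g) (v' *m g) = e123 u v v']].

End Group.

Section Orbit.
Context {R : realType} {B : body R}.

Lemma mem_span2 (a b u : 'rV[R]_3) :
  u \in <<[:: a; b]>>%VS <-> exists s t, u = s *: a + t *: b.
Proof.
rewrite span_cons span_seq1; split.
  move=> /memv_addP[_ /vlineP[s ->]] [_ /vlineP[t ->]] ->; by exists s, t.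
by move=> [s [t ->]]; rewrite memv_add // rpredZ // memv_line.
Qed.

Lemma row_basis (F : 'M[R]_3) i : row i F = basis_vec i *m F.
Proof. exact: rowE. Qed.

Lemma mem_E23 (F : 'M[R]_3) (u : 'rV[R]_3) : F \in unitmx ->
  (u *m F \in <<[:: row i2 F; row i3 F]>>%VS) = (u \in E23).
Proof.
move=> uF; apply/idP/idP => /mem_span2[s [t h]]; apply/mem_span2; exists s, t.
  by apply: (can_inj (mulmxK uF)); rewrite h !row_basis mulmxDl !scalemxAl.
by rewrite h !row_basis mulmxDl !scalemxAl.
Qed.

Lemma row3E (u : 'rV[R]_3) :
  u = u 0 i1 *: basis_vec i1 + u 0 i2 *: basis_vec i2 + u 0 i3 *: basis_vec i3.
Proof.
apply/rowP => j; rewrite !mxE /= -!val_eqE /=.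
by case: j => [[|[|[|//]]] hj] /=; rewrite ?(mulr0, mulr1, addr0, add0r);
  congr (u _ _); apply/val_inj.
Qed.

Lemma e123E (u v v' : 'rV[R]_3) : e123 u v v' =
  u 0 i1 * (v 0 i2 * v' 0 i3 - v 0 i3 * v' 0 i2)
  - u 0 i2 * (v 0 i1 * v' 0 i3 - v 0 i3 * v' 0 i1)
  + u 0 i3 * (v 0 i1 * v' 0 i2 - v 0 i2 * v' 0 i1).
Proof.
have det2 (M : 'M[R]_2) : \det M = M 0 0 * M 1 1 - M 0 1 * M 1 0.
  rewrite (expand_det_row _ 0) !big_ord_recl big_ord0 /cofactor !det_mx11 !mxE.
  rewrite (_ : lift 0 0 = 1); last exact/val_inj.
  rewrite (_ : lift 1 0 = 0); last exact/val_inj.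
  by rewrite /= /bump /= !addn0 expr0 expr1; ring.
rewrite /e123 (expand_det_row _ i1) !big_ord_recl big_ord0 /cofactor.
rewrite !det2 !mxE /=.
have nat_coef (x : 'rV[R]_3) : exists x' : nat -> R, forall i, x 0 i = x' i.
  by exists (fun k => x 0 (inord k)) => i; rewrite inord_val.
have [[u' hu] [v1 hv] [v1' hv']] := And3 (nat_coef u) (nat_coef v) (nat_coef v').
by rewrite !(hu, hv, hv') /= /bump /= !add0n !addn0 expr0 expr1 sqrrN expr1n; ring.
Qed.

Lemma alternating3E (T : @form3 R) u v v' : alternating3 T ->
  T u v v' = e123 u v v' * T (basis_vec i1) (basis_vec i2) (basis_vec i3).
Proof.
move=> [l1 l2 l3 alt].
have D1 a b c d : T (a + b) c d = T a c d + T b c d.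
  by have := l1 c d 1 a b; rewrite scale1r mul1r.
have D2 a b c d : T c (a + b) d = T c a d + T c b d.
  by have := l2 c d 1 a b; rewrite scale1r mul1r.
have D3 a b c d : T c d (a + b) = T c d a + T c d b.
  by have := l3 c d 1 a b; rewrite scale1r mul1r.
have z0 c d : [/\ T 0 c d = 0, T c 0 d = 0 & T c d 0 = 0].
  by split; [have := D1 0 0 c d|have := D2 0 0 c d|have := D3 0 0 c d];
    rewrite addr0 => /esym/eqP; rewrite -subr_eq0 addrK => /eqP.
have Z1 k a c d : T (k *: a) c d = k * T a c d.
  by have := l1 c d k a 0; have [-> _ _] := z0 c d; rewrite !addr0.
have Z2 k a c d : T c (k *: a) d = k * T c a d.
  by have := l2 c d k a 0; have [_ -> _] := z0 c d; rewrite !addr0.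
have Z3 k a c d : T c d (k *: a) = k * T c d a.
  by have := l3 c d k a 0; have [_ _ ->] := z0 c d; rewrite !addr0.
have A1 a b : T a a b = 0 by have [] := alt a b.
have A2 a b : T a b a = 0 by have [] := alt a b.
have A3 a b : T b a a = 0 by have [] := alt a b.
have S12 a b c : T b a c = - T a b c.
  have := A1 (a + b) c; rewrite !(D1, D2) !A1 add0r addr0 => /eqP.
  by rewrite addr_eq0 => /eqP ->; rewrite ?opprK.
have S23 a b c : T a c b = - T a b c.
  have := A3 (b + c) a; rewrite !(D2, D3) !A3 add0r addr0 => /eqP.
  by rewrite addr_eq0 => /eqP ->; rewrite ?opprK.
rewrite e123E {1}(row3E u) {1}(row3E v) {1}(row3E v').
move: (basis_vec i1) (basis_vec i2) (basis_vec i3) => a b c.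
have Ebac : T b a c = - T a b c by exact: S12.
have Eacb : T a c b = - T a b c by exact: S23.
have Ebca : T b c a = T a b c by rewrite (S23 b a c) Ebac opprK.
have Ecab : T c a b = T a b c by rewrite (S12 a c b) Eacb opprK.
have Ecba : T c b a = - T a b c by rewrite (S12 b c a) Ebca.
rewrite !(D1, D2, D3, Z1, Z2, Z3) !(A1, A2, A3) Ebac Eacb Ebca Ecab Ecba.
by move: (T a b c : R) => t; ring.
Qed.

Lemma dual_eval_frame (D : B -> {vspace tangent R}) (w : dual_field D) O x F u :
  G1B_structure w O x F -> u \in E23 -> dual_eval w x (u *m F) = u 0 i2.
Proof.
move=> [uF _ w2 w3 _] /mem_span2[s [t ->]].
rewrite mulmxDl -!scalemxAl -!row_basis /dual_eval linearD /= !linearZ /=.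
rewrite linearD /= !linearZ /=.
have -> : w x (vsproj (D x) (row i2 F)) = 1 := w2.
have -> : w x (vsproj (D x) (row i3 F)) = 0 := w3.
rewrite !mxE /=.
by rewrite /GRing.scale /= !mulr1 !mulr0.
Qed.

(* Each nonempty fibre of [G1B_structure] is an orbit of the group [G1B]. *)
Lemma G1B_structure_orbit (D : B -> {vspace tangent R}) (w : dual_field D)
    (O : B -> form3) (x : B) (F F' : 'M[R]_3) :
  alternating3 (O x) -> G1B_structure w O x F ->
  G1B_structure w O x F' <-> exists2 g, G1B g & F' = g *m F.
Proof.
move=> altO hF; have [uF DF _ _ OF] := hF.
have volF (M : 'M[R]_3) u v v' : O x (u *m M) (v *m M) (v' *m M) =
    e123 u v v' * O x (row i1 M) (row i2 M) (row i3 M).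
  pose T a b c := O x (a *m M) (b *m M) (c *m M).
  rewrite !row_basis; apply: (@alternating3E T); case: altO => l1 l2 l3 alt.
  split=> [b c k a a'|a c k b b'|a b k c c'|a b]; last exact: alt.
  - by rewrite /T mulmxDl -scalemxAl l1.
  - by rewrite /T mulmxDl -scalemxAl l2.
  - by rewrite /T mulmxDl -scalemxAl l3.
split=> [hF'|[g hg ->]].
  have [uF' DF' _ _ OF'] := hF'.
  have gF : F' *m invmx F *m F = F' by rewrite mulmxKV.
  have actF (u : 'rV[R]_3) : u *m (F' *m invmx F) *m F = u *m F'.
    by rewrite -mulmxA gF.
  have memg u : (u *m (F' *m invmx F) \in E23) = (u \in E23).
    by rewrite -(mem_E23 _ uF) actF DF -DF' mem_E23.
  exists (F' *m invmx F); last by rewrite gF.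
  split=> // [|u hu|u v v'].
  - by rewrite unitmx_mul uF' unitmx_inv.
  - rewrite -(dual_eval_frame hF (u := u *m _)) ?memg // actF.
    exact: dual_eval_frame hF' hu.
  - have := volF F (u *m (F' *m invmx F)) (v *m (F' *m invmx F))
      (v' *m (F' *m invmx F)).
    by rewrite !actF volF OF OF' !mulr1 => ->.
have [ug gE gw gv] := hg.
have e2 : basis_vec i2 \in @E23 R.
  by apply/mem_span2; exists 1, 0; rewrite scale1r scale0r addr0.
have e3 : basis_vec i3 \in @E23 R.
  by apply/mem_span2; exists 0, 1; rewrite scale1r scale0r add0r.
have ugF : g *m F \in unitmx by rewrite unitmx_mul ug.
split=> //.
- apply/vspaceP => v; rewrite -(mulmxKV ugF v) (mem_E23 _ ugF) mulmxA.
  by rewrite -DF mem_E23 // gE.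
- by rewrite row_basis mulmxA (dual_eval_frame hF) ?gE // gw // !mxE.
- by rewrite row_basis mulmxA (dual_eval_frame hF) ?gE // gw // !mxE.
- rewrite !row_basis !(mulmxA _ g) volF gv OF mulr1 e123E !mxE /=.
  by rewrite !(mulr0, mul0r, mulr1, subr0, addr0).
Qed.

End Orbit.

(* Main.v *)
(* If local coordinates with frames in the structure exist, D is spanned by the
   last two coordinate fields and omega|_D is the restriction of the second
   coordinate differential, so D is involutive (brackets preserve the kernel of
   the first coordinate differential) and omega|_D is closed on leaves (symmetry
   of second derivatives).

   Conversely, near a point D is the graph of du_1 = P_2 du_2 + P_3 du_3 in
   suitable affine coordinates.  Solving this system along radial lines of the
   slices q_1 = const gives a map G, smooth by smooth dependence on initial
   conditions, and involutivity makes G map the slices into leaves (Frobenius).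
   Pulled back by G, omega|_D is a closed form on slices, with the radial
   primitive f; taking f as second coordinate makes omega|_D equal to dx^2.
   Finally, taking as third coordinate a primitive, in the direction of x^3, of
   the density of the volume form makes that density equal to 1 without affecting
   D and omega|_D.  Each change of coordinate is inverted by the inverse function
   theorem. *)

From HB Require Import structures.
Require Import Defs.
From mathcomp Require Import all_boot all_order all_algebra.
From mathcomp Require Import all_classical all_reals all_analysis.
From mathcomp Require Import ring lra.

Set Implicit Arguments.
Unset Strict Implicit.
Unset Printing Implicit Defensive.

Import Order.TTheory GRing.Theory Num.Theory.
Import numFieldNormedType.Exports.

Local Open Scope classical_set_scope.
Local Open Scope ring_scope.

(** * Functions of class C^k *)

(** Integrals are normalised to [0, 1], and increments are written, after Hadamard, as displacement
    coordinates times averaged partial derivatives. By [caratheodory] such a formula with continuous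
    coefficients gives both differentiability and the derivative; it serves for parameter integrals,
    local inverses and solutions of the leaf system. In the last two cases the derivative is a
    smooth expression in the function itself, so class C^k improves to C^(k+1). The leaf system is
    overdetermined. Restricted to rays it becomes one scalar integral equation, solvable without any
    integrability condition, with the first coordinate as initial value; involutivity enters only to
    get the derivatives across the rays right. The dilation [dil] fixes the coordinates outside a
    set [J], so one radial primitive serves both the slices ([J] = all but the first coordinate) and
    the volume density ([J] = the third alone). The affine frame is chosen with omega nonzero on its
    second row, which makes f admissible as second coordinate. Changing the third coordinate last is
    harmless: the conditions on D and omega|_D only read the first two components of a vector. *)

Lemma differentiable_intro {R : realType} {V W : normedModType R} (f : V -> W)
    (df : {linear V -> W}) (x : V) : continuous df ->
    (forall e, 0 < e -> \forall h \near 0,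
       `|f (h + x) - f x - df h| <= e * `|h|) ->
  differentiable f x /\ 'd f x = df :> (V -> W).
Proof.
move=> cdf fx.
have fo : f \o shift x = cst (f x) + df +o_ 0 id.
  apply/eqaddoP => e e0; near=> h.
  have : `|f (h + x) - f x - df h| <= e * `|h| by near: h; exact: fx.
  by congr (`|_| <= _); rewrite !fctE /= opprD addrA.
have dfE := diff_unique cdf fo.
by split=> //; apply/diff_locallyP; rewrite dfE.
Unshelve. all: by end_near. Qed.

Lemma near_forall_ord {T : topologicalType} n (P : 'I_n -> T -> Prop) (x : T) :
  (forall i, \near x, P i x) -> \near x, forall i, P i x.
Proof. by move=> Px; apply: filter_forall. Qed.

Lemma cont_pair {T A B : topologicalType} (a : T -> A) (b : T -> B) (z : T) :
  {for z, continuous a} -> {for z, continuous b} ->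
  {for z, continuous (fun t => (a t, b t))}.
Proof. by move=> ca cb; exact: cvg_pair. Qed.

Lemma cont_fst {A B : topologicalType} (x : A * B) : {for x, continuous fst}.
Proof. exact: cvg_fst. Qed.

Lemma cont_snd {A B : topologicalType} (x : A * B) : {for x, continuous snd}.
Proof. exact: cvg_snd. Qed.

Lemma cont_id {A : topologicalType} (x : A) :
  {for x, continuous (fun y : A => y)}.
Proof. exact: cvg_id. Qed.

Section ContinuousAt.
Context {R : realType} {T : topologicalType}.
Implicit Types (f g : T -> R) (x : T).

Lemma contD {V : normedModType R} (f g : T -> V) x :
  {for x, continuous f} -> {for x, continuous g} ->
  {for x, continuous (fun y => f y + g y)}.
Proof. exact: continuousD. Qed.

Lemma contM f g x : {for x, continuous f} -> {for x, continuous g} ->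
  {for x, continuous (fun y => f y * g y)}.
Proof. exact: continuousM. Qed.

Lemma cont_cst {V : topologicalType} (c : V) x : {for x, continuous (fun=> c : V)}.
Proof. exact: cst_continuous. Qed.

Lemma cont_comp {V W : topologicalType} (f : T -> V) (g : V -> W) x :
  {for x, continuous f} -> {for f x, continuous g} ->
  {for x, continuous (fun y => g (f y))}.
Proof. exact: continuous_comp. Qed.

Lemma cont_sum (I : Type) (r : seq I) (P : pred I) (f : I -> T -> R) x :
  (forall i, P i -> {for x, continuous (f i)}) ->
  {for x, continuous (fun y => \sum_(i <- r | P i) f i y)}.
Proof.
move=> cf; elim: r => [|i r IH].
  rewrite (_ : (fun y => _) = fun=> 0); first exact: cont_cst.
  by apply/funext => y; rewrite big_nil.
rewrite (_ : (fun y => _) = fun y => (if P i then f i y else 0) +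
    \sum_(i <- r | P i) f i y); last first.
  by apply/funext => y; rewrite big_cons; case: ifP; rewrite ?add0r.
by apply: contD => //; case: (boolP (P i)) => [/cf//|_]; exact: cont_cst.
Qed.

Lemma cont_row m (f : T -> 'rV[R]_m) x :
  (forall j, {for x, continuous (fun y => f y 0 j)}) -> {for x, continuous f}.
Proof.
move=> cf; apply/cvgrPdist_lt => e e0.
have : \forall y \near x, forall j, `|f x 0 j - f y 0 j| < e.
  by apply: filter_forall => j; have /cvgrPdist_lt/(_ _ e0) := cf j.
apply: filterS => y fy.
rewrite /Num.Def.normr /= mx_normrE; apply/bigmax_ltP; split=> //= -[i j] _ /=.
by rewrite !mxE ord1.
Qed.

Lemma cont_coord m n (f : T -> 'M[R]_(m, n)) i j x :
  {for x, continuous f} -> {for x, continuous (fun y => f y i j : R)}.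
Proof. move=> cf.
apply: (@continuous_comp _ _ _ f (fun M : 'M[R]_(m, n) => M i j)) => //.
exact: coord_continuous. Qed.

End ContinuousAt.

Lemma derive_translate {R : realType} {V W : normedModType R} (f : V -> W)
    (x c w : V) : differentiable f (x + c) ->
  differentiable (fun y => f (y + c)) x /\
  'D_w (fun y => f (y + c)) x = 'D_w f (x + c).
Proof.
move=> df; have dsh : is_diff x (fun y : V => y + c) id.
  by apply: is_diff_eq; rewrite addr0.
have d : differentiable (f \o (fun y => y + c)) x.
  by apply: differentiable_comp.
split=> //; rewrite !deriveE //.
by rewrite (diff_comp (f := fun y => y + c)) //= diff_val.
Qed.

Section DeriveRules.
Context {R : realType} {V : normedModType R}.
Implicit Types (f g : V -> R) (x v : V).

Lemma diffsD f g x : differentiable f x -> differentiable g x ->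
  differentiable (fun y => f y + g y) x /\
  forall v, 'D_v (fun y => f y + g y) x = 'D_v f x + 'D_v g x.
Proof.
move=> df dg; split=> [|v]; first exact: differentiableD.
by rewrite -deriveD //; exact: diff_derivable.
Qed.

Lemma diffsB f g x : differentiable f x -> differentiable g x ->
  differentiable (fun y => f y - g y) x /\
  forall v, 'D_v (fun y => f y - g y) x = 'D_v f x - 'D_v g x.
Proof.
move=> df dg; split=> [|v]; first exact: differentiableB.
by rewrite -deriveB //; exact: diff_derivable.
Qed.

Lemma diffsM f g x : differentiable f x -> differentiable g x ->
  differentiable (fun y => f y * g y) x /\
  forall v, 'D_v (fun y => f y * g y) x = f x * 'D_v g x + g x * 'D_v f x.
Proof.
move=> df dg; split=> [|v]; first exact: differentiableM.
by rewrite -[LHS]/('D_v (f * g) x) deriveM //; exact: diff_derivable.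
Qed.

Lemma diffsZ c f x : differentiable f x ->
  differentiable (fun y => c * f y) x /\
  forall v, 'D_v (fun y => c * f y) x = c * 'D_v f x.
Proof.
move=> df; have [d D] := diffsM (differentiable_cst c x) df.
by split=> // v; rewrite D derive_cst mulr0 addr0.
Qed.

Lemma diffs_sum (I : Type) (r : seq I) (P : pred I) (f : I -> V -> R) x :
  (forall i, P i -> differentiable (f i) x) ->
  differentiable (fun y => \sum_(i <- r | P i) f i y) x /\
  forall v, 'D_v (fun y => \sum_(i <- r | P i) f i y) x =
    \sum_(i <- r | P i) 'D_v (f i) x.
Proof.
move=> df; elim: r => [|i r [IHd IHD]].
  have -> : (fun y => \sum_(i <- [::] | P i) f i y) = cst 0.
    by apply/funext => y; rewrite big_nil.
  by split=> [|v]; [exact: differentiable_cst|rewrite derive_cst big_nil].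
have [Pi|nPi] := boolP (P i).
  have -> : (fun y => \sum_(i <- i :: r | P i) f i y) =
      fun y => f i y + \sum_(i <- r | P i) f i y.
    by apply/funext => y; rewrite big_cons Pi.
  have [d D] := diffsD (df i Pi) IHd.
  by split=> // v; rewrite D big_cons Pi IHD.
have -> : (fun y => \sum_(i <- i :: r | P i) f i y) =
    fun y => \sum_(i <- r | P i) f i y.
  by apply/funext => y; rewrite big_cons (negbTE nPi).
by split=> // v; rewrite big_cons (negbTE nPi).
Qed.

End DeriveRules.

Section ClassC.
Context {R : realType} {n : nat}.
Implicit Types (U W : set 'rV[R]_n) (p v : 'rV[R]_n).

Lemma near_eq_differentiable {V W : normedModType R} (f g : V -> W) (p : V) :
  (\near p, f p = g p) -> differentiable f p -> differentiable g p.
Proof.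
move=> fg df; have fgp : f p = g p by exact: (nbhs_singleton fg).
have [|e e0|//] := @differentiable_intro R V W g ('d f p) p.
  exact: diff_continuous.
have /eqaddoP/(_ e e0) fo := diff_locally df.
have fg' : \forall h \near 0, f (h + p) = g (h + p).
  by have := fg; rewrite (near_shift 0) subr0.
near=> h; rewrite -fgp.
have <- : f (h + p) = g (h + p) by near: h.
have : `|(f \o shift p - (cst (f p) + 'd f p)) h| <= e * `|h| by near: h.
by congr (`|_| <= _); rewrite !fctE /= opprD addrA.
Unshelve. all: by end_near. Qed.

Lemma class_CS {V : normedModType R} k U (f : 'rV[R]_n -> V) :
  class_C k.+1 U f <->
  (forall p, U p -> differentiable f p) /\ (forall v, class_C k U ('D_v f)).
Proof. by []. Qed.

Lemma class_C_cont {V : normedModType R} k U (f : 'rV[R]_n -> V) :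
  class_C k U f -> forall p, U p -> {for p, continuous f}.
Proof.
by case: k => [|k] // [df _] p Up; exact/differentiable_continuous/df.
Qed.

Lemma class_CW {V : normedModType R} k U (f : 'rV[R]_n -> V) :
  class_C k.+1 U f -> class_C k U f.
Proof.
elim: k f => [f|k IH f [df Df]]; first exact: class_C_cont.
by split=> // v; exact/IH/Df.
Qed.

Lemma class_C_sub {V : normedModType R} k U W (f : 'rV[R]_n -> V) :
  W `<=` U -> class_C k U f -> class_C k W f.
Proof.
move=> WU; elim: k f => [|k IH] f /=; first by move=> fU p /WU/fU.
by move=> /class_CS[df Df]; split=> [p /WU/df//|v]; exact/IH/Df.
Qed.

Lemma open_near_eq {V : normedModType R} U (f g : 'rV[R]_n -> V) p :
  open U -> (forall q, U q -> f q = g q) -> U p -> \near p, f p = g p.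
Proof.
move=> oU fg Up; have : nbhs p U by apply: open_nbhs_nbhs.
by apply: filterS => q /fg.
Qed.

Lemma derive_eq_on {V : normedModType R} U (f g : 'rV[R]_n -> V) p v :
  open U -> (forall q, U q -> f q = g q) -> U p -> 'D_v f p = 'D_v g p.
Proof. by move=> oU fg Up; apply: near_eq_derive; exact: (open_near_eq oU fg Up). Qed.

(** Derivatives at a point of the open set [U] only see nearby values, so a formula for a derivative
    has to be checked on [U] alone. All inductions on the class below replace ['D_v f] by an
    explicit expression in this way. *)
Lemma class_C_eq {V : normedModType R} k U (f g : 'rV[R]_n -> V) :
  open U -> (forall q, U q -> f q = g q) -> class_C k U f -> class_C k U g.
Proof.
move=> oU; elim: k f g => [|k IH] f g fg /=.
  move=> cf p Up; rewrite /prop_for /continuous_at -fg//.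
  have /near_eq_cvg gf := open_near_eq oU fg Up.
  exact: cvg_trans gf (cf p Up).
move=> /class_CS[df Df]; split=> [p Up|v].
  by apply: near_eq_differentiable (df p Up); exact: (open_near_eq oU fg Up).
by apply: IH (Df v) => q; apply: derive_eq_on.
Qed.

Lemma class_C_cst {V : normedModType R} k U (c : V) : class_C k U (fun=> c).
Proof.
elim: k c => [|k IH] c /=; first by move=> p _; exact: cst_continuous.
split=> [p _|v]; first exact: differentiable_cst.
rewrite (_ : 'D_v _ = fun=> 0) //; apply/funext => p; exact: derive_cst.
Qed.

Lemma class_CD {V : normedModType R} k U (f g : 'rV[R]_n -> V) : open U ->
  class_C k U f -> class_C k U g -> class_C k U (fun x => f x + g x).
Proof.
move=> oU; elim: k f g => [|k IH] f g.
  by move=> cf cg p Up; apply: contD; [exact: cf|exact: cg].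
move=> /class_CS[df Df] /class_CS[dg Dg]; split=> [p Up|v].
  by apply: differentiableD; [exact: df|exact: dg].
apply: class_C_eq (IH _ _ (Df v) (Dg v)) => // q Uq.
by rewrite -deriveD //; apply: diff_derivable; [exact: df|exact: dg].
Qed.

Lemma class_CN {V : normedModType R} k U (f : 'rV[R]_n -> V) : open U ->
  class_C k U f -> class_C k U (fun x => - f x).
Proof.
move=> oU; elim: k f => [|k IH] f.
  by move=> cf p Up; apply: continuousN; exact: cf.
move=> /class_CS[df Df]; split=> [p Up|v]; first by apply: differentiableN; exact: df.
apply: class_C_eq (IH _ (Df v)) => // q Uq.
by rewrite -deriveN //; apply: diff_derivable; exact: df.
Qed.

Lemma class_CB {V : normedModType R} k U (f g : 'rV[R]_n -> V) : open U ->
  class_C k U f -> class_C k U g -> class_C k U (fun x => f x - g x).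
Proof. by move=> oU Cf Cg; apply: class_CD => //; apply: class_CN. Qed.

Lemma class_C_sum {V : normedModType R} k U (I : Type) (r : seq I) (P : pred I)
    (f : I -> 'rV[R]_n -> V) : open U -> (forall i, P i -> class_C k U (f i)) ->
  class_C k U (fun x => \sum_(i <- r | P i) f i x).
Proof.
move=> oU Cf; elim: r => [|i r IH].
  by apply: class_C_eq (class_C_cst k U 0) => // q _; rewrite big_nil.
case: (boolP (P i)) => Pi.
  apply: class_C_eq (class_CD oU (Cf i Pi) IH) => // q _.
  by rewrite big_cons Pi.
by apply: class_C_eq IH => // q _; rewrite big_cons (negbTE Pi).
Qed.

Lemma class_CM k U (f g : 'rV[R]_n -> R) : open U ->
  class_C k U f -> class_C k U g -> class_C k U (fun x => f x * g x).
Proof.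
move=> oU; elim: k f g => [|k IH] f g.
  by move=> cf cg p Up; apply: contM; [exact: cf|exact: cg].
move=> Cf Cg; have [/class_CS[df Df] /class_CS[dg Dg]] := (Cf, Cg).
split=> [p Up|v]; first by apply: differentiableM; [exact: df|exact: dg].
apply: (@class_C_eq _ _ _ (fun x => f x * 'D_v g x + g x * 'D_v f x)) => //.
  move=> q Uq; rewrite -[RHS]/('D_v (f * g) q).
  by rewrite deriveM //; apply: diff_derivable; [exact: df|exact: dg].
by apply: class_CD => //; apply: IH => //; exact: class_CW.
Qed.

Lemma class_C_prod k U (I : Type) (r : seq I) (P : pred I)
    (f : I -> 'rV[R]_n -> R) : open U -> (forall i, P i -> class_C k U (f i)) ->
  class_C k U (fun x => \prod_(i <- r | P i) f i x).
Proof.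
move=> oU Cf; elim: r => [|i r IH].
  by apply: class_C_eq (class_C_cst k U (1 : R)) => // q _; rewrite big_nil.
case: (boolP (P i)) => Pi.
  apply: class_C_eq (class_CM oU (Cf i Pi) IH) => // q _.
  by rewrite big_cons Pi.
by apply: class_C_eq IH => // q _; rewrite big_cons (negbTE Pi).
Qed.

Lemma class_CV k U (f : 'rV[R]_n -> R) : open U ->
  (forall p, U p -> f p != 0) -> class_C k U f -> class_C k U (fun x => (f x)^-1).
Proof.
move=> oU f0; elim: k => [|k IH].
  by move=> cf p Up; apply: continuousV; [exact: f0|exact: cf].
move=> Cf; have /class_CS[df Df] := Cf.
split=> [p Up|v]; first by apply: differentiableV; [exact: df|exact: f0].
have CV := IH (class_CW Cf).
apply: (@class_C_eq _ _ _ (fun x => - ((f x)^-1 * (f x)^-1 * 'D_v f x))) => //.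
  move=> q Uq; rewrite -[RHS]/('D_v (fun y => (f y)^-1) q).
  rewrite deriveV ?f0 //; last by apply: diff_derivable; exact: df.
  by rewrite /GRing.scale /= expr2 invfM mulNr.
by apply: class_CN => //; apply: class_CM => //; apply: class_CM.
Qed.

Lemma class_CZl {V : normedModType R} k U (f : 'rV[R]_n -> R) (u : V) : open U ->
  class_C k U f -> class_C k U (fun x => f x *: u).
Proof.
move=> oU; elim: k f => [|k IH] f.
  by move=> cf p Up; apply: continuousZr_tmp; exact: cf.
move=> /class_CS[df Df]; split=> [p Up|v]; first by apply: differentiableZl; exact: df.
apply: class_C_eq (IH _ (Df v)) => // q Uq.
rewrite !deriveE; [by rewrite diffZl //; exact: df| |exact: df].
by apply: differentiableZl; exact: df.
Qed.

Lemma derive_coord m v p (f : 'rV[R]_n -> 'rV[R]_m) j : differentiable f p ->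
  'D_v (fun x => f x 0 j) p = ('D_v f p) 0 j.
Proof. by move=> df; rewrite derive_mx ?mxE//; exact: diff_derivable. Qed.

Lemma differentiable_coordP m p (f : 'rV[R]_n -> 'rV[R]_m) :
  differentiable f p <-> forall j, differentiable (fun x => f x 0 j) p.
Proof.
split=> [df j|df].
  apply: (@differentiable_comp _ _ _ _ f (fun M : 'rV[R]_m => M 0 j : R)) => //.
  exact: differentiable_coord.
rewrite (_ : f = \sum_(j < m) (fun x => f x 0 j *: delta_mx 0 j)).
  by apply: differentiable_sum => j; exact: differentiableZl.
by apply/funext => x; rewrite [LHS]row_sum_delta fct_sumE.
Qed.

Lemma class_C_rV m k U (f : 'rV[R]_n -> 'rV[R]_m) : open U ->
  class_C k U f <-> forall j, class_C k U (fun x => f x 0 j).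
Proof.
move=> oU; split=> [+ j|].
  elim: k f => [|k IH] f.
    move=> cf p Up; exact/cont_coord/cf.
  move=> /class_CS[df Df]; split=> [p Up|v]; first exact: ((differentiable_coordP _ _).1 (df p Up)).
  apply: class_C_eq (IH _ (Df v)) => // q Uq.
  by rewrite derive_coord //; exact: df.
move=> Cf; apply: (@class_C_eq _ _ _ (fun x => \sum_j f x 0 j *: delta_mx 0 j)).
- by [].
- by move=> q _; rewrite -row_sum_delta.
- by apply: class_C_sum => // j _; exact: class_CZl.
Qed.

Lemma class_C_coord k U j : class_C k U (fun x : 'rV[R]_n => x 0 j : R).
Proof.
case: k => [|k]; first by move=> p _; exact: coord_continuous.
split=> [p _|v]; first exact: differentiable_coord.
rewrite (_ : 'D_v _ = fun=> v 0 j); first exact: class_C_cst.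
by apply/funext => p; rewrite (derive_coord _ j (f := id)) // derive_id.
Qed.

Lemma derive_basis {V : normedModType R} p v (f : 'rV[R]_n -> V) :
  differentiable f p -> 'D_v f p = \sum_i v 0 i *: 'D_(delta_mx 0 i) f p.
Proof.
move=> df; rewrite deriveE // {1}(row_sum_delta v) linear_sum.
by apply: eq_bigr => i _; rewrite linearZ deriveE.
Qed.

End ClassC.

Section ClassCComp.
Context {R : realType} {n m : nat}.
Implicit Types (U : set 'rV[R]_n) (W : set 'rV[R]_m).

Lemma derive_comp {V : normedModType R} (f : 'rV[R]_n -> 'rV[R]_m)
    (g : 'rV[R]_m -> V) p v : differentiable f p -> differentiable g (f p) ->
  'D_v (fun x => g (f x)) p = 'D_('D_v f p) g (f p).
Proof.
move=> df dg; rewrite deriveE; last exact: differentiable_comp.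
by rewrite (diff_comp df dg) /= [in RHS]deriveE // (deriveE _ df).
Qed.

(** In coordinates the chain rule is a sum of products of [('D_v f) 0 j] with a partial derivative
    of [g] composed with [f]. The induction therefore generalises over [g] and keeps [f] fixed,
    lowering only its class. *)
Lemma class_C_comp k U W (f : 'rV[R]_n -> 'rV[R]_m) (g : 'rV[R]_m -> R) :
  open U -> open W -> (forall x, U x -> W (f x)) ->
  class_C k U f -> class_C k W g -> class_C k U (fun x => g (f x)).
Proof.
move=> oU oW UW; elim: k g => [|k IH] g.
  by move=> cf cg p Up; apply: continuous_comp (cf p Up) (cg _ (UW _ Up)).
move=> Cf Cg; have [/class_CS[df Df] /class_CS[dg Dg]] := (Cf, Cg).
split=> [p Up|v].
  by apply: differentiable_comp; [exact: df|apply: dg; exact: UW].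
apply: (@class_C_eq _ _ _ _ _ (fun x => \sum_j
   ('D_v f x) 0 j * 'D_(delta_mx 0 j) g (f x))) => //.
  move=> q Uq; rewrite derive_comp; [|exact: df|by apply: dg; exact: UW].
  by rewrite [RHS]derive_basis //; apply: dg; exact: UW.
apply: class_C_sum => // j _; apply: class_CM => //; last first.
  by apply: IH (Dg _); exact: class_CW.
by move: j; apply/class_C_rV.
Qed.

Lemma class_C_compV l k U W (f : 'rV[R]_n -> 'rV[R]_m)
    (g : 'rV[R]_m -> 'rV[R]_l) : open U -> open W -> (forall x, U x -> W (f x)) ->
  class_C k U f -> class_C k W g -> class_C k U (fun x => g (f x)).
Proof.
move=> oU oW UW Cf Cg; apply/class_C_rV => // j.
apply: (class_C_comp (g := fun x => g x 0 j) oU oW UW Cf _).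
by have /(class_C_rV _ _ oW)/(_ j) := Cg.
Qed.

End ClassCComp.

Section ClassCMore.
Context {R : realType} {n : nat}.
Implicit Types (U W : set 'rV[R]_n) (p v : 'rV[R]_n).

Lemma class_C_expR k U (f : 'rV[R]_n -> R) : open U ->
  class_C k U f -> class_C k U (fun x => expR (f x)).
Proof.
move=> oU; elim: k => [|k IH].
  by move=> cf p Up; apply: continuous_comp (cf p Up) _; exact: continuous_expR.
move=> Cf; have /class_CS[df Df] := Cf.
have dexp x : differentiable (@expR R) x.
  by apply/derivable1_diffP; exact: derivable_expR.
split=> [p Up|v].
  by apply: (@differentiable_comp _ _ _ _ f expR) => //; exact: df.
apply: (@class_C_eq _ _ _ _ _ (fun x => 'D_v f x * expR (f x))) => //.
  move=> q Uq; have dfq := df q Uq.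
  rewrite [RHS]deriveE; last exact: (@differentiable_comp _ _ _ _ f expR).
  rewrite (@diff_comp _ _ _ _ f expR) //= diff1E // -deriveE //.
  by rewrite derive1E derive_val.
by apply: class_CM => //; apply: IH; exact: class_CW.
Qed.

Lemma class_C_det k U m (M : 'rV[R]_n -> 'M[R]_m) : open U ->
  (forall i j, class_C k U (fun x => M x i j)) -> class_C k U (fun x => \det (M x)).
Proof.
move=> oU CM; apply: class_C_sum => // s _; apply: class_CM => //.
  exact: class_C_cst.
by apply: class_C_prod.
Qed.

(** Cramer's rule: the entries are quotients of determinants. *)
Lemma class_C_invmx k U m (M : 'rV[R]_n -> 'M[R]_m) i j : open U ->
  (forall x, U x -> M x \in unitmx) ->
  (forall i j, class_C k U (fun x => M x i j)) ->
  class_C k U (fun x => invmx (M x) i j).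
Proof.
move=> oU uM CM.
apply: (@class_C_eq _ _ _ _ _ (fun x => (\det (M x))^-1 * cofactor (M x) j i)).
- by [].
- by move=> q Uq; rewrite /invmx uM // !mxE.
apply: class_CM => //.
  apply: class_CV => //; last exact: class_C_det.
  by move=> p /uM; rewrite unitmxE unitfE.
rewrite /cofactor; apply: class_CM => //; first exact: class_C_cst.
apply: class_C_det => // i' j'; case: m => [|m] in M uM CM i j i' j' *.
  by case: i.
by apply: class_C_eq (CM (lift j i') (lift i j')) => // q _; rewrite !mxE.
Qed.

(** Replacing [C i h] by [C i 0] changes the increment by the norm of [h] times a quantity that
    tends to 0 by continuity of the coefficients. Thus an exact increment formula yields a
    derivative without any second order estimate. *)
Lemma caratheodory (f : 'rV[R]_n -> R) (C : 'I_n -> 'rV[R]_n -> R) x :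
  (\forall h \near (0 : 'rV[R]_n), f (h + x) - f x = \sum_i h 0 i * C i h) ->
  (forall i, {for 0, continuous (C i)}) ->
  differentiable f x /\ forall v, 'D_v f x = \sum_i v 0 i * C i 0.
Proof.
move=> fC cC; pose l (v : 'rV[R]_n) : R := \sum_i v 0 i * C i 0.
have ll : linear l.
  move=> a u v; rewrite /l scaler_sumr -big_split; apply: eq_bigr => i _ /=.
  by rewrite !mxE mulrDl -mulrA.
pose lM := GRing.isLinear.Build _ _ _ _ _ ll.
pose L : {linear 'rV[R]_n -> R} := HB.pack l lM.
have cL : continuous L.
  move=> v; apply: (@class_C_cont _ _ _ 0 setT) => //.
  apply: class_C_sum => // [|i _]; first exact: openT.
  by apply: class_CM; [exact: openT|exact: class_C_coord|exact: class_C_cst].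
have [|df dE] := @differentiable_intro R _ _ f L x cL; last first.
  by split=> // v; rewrite deriveE // dE.
(* The sum has [n] terms; dividing by [n.+1] also covers [n = 0]. *)
move=> e e0; have d0 : 0 < e / n.+1%:R by rewrite divr_gt0.
have cC' : \forall h \near (0 : 'rV[R]_n), forall i, `|C i 0 - C i h| < e / n.+1%:R.
  by apply: near_forall_ord => i; have /cvgrPdist_lt/(_ _ d0) := cC i.
near=> h.
have -> : f (h + x) - f x = \sum_i h 0 i * C i h by near: h.
rewrite /L /= /l -sumrB (le_trans (ler_norm_sum _ _ _)) //.
apply: (@le_trans _ _ (\sum_(i < n) `|h| * (e / n.+1%:R))).
  apply: ler_sum => i _; rewrite -mulrBr normrM ler_pM //.
    rewrite [leRHS]/Num.Def.normr /= mx_normrE.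
    by apply: (le_bigmax _ (fun ij => `|h ij.1 ij.2|) (0, i)).
  by rewrite distrC ltW //; move: i; near: h.
rewrite sumr_const card_ord; apply: le_trans (_ : (e * `|h|) * (n%:R / n.+1%:R) <= _).
  by rewrite le_eqVlt; apply/orP; left; apply/eqP; rewrite -mulr_natr; ring.
rewrite ler_piMr //; first by rewrite mulr_ge0 ?(ltW e0).
by rewrite ler_pdivrMr // mul1r ler_nat.
Unshelve. all: by end_near. Qed.

Lemma class_C_mulmx m k U (A : 'M[R]_(n, m)) : open U ->
  class_C k U (fun x : 'rV[R]_n => x *m A).
Proof.
move=> oU; apply/class_C_rV => // j.
apply: (@class_C_eq _ _ _ _ _ (fun x => \sum_i x 0 i * A i j)) => //.
  by move=> q _; rewrite mxE.
apply: class_C_sum => // i _; apply: class_CM => //; first exact: class_C_coord.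
exact: class_C_cst.
Qed.

Lemma differentiable_mulmx m (A : 'M[R]_(n, m)) (x : 'rV[R]_n) :
  differentiable (fun x : 'rV[R]_n => x *m A) x.
Proof.
have /class_CS[d _] := @class_C_mulmx m 1 setT A openT.
exact: d.
Qed.

Lemma derive_mulmx m (A : 'M[R]_(n, m)) (x v : 'rV[R]_n) :
  'D_v (fun x : 'rV[R]_n => x *m A) x = v *m A.
Proof.
rewrite deriveE; last exact: differentiable_mulmx.
have cA : continuous (mulmxr A : 'rV[R]_n -> 'rV[R]_m).
  by move=> y; apply: differentiable_continuous; exact: differentiable_mulmx.
by rewrite (diff_lin (f := mulmxr A) x cA).
Qed.

Lemma derive_comp_mulmx m (V : normedModType R) (g : 'rV[R]_m -> V)
    (A : 'M[R]_(n, m)) (x v : 'rV[R]_n) : differentiable g (x *m A) ->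
  'D_v (fun x => g (x *m A)) x = 'D_(v *m A) g (x *m A).
Proof.
move=> dg; rewrite (@derive_comp R n m V (fun x => x *m A) g) ?derive_mulmx //.
exact: differentiable_mulmx.
Qed.

End ClassCMore.

(** * Integrals depending on a parameter *)

Section Int01.
Context {R : realType}.
Implicit Types (f g F : R -> R).
Local Notation mu := (@lebesgue_measure R).

Definition int01 f : R := \int[mu]_(t in `[0, 1]) f t.

Definition cont01 f := forall t, 0 <= t <= 1 -> {for t, continuous f}.

Lemma cont01_within f : cont01 f -> {within `[0, 1], continuous f}.
Proof.
move=> cf; apply: continuous_in_subspaceT => t.
by rewrite inE /= in_itv /= => /cf.
Qed.

Lemma cont01_integrable f : cont01 f -> mu.-integrable `[0, 1] (EFin \o f).
Proof.
move=> cf; apply: continuous_compact_integrable; first exact: segment_compact.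
exact: cont01_within.
Qed.

Lemma eq_int01 f g : (forall t, 0 <= t <= 1 -> f t = g t) -> int01 f = int01 g.
Proof.
by move=> fg; apply: eq_Rintegral => t; rewrite inE /= in_itv /= => /fg.
Qed.

Lemma int01D f g : cont01 f -> cont01 g ->
  int01 (fun t => f t + g t) = int01 f + int01 g.
Proof. by move=> cf cg; apply: RintegralD => //; exact: cont01_integrable. Qed.

Lemma int01Z f c : cont01 f -> int01 (fun t => c * f t) = c * int01 f.
Proof. by move=> cf; apply: RintegralZl => //; exact: cont01_integrable. Qed.

Lemma int01_cst c : int01 (fun=> c) = c.
Proof.
rewrite /int01 Rintegral_cst //= lebesgue_measure_itv /= lte_fin ltr01.
by rewrite oppr0 adde0 /= mulr1.
Qed.

Lemma int01B f g : cont01 f -> cont01 g ->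
  int01 (fun t => f t - g t) = int01 f - int01 g.
Proof. by move=> cf cg; apply: RintegralB => //; exact: cont01_integrable. Qed.

Lemma int01_sum (I : Type) (r : seq I) (P : pred I) (f : I -> R -> R) :
  (forall i, P i -> cont01 (f i)) ->
  int01 (fun t => \sum_(i <- r | P i) f i t) = \sum_(i <- r | P i) int01 (f i).
Proof.
move=> cf; elim: r => [|i r IH].
  by rewrite big_nil -[RHS]int01_cst; apply: eq_int01 => t _; rewrite big_nil.
rewrite big_cons; case: ifP => Pi.
  rewrite -IH -int01D; last 2 first.
  - exact: cf.
  - by move=> t t01; apply: cont_sum => j /cf; exact.
  by apply: eq_int01 => t _; rewrite big_cons Pi.
by rewrite -IH; apply: eq_int01 => t _; rewrite big_cons Pi.
Qed.

Lemma ler_int01 f g : cont01 f -> cont01 g ->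
  (forall t, 0 <= t <= 1 -> f t <= g t) -> int01 f <= int01 g.
Proof.
move=> cf cg fg.
apply: le_Rintegral; [by []|exact: cont01_integrable..|].
by move=> t /=; rewrite in_itv /= => /fg.
Qed.

Lemma ler_norm_int01 f M : cont01 f -> (forall t, 0 <= t <= 1 -> `|f t| <= M) ->
  `|int01 f| <= M.
Proof.
move=> cf fM; have cc c : cont01 (fun=> c : R) by move=> t _; exact: cont_cst.
rewrite ler_norml; apply/andP; split.
  rewrite -[leLHS]int01_cst; apply: ler_int01 => // t /fM.
  by rewrite ler_norml => /andP[].
rewrite -[leRHS]int01_cst; apply: ler_int01 => // t /fM.
by rewrite ler_norml => /andP[].
Qed.

Lemma is_derive_cont F (t d : R) : is_derive t 1 F d -> {for t, continuous F}.
Proof. by move=> [dF _]; exact/differentiable_continuous/derivable1_diffP. Qed.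

Lemma int01_FTC2 f F : cont01 f ->
  (forall t : R, 0 <= t <= 1 -> is_derive t 1 F (f t)) -> int01 f = F 1 - F 0.
Proof.
move=> cf dF; have cF : cont01 F by move=> t /dF/is_derive_cont.
rewrite /int01 /Rintegral (continuous_FTC2 (F := F)) //=.
- exact: cont01_within.
- have /(continuous_within_itvP _ (@ltr01 R))[cF0 cF1 cF2] := cont01_within cF.
  split=> // t; rewrite in_itv /= => /andP[t0 t1].
  by have [] := dF t; rewrite ?ltW.
- move=> t; rewrite in_itv /= => /andP[t0 t1].
  by rewrite derive1E; have [|_ ->] := dF t; rewrite ?ltW.
Qed.

Lemma is_derive_mulr (u c : R) : is_derive u 1 (fun t => t * c) c.
Proof.
have -> : (fun t => t * c) = (id : R -> R) * cst c by [].
by apply: is_derive_eq; rewrite scaler0 add0r /GRing.scale /= mulr1.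
Qed.

(** The last clause is the substitution that rewrites the integral from 0 to [t] as one over
    [0, 1]. *)
Lemma int01_prim f : cont01 f -> exists F,
  [/\ F 0 = 0, forall t : R, 0 <= t <= 1 -> is_derive t 1 F (f t) &
      forall t, 0 <= t <= 1 -> F t = t * int01 (fun u => f (u * t))].
Proof.
(* Clamping the argument extends [f] continuously to the whole line. Integrating from -1 to below 2
   then makes 0 and 1 interior points, where the primitive has two-sided derivatives. *)
move=> cf; pose fc t := f (Num.max 0 (Num.min 1 t)).
have fcE t : 0 <= t <= 1 -> fc t = f t.
  by move=> /andP[t0 t1]; rewrite /fc min_r // max_r.
have cfc : continuous fc.
  move=> t; apply: (@cont_comp R R R (fun t => Num.max 0 (Num.min 1 t)) f t).
    apply: (@continuous_max _ _ (fun=> 0)); first exact: cont_cst.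
    by apply: (@continuous_min _ _ (fun=> 1)); [exact: cont_cst|exact: cvg_id].
  by apply: cf; rewrite le_max lexx /= ge_max ler01 ge_min lexx.
have ifc : mu.-integrable `[-1, 2] (EFin \o fc).
  apply: continuous_compact_integrable; first exact: segment_compact.
  exact: continuous_subspaceT.
pose G (t : R) := \int[mu]_(u in `[-1, t]) fc u.
pose F (t : R) := G t - G 0.
have dF (t : R) : 0 <= t <= 1 -> is_derive t 1 F (f t).
  move=> t01; have /andP[t0 t1] := t01.
  have [||dG] := @continuous_FTC1_closed R fc (-1) t 2 _ ifc _ (cfc t).
  - by rewrite (le_lt_trans t1) // ltr1n.
  - by rewrite (lt_le_trans _ t0) // ltrN10.
  rewrite derive1E => dGE; rewrite -(fcE t t01).
  rewrite -[fc t]subr0 /F; apply: is_deriveB.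
  by rewrite -dGE; exact/derivableP.
have F0 : F 0 = 0 by rewrite /F subrr.
exists F; split=> // t /andP[t0 t1].
have ct u : 0 <= u <= 1 -> 0 <= u * t <= 1.
  by move=> /andP[u0 u1]; rewrite mulr_ge0 // mulr_ile1.
have cfu : cont01 (fun u => f (u * t)).
  move=> u u01; apply: (@cont_comp R R R (fun u => u * t)); last exact/cf/ct.
  exact: mulrr_continuous.
have -> : t * int01 (fun u => f (u * t)) = F (1 * t) - F (0 * t).
  rewrite -int01Z //; apply: (int01_FTC2 (F := fun u => F (u * t))).
    by move=> u u01; apply: contM; [exact: cont_cst|exact: cfu].
  move=> u u01; rewrite mulrC.
  apply: (@is_derive1_comp _ F (fun u => u * t)); first exact/dF/ct.
  exact: is_derive_mulr.
by rewrite mul1r mul0r F0 subr0.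
Qed.

(** Compactness of [0, 1] turns joint continuity at the points (t, x) into closeness of [g (t, y)]
    to [g (t, x)] uniformly in t (tube lemma). *)
Lemma int01_param_cont {T : topologicalType} (g : R * T -> R) (x : T) :
  (forall t, 0 <= t <= 1 -> {for (t, x), continuous g}) ->
  (\forall y \near x, cont01 (fun t => g (t, y))) ->
  {for x, continuous (fun y => int01 (fun t => g (t, y)))}.
Proof.
move=> cg cgy; apply/cvgrPdist_le => e e0; have e20 : 0 < e / 2 by rewrite divr_gt0.
have /compact_near_coveringP cpt : compact (`[0, 1] : set R) by exact: segment_compact.
have cgx : cont01 (fun t => g (t, x)) by exact: (nbhs_singleton cgy).
have H : \forall y \near x, `[0, 1] `<=` (fun t => `|g (t, x) - g (t, y)| <= e).
  apply: cpt => t; rewrite /= in_itv /= => t01.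
  have /cvgrPdist_lt/(_ _ e20) [[A B] /= [At Bx] AB] := cg t t01.
  exists (A, B); first by split.
  move=> [t' y] [/= At' By].
  have h1 := AB (t', y) (conj At' By).
  have h2 := AB (t', x) (conj At' (nbhs_singleton Bx)).
  rewrite (splitr e) (le_trans (ler_distD (g (t, x)) _ _)) // lerD ?ltW //.
  by rewrite distrC.
near=> y; rewrite -int01B //; last by near: y.
apply: ler_norm_int01; last first.
  move=> t t01; suff : [set` `[0, 1]] t by move: t {t01}; near: y.
  by rewrite /= in_itv.
move=> t t01; apply: contD; first exact: cgx.
apply: continuousN; move: t t01; near: y; exact: cgy.
Unshelve. all: by end_near. Qed.

End Int01.

(** * Averages along segments *)

Section SegmentTop.
Context {R : realType} {V : normedModType R}.
Implicit Types (U : set V) (x y : V).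

Definition segment_in U x y := forall t : R, 0 <= t <= 1 -> U (x + t *: (y - x)).

Definition int_segment (g : V -> R) x y : R := int01 (fun t => g (x + t *: (y - x))).

Lemma cont_segment {T : topologicalType} (t : T -> R) (a b : T -> V) z :
  {for z, continuous t} -> {for z, continuous a} -> {for z, continuous b} ->
  {for z, continuous (fun z => a z + t z *: (b z - a z))}.
Proof.
move=> ct ca cb; apply: contD => //; apply: continuousZ => //.
exact: continuousB.
Qed.

Lemma near_segment U x y : open U -> segment_in U x y ->
  \forall p \near (x, y), segment_in U p.1 p.2.
Proof.
move=> oU sU.
have /compact_near_coveringP cpt : compact (`[0, 1] : set R) by exact: segment_compact.
have : \forall p \near nbhs (x, y),
    `[0, 1] `<=` (fun t : R => U (p.1 + t *: (p.2 - p.1))).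
  apply: (cpt _ (nbhs (x, y)) (fun p t => U (p.1 + t *: (p.2 - p.1)))) => t.
  rewrite /= in_itv /= => t01.
  have : nbhs (x + t *: (y - x)) U by apply: open_nbhs_nbhs; split=> //; exact: sU.
  apply: (@cont_segment (R * (V * V))%type fst (fun q => q.2.1) (fun q => q.2.2)
    (t, (x, y))).
  - exact: cont_fst.
  - by apply: (cont_comp (f := snd)); [exact: cont_snd|exact: cont_fst].
  - by apply: (cont_comp (f := snd)); [exact: cont_snd|exact: cont_snd].
by apply: filterS => p H t t01; apply: H; rewrite /= in_itv.
Qed.

Lemma near_segment_comp {T : topologicalType} U (a b : T -> V) z : open U ->
  {for z, continuous a} -> {for z, continuous b} -> segment_in U (a z) (b z) ->
  \forall z' \near z, segment_in U (a z') (b z').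
Proof. by move=> oU ca cb /(near_segment oU)/(cont_pair ca cb). Qed.

Lemma cont01_line (g : V -> R) U x y : segment_in U x y ->
  (forall p, U p -> {for p, continuous g}) -> cont01 (fun t => g (x + t *: (y - x))).
Proof.
move=> sU cg t t01.
apply: (cont_comp (f := fun t : R => x + t *: (y - x))); last exact/cg/sU.
by apply: cont_segment; [exact: cont_id|exact: cont_cst|exact: cont_cst].
Qed.

Lemma int_segment_cont (g : V -> R) U {T : topologicalType} (a b : T -> V) z :
  open U -> (forall p, U p -> {for p, continuous g}) ->
  {for z, continuous a} -> {for z, continuous b} -> segment_in U (a z) (b z) ->
  {for z, continuous (fun z => int_segment g (a z) (b z))}.
Proof.
move=> oU cg ca cb sU.
apply: (@int01_param_cont R T (fun q => g (a q.2 + q.1 *: (b q.2 - a q.2)))).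
  move=> t t01.
  apply: (cont_comp (f := fun q : R * T => a q.2 + q.1 *: (b q.2 - a q.2))).
    apply: cont_segment; first exact: cont_fst.
    - by apply: (cont_comp (f := snd)); [exact: cont_snd|].
    - by apply: (cont_comp (f := snd)); [exact: cont_snd|].
  by apply: cg; exact: sU.
by have := near_segment_comp oU ca cb sU; apply: filterS => p sp; exact: cont01_line sp cg.
Qed.

End SegmentTop.

Section IntParamTop.
Context {R : realType} {T V : topologicalType}.

Lemma cont01_comp (g : V -> R) (a : R * T -> V) (S : set V) z :
  (forall p, S p -> {for p, continuous g}) ->
  (forall t, 0 <= t <= 1 -> {for (t, z), continuous a}) ->
  (forall t, 0 <= t <= 1 -> S (a (t, z))) -> cont01 (fun t => g (a (t, z))).
Proof.
move=> cg ca sa t t01.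
apply: (cont_comp (f := fun t => a (t, z))); last by apply: cg; exact: sa.
apply: (cont_comp (f := fun t => (t, z))); last exact: ca.
by apply: cont_pair; [exact: cont_id|exact: cont_cst].
Qed.

Lemma int01_comp_cont (g : V -> R) (a : R * T -> V) (S : set V) z :
  (forall p, S p -> {for p, continuous g}) ->
  (\forall y \near z, forall t, 0 <= t <= 1 -> {for (t, y), continuous a}) ->
  (\forall y \near z, forall t, 0 <= t <= 1 -> S (a (t, y))) ->
  {for z, continuous (fun y => int01 (fun t => g (a (t, y))))}.
Proof.
move=> cg ca sa.
apply: (@int01_param_cont R T (fun q => g (a q))).
  move=> t t01; apply: cont_comp; first exact: (nbhs_singleton ca).
  by apply: cg; exact: (nbhs_singleton sa).
near=> y; apply: cont01_comp cg _ _; near: y => //.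
Unshelve. all: by end_near. Qed.

End IntParamTop.

(** * Hadamard's increment formula *)

Section Segment.
Context {R : realType} {n : nat}.
Implicit Types (U : set 'rV[R]_n) (x y h v : 'rV[R]_n).

Lemma is_derive_line (f : 'rV[R]_n -> R) x v (t : R) :
  differentiable f (x + t *: v) ->
  is_derive t 1 (fun u : R => f (x + u *: v)) ('D_v f (x + t *: v)).
Proof.
move=> df; have dfv : derivable f (x + t *: v) v by exact: diff_derivable.
have E : (fun h : R => h^-1 *: (f (x + (h *: 1 + t) *: v) - f (x + t *: v))) =
         (fun h : R => h^-1 *: (f (h *: v + (x + t *: v)) - f (x + t *: v))).
  apply/funext => h; congr (_ *: (f _ - _)).
  by rewrite scalerDl /GRing.scale /= mulr1 addrCA.
by apply: DeriveDef; rewrite /derivable /derive /= E.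
Qed.

Lemma int_segmentxx (g : 'rV[R]_n -> R) x : int_segment g x x = g x.
Proof.
rewrite -[RHS]int01_cst; apply: eq_int01 => t _.
by rewrite subrr scaler0 addr0.
Qed.

Lemma segment_FTC (f : 'rV[R]_n -> R) U x y : class_C 1 U f -> segment_in U x y ->
  f y - f x = int_segment ('D_(y - x) f) x y.
Proof.
move=> /class_CS[df Df] sU; apply/esym/etrans.
  apply: (@int01_FTC2 _ _ (fun t => f (x + t *: (y - x)))) => [|t t01].
    exact: cont01_line sU (Df _).
  by apply: is_derive_line; exact/df/sU.
by rewrite /= scale1r scale0r addr0 [x + _]addrC subrK.
Qed.

(** Hadamard's coefficient: the mean of the i-th partial derivative over the segment from [x] to
    [y]. It is continuous in both end points and equals the partial derivative on the diagonal. *)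
Definition slope (f : 'rV[R]_n -> R) (i : 'I_n) x y : R :=
  int_segment ('D_(delta_mx 0 i) f) x y.

Lemma slopexx f i x : slope f i x x = 'D_(delta_mx 0 i) f x.
Proof.
exact: int_segmentxx.
Qed.

Lemma slopeE (f : 'rV[R]_n -> R) U x y : class_C 1 U f -> segment_in U x y ->
  f y - f x = \sum_i (y - x) 0 i * slope f i x y.
Proof.
move=> Cf sU; have /class_CS[df Df] := Cf.
have cD v : cont01 (fun t => 'D_v f (x + t *: (y - x))) by exact: cont01_line sU (Df _).
rewrite (segment_FTC Cf sU).
under eq_bigr do rewrite -int01Z //.
rewrite -int01_sum; last first.
  by move=> i _ t t01; apply: contM; [exact: cont_cst|exact: cD].
apply: eq_int01 => t t01; rewrite derive_basis //.
exact/df/sU.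
Qed.

Lemma slope_cont (f : 'rV[R]_n -> R) i U {T : topologicalType}
    (a b : T -> 'rV[R]_n) z : open U -> class_C 1 U f ->
  {for z, continuous a} -> {for z, continuous b} -> segment_in U (a z) (b z) ->
  {for z, continuous (fun z => slope f i (a z) (b z))}.
Proof.
move=> oU /class_CS[_ Df] ca cb sU.
exact: (int_segment_cont oU (Df _) ca cb sU).
Qed.

End Segment.

(** * Differentiation under the integral sign *)

Section IntParam.
Context {R : realType} {n : nat}.
Implicit Types (U : set 'rV[R]_n) (S : set 'rV[R]_(1 + n)) (x y h v : 'rV[R]_n).

(** The integration variable and the parameter form a single row vector, so that [class_C] expresses
    the joint regularity of the integrand. *)
Definition int_param (G : 'rV[R]_(1 + n) -> R) x : R :=
  int01 (fun t => G (row_mx t%:M x)).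

Definition slab S U := forall t x, 0 <= t <= 1 -> U x -> S (row_mx t%:M x).

Lemma cont_row_mx {T : topologicalType} (a : T -> R) (b : T -> 'rV[R]_n) (p : T) :
  {for p, continuous a} -> {for p, continuous b} ->
  {for p, continuous (fun q => row_mx (a q)%:M (b q) : 'rV[R]_(1 + n))}.
Proof.
move=> ca cb; apply: cont_row => j.
case: (splitP j) => k jk.
  have -> : j = lshift n k by exact/val_inj.
  rewrite (_ : (fun _ => _) = a) //.
  by apply/funext => y; rewrite row_mxEl !ord1 mxE.
have -> : j = rshift 1 k by exact/val_inj.
rewrite (_ : (fun _ => _) = (fun y : T => b y 0 k)); first exact: cont_coord.
by apply/funext => y; rewrite row_mxEr.
Qed.

Lemma cont_row_mx2 (q : R * 'rV[R]_n) :
  {for q, continuous (fun q : R * 'rV[R]_n => row_mx q.1%:M q.2 : 'rV[R]_(1 + n))}.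
Proof. by apply: cont_row_mx; [exact: cont_fst|exact: cont_snd]. Qed.

Lemma cont01_slab S U G x : slab S U -> class_C 0 S G -> U x ->
  cont01 (fun t => G (row_mx t%:M x)).
Proof.
move=> SU cG Ux.
apply: (cont01_comp (a := fun q : R * 'rV[R]_n => row_mx q.1%:M q.2) cG).
  by move=> t t01; exact: cont_row_mx2.
by move=> t t01; exact: SU.
Qed.

Lemma int_param_cont S U G : open S -> open U -> slab S U -> class_C 0 S G ->
  class_C 0 U (int_param G).
Proof.
move=> oS oU SU cG x Ux.
have nU : nbhs x U by apply: open_nbhs_nbhs.
apply: (int01_comp_cont (a := fun q : R * 'rV[R]_n => row_mx q.1%:M q.2) cG).
  by apply: filterS nU => y _ t _; exact: cont_row_mx2.
by apply: filterS nU => y Uy t t01; exact: SU.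
Qed.

(** For each t the increment of the integrand is given by Hadamard's formula. Integrating its
    coefficients over t gives an increment formula for the integral, to which [caratheodory]
    applies. *)
Lemma int_param_diff S U G x : open S -> open U -> slab S U -> class_C 1 S G ->
  U x -> differentiable (int_param G) x /\
  forall v, 'D_v (int_param G) x = int_param ('D_(row_mx 0 v) G) x.
Proof.
move=> oS oU SU CG Ux; have /class_CS[dG DG] := CG.
have C0 : class_C 0 S G by exact: class_CW.
pose sl (i : 'I_n) (q : R * 'rV[R]_n) :=
  slope G (rshift 1 i) (row_mx q.1%:M x) (row_mx q.1%:M (q.2 + x)).
pose C i h := int01 (fun t => sl i (t, h)).
have lin t (a b : 'rV[R]_n) (u : R) :
    row_mx t%:M a + u *: (row_mx t%:M b - row_mx t%:M a) =
    row_mx t%:M (a + u *: (b - a)) :> 'rV[R]_(1 + n).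
  by rewrite opp_row_mx add_row_mx scale_row_mx add_row_mx subrr scaler0 addr0.
have cshift h : {for h, continuous (fun h => h + x)}.
  by apply: contD; [exact: cont_id|exact: cont_cst].
have nearU : \forall h \near (0 : 'rV[R]_n), segment_in U x (h + x).
  apply: (near_segment_comp (a := fun=> x) oU); [exact: cont_cst|exact: cshift|].
  by move=> t _; rewrite add0r subrr scaler0 addr0.
have sS t h : 0 <= t <= 1 -> segment_in U x (h + x) ->
    segment_in S (row_mx t%:M x) (row_mx t%:M (h + x)).
  by move=> t01 sh u u01; rewrite lin; apply: SU => //; exact: sh.
have cC t h i : 0 <= t <= 1 -> segment_in U x (h + x) ->
    {for (t, h), continuous (sl i)}.
  move=> t01 sh; apply: (slope_cont oS CG); last exact: sS.
    by apply: cont_row_mx; [exact: cont_fst|exact: cont_cst].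
  apply: cont_row_mx; first exact: cont_fst.
  by apply: contD; [exact: cont_snd|exact: cont_cst].
have s0 : segment_in U x (0 + x) by exact: (nbhs_singleton nearU).
have cC1 i h : segment_in U x (h + x) -> cont01 (fun t => sl i (t, h)).
  move=> sh t t01.
  apply: (@cont_comp _ _ _ (fun t : R => (t, h)) (sl i)); last exact: cC.
  by apply: cont_pair; [exact: cont_id|exact: cont_cst].
have Ch i : {for 0, continuous (C i)}.
  apply: (@int01_param_cont R _ (sl i)).
    by move=> t t01; exact: cC.
  by apply: filterS nearU => h sh; exact: cC1.
have [|dI DI] := @caratheodory R n (int_param G) C x _ Ch; last first.
  split=> // v; rewrite DI.
  rewrite (eq_bigr _ (fun i _ => esym (int01Z _ (cC1 i 0 s0)))) -int01_sum; last first.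
    by move=> i _ t t01; apply: contM; [exact: cont_cst|exact: cC1].
  apply: eq_int01 => t t01; rewrite [RHS]derive_basis; last exact/dG/SU.
  rewrite big_split_ord /= big_ord1 row_mxEl mxE scale0r add0r.
  by apply: eq_bigr => i _; rewrite row_mxEr /sl add0r slopexx.
near=> h; have sh : segment_in U x (h + x) by near: h.
have Uhx : U (h + x).
  by have := sh 1; rewrite scale1r [x + _]addrC subrK; apply; rewrite ler01 lexx.
rewrite /int_param -int01B; [|exact: cont01_slab SU C0 _|exact: cont01_slab SU C0 _].
rewrite (eq_bigr _ (fun i _ => esym (int01Z _ (cC1 i h sh)))) -int01_sum; last first.
  by move=> i _ t t01; apply: contM; [exact: cont_cst|exact: cC1].
apply: eq_int01 => t t01; rewrite (slopeE CG (sS t h t01 sh)).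
rewrite big_split_ord /= big_ord1 opp_row_mx add_row_mx row_mxEl subrr mxE mul0r add0r.
by apply: eq_bigr => i _; rewrite row_mxEr addrK.
Unshelve. all: by end_near. Qed.

Lemma class_C_int_param k S U G : open S -> open U -> slab S U ->
  class_C k S G -> class_C k U (int_param G).
Proof.
move=> oS oU SU; elim: k G => [|k IH] G; first exact: int_param_cont.
move=> CG; have CG1 : class_C 1 S G.
  by elim: k CG {IH} => // k IH /class_CW.
have D x Ux := int_param_diff oS oU SU CG1 (x := x) Ux.
split=> [x Ux|v]; first exact: (D x Ux).1.
have /class_CS[_ DG] := CG.
apply: class_C_eq (IH _ (DG (row_mx 0 v))) => // x Ux.
by rewrite (D x Ux).2.
Qed.

End IntParam.

(** * Symmetry of second derivatives *)

Section Schwarz.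
Context {R : realType} {n : nat}.
Implicit Types (U : set 'rV[R]_n) (x v : 'rV[R]_n).

(** Write f(y + s v) - f(y) as s times the mean of ['D_v f] over the segment, apply ['D_w] under the
    integral, divide by s and let s tend to 0: the left side tends to ['D_v ('D_w f) x], the right
    side to ['D_w ('D_v f) x]. *)
Lemma schwarz (f : 'rV[R]_n -> R) U x v w : open U -> class_C 2 U f -> U x ->
  'D_v ('D_w f) x = 'D_w ('D_v f) x.
Proof.
move=> oU Cf Ux; have [/class_CS[df Df] C1f] := (Cf, class_CW Cf).
have dDf u p : U p -> differentiable ('D_u f) p.
  by have /class_CS[d _] := Df u; exact: d.
have DDc u u' : forall p, U p -> {for p, continuous ('D_u ('D_u' f))}.
  by have /class_CS[_ /(_ u)] := Df u'.
have sx : segment_in U x (x + 0 *: v) by move=> t _; rewrite scale0r addr0 subrr scaler0 addr0.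
have nU : nbhs x U by apply: open_nbhs_nbhs.
have cl (s : R) : {for s, continuous (fun s : R => x + s *: v)}.
  apply: contD; first exact: cont_cst.
  by apply: continuousZr_tmp; exact: cont_id.
have nears : \forall s \near (0 : R), segment_in U x (x + s *: v).
  by apply: (near_segment_comp (a := fun=> x) oU); [exact: cont_cst|exact: cl|].
have key : \forall s \near (0 : R), 'D_w f (x + s *: v) - 'D_w f x =
    s * int_segment ('D_w ('D_v f)) x (x + s *: v).
  near=> s; have ss : segment_in U x (x + s *: v) by near: s.
  (* The linear map (t, y) |-> y + t s v, which puts the mean in the form [int_param]. *)
  pose A := col_mx (s *: v) 1%:M : 'M[R]_(1 + n, n).
  have AE t y : row_mx t%:M y *m A = y + t *: ((y + s *: v) - y).
    by rewrite mul_row_col mulmx1 mul_scalar_mx addrC (addrC y (s *: v)) addrK.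
  pose G q := 'D_v f (q *m A).
  pose S := [set q : 'rV[R]_(1 + n) | U (q *m A)].
  have oS : open S.
    apply: open_comp => // q _; apply: differentiable_continuous.
    exact: differentiable_mulmx.
  pose U' := interior [set y | segment_in U y (y + s *: v)].
  have oU' : open U' by exact: open_interior.
  have SU : slab S U'.
    by move=> t y t01 /interior_subset/(_ t t01); rewrite /S /= AE.
  have U'x : U' x.
    apply: (near_segment_comp (a := fun y => y) (b := fun y => y + s *: v) oU _ _ ss).
      exact: cont_id.
    by apply: contD; [exact: cont_id|exact: cont_cst].
  have CG : class_C 1 S G.
    by apply: (class_C_comp oS oU _ (class_C_mulmx _ _ oS) (Df v)).
  have [dG DG] := int_param_diff oS oU' SU CG U'x.
  have E y : U' y -> f (y + s *: v) - f y = s * int_param G y.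
    move=> U'y; have sy : segment_in U y (y + s *: v) by exact: (interior_subset U'y).
    rewrite (segment_FTC C1f sy) -int01Z; last by apply: (cont01_slab SU _ U'y); exact: class_CW CG.
    apply: eq_int01 => t t01; rewrite /G AE; have dp := df _ (sy t t01).
    by rewrite !deriveE // [y + _ - _]addrAC subrr add0r linearZ.
  have DGw : int_param ('D_(row_mx 0 w) G) x =
      int_segment ('D_w ('D_v f)) x (x + s *: v).
    apply: eq_int01 => t t01.
    transitivity ('D_(row_mx 0 w *m A) ('D_v f) (row_mx t%:M x *m A)).
      by apply: (@derive_comp_mulmx R _ n _ ('D_v f)); apply: dDf; exact: SU.
    by rewrite AE mul_row_col mul0mx add0r mulmx1.
  have Uxs : U (x + s *: v).
    by have := ss 1; rewrite scale1r addrC subrK; apply; rewrite ler01 lexx.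
  have [dfs Dfs] := derive_translate w (df _ Uxs).
  have := derive_eq_on w oU' E U'x.
  have -> : 'D_w (fun y => s * int_param G y) x = s * 'D_w (int_param G) x.
    exact: (diffsZ s dG).2.
  have -> : 'D_w (fun y => f (y + s *: v) - f y) x = 'D_w f (x + s *: v) - 'D_w f x.
    by rewrite (diffsB dfs (df x Ux)).2 Dfs.
  move=> ->; rewrite DG DGw //.
have ci : {for (0 : R), continuous (fun s : R => int_segment ('D_w ('D_v f)) x (x + s *: v))}.
  by apply: (int_segment_cont oU (DDc w v)); [exact: cont_cst|exact: cl|].
transitivity ('D_v ('D_w f) (x + 0 *: v)); first by rewrite scale0r addr0.
have [|_ <-] := is_derive_line (v := v) (t := 0) (f := 'D_w f) (x := x).
  by rewrite scale0r addr0; exact: dDf.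
apply/cvg_lim => //; rewrite -(int_segmentxx ('D_w ('D_v f)) x).
pose J (s : R) := int_segment ('D_w ('D_v f)) x (x + s *: v).
have cJ : J h @[h --> 0^'] --> int_segment ('D_w ('D_v f)) x x.
  have := ci; rewrite /prop_for /continuous_at scale0r addr0 => cJ0.
  by apply: cvg_trans cJ0; apply: cvg_app; exact: nbhs_dnbhs.
apply: cvg_trans cJ; apply: near_eq_cvg; near=> h.
have hn0 : h != 0 by near: h; exact: nbhs_dnbhs_neq.
rewrite /= addr0 scale0r addr0 [h *: 1]mulr1.
have -> : 'D_w f (x + h *: v) - 'D_w f x = h * J h.
  by near: h; apply: nbhs_dnbhs; exact: key.
by rewrite /GRing.scale /= mulKf.
Unshelve. all: by end_near. Qed.

End Schwarz.

(** * The inverse function theorem *)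

(** The equation x - phi x = z says that x is a fixed point of x |-> phi x + z. On the closed ball
    of radius [rho], half of the radius pays for the displacement of [z] and half for the variation
    of [phi], so this contraction preserves the ball. *)
Lemma perturbed_id_onto {R : realType} {V : completeNormedModType R} (phi : V -> V)
    (B : set V) x1 (rho : R) : 0 < rho ->
  (forall x, `|x1 - x| <= rho -> B x) ->
  (forall x x', B x -> B x' -> `|phi x' - phi x| <= 2^-1 * `|x' - x|) ->
  forall z, `|z - (x1 - phi x1)| <= 2^-1 * rho -> exists2 x, B x & x - phi x = z.
Proof.
move=> rho0 rB phiB z zr.
pose K : set V := closed_ball_ Num.norm x1 rho.
pose T x := phi x + z.
have Bx1 : B x1 by apply: rB; rewrite subrr normr0 ltW.
have TK : set_fun K K T.
  move=> x /= Kx; rewrite /K /closed_ball_ /= /T.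
  have -> : x1 - (phi x + z) = - (z - (x1 - phi x1) + (phi x - phi x1)).
    by rewrite !opprD !opprK addrACA subrK [RHS]addrC [in RHS](addrC (- z)).
  rewrite normrN (le_trans (ler_normD _ _)) //.
  have -> : rho = 2^-1 * rho + 2^-1 * rho by rewrite -mulrDl -{1 2}[2^-1]mul1r -splitr mul1r.
  apply: lerD => //; apply: le_trans (phiB _ _ Bx1 (rB _ Kx)) _.
  by rewrite ler_wpM2l ?invr_ge0 // distrC.
pose Tf : {fun K >-> K} := HB.pack T (isFun.Build _ _ K K T TK).
have cT : is_contraction Tf.
  exists (2^-1)%:nng; split; first by rewrite /= invf_lt1 ?ltr1n.
  move=> [x y] /= [Kx Ky]; rewrite /T opprD addrACA subrr addr0.
  by apply: phiB; exact: rB.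
have [||p Kp pE] := @banach_fixed_point R V K Tf cT.
- exact: closed_closed_ball_.
- by exists x1; rewrite /K /closed_ball_ /= subrr normr0 ltW.
exists p; first exact: rB.
by rewrite {1}pE /= /T addrC addKr.
Qed.

Section RowNorm.
Context {R : realType}.

Lemma coord_le_norm m n (x : 'M[R]_(m, n)) i j : `|x i j| <= `|x|.
Proof.
rewrite [leRHS]/Num.Def.normr /= mx_normrE.
exact: (le_bigmax _ (fun ij => `|x ij.1 ij.2|) (i, j)).
Qed.

Lemma row_norm_le n (x : 'rV[R]_n) (c : R) : 0 <= c -> (forall i, `|x 0 i| <= c) ->
  `|x| <= c.
Proof.
move=> c0 xc; rewrite [leLHS]/Num.Def.normr /= mx_normrE.
by apply: bigmax_le => // -[i j] _ /=; rewrite ord1.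
Qed.

Lemma mulmx_norm_le m n (x : 'rV[R]_m) (E : 'M[R]_(m, n)) (e : R) : 0 <= e ->
  (forall i j, `|E i j| <= e) -> `|x *m E| <= m%:R * e * `|x|.
Proof.
move=> e0 Ee; apply: row_norm_le => [|j]; first by rewrite !mulr_ge0.
rewrite mxE (le_trans (ler_norm_sum _ _ _)) //.
apply: (@le_trans _ _ (\sum_(i < m) `|x| * e)).
  by apply: ler_sum => i _; rewrite normrM ler_pM // coord_le_norm.
by rewrite sumr_const card_ord le_eqVlt -mulr_natl; apply/orP; left; apply/eqP; ring.
Qed.

End RowNorm.

Lemma cont_dominated {R : realType} {T : topologicalType} {V W : normedModType R}
    (g : T -> V) (a : T -> W) y (K : R) : 0 < K -> {for y, continuous a} ->
  (\forall y' \near y, `|g y - g y'| <= K * `|a y - a y'|) -> {for y, continuous g}.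
Proof.
move=> K0 ca gK; apply/cvgrPdist_lt => d d0.
have dK : 0 < d / K by rewrite divr_gt0.
have /cvgrPdist_lt/(_ _ dK) ad := ca.
near=> y'; apply: (@le_lt_trans _ _ (K * `|a y - a y'|)); first by near: y'.
by rewrite mulrC -ltr_pdivlMr //; near: y'.
Unshelve. all: by end_near. Qed.

HB.instance Definition _ (R : realType) (n : nat) :=
  Uniform_isComplete.Build 'rV[R]_n.+1 cauchy_cvg.

Section InverseFunction.
Context {R : realType} {n' : nat}.
Local Notation n := n'.+1.
Implicit Types (U V : set 'rV[R]_n) (f : 'rV[R]_n -> 'rV[R]_n).

(** The transpose of the usual Jacobian matrix: its rows are the partial derivatives, and the
    differential acts on row vectors by right multiplication. *)
Definition jac f x : 'M[R]_n := \matrix_i 'D_(delta_mx 0 i) f x.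

Lemma derive_jac f x v : differentiable f x -> 'D_v f x = v *m jac f x.
Proof.
move=> df; rewrite derive_basis // mulmx_sum_row.
by apply: eq_bigr => i _; rewrite rowK.
Qed.

Lemma jacE f x i j : differentiable f x ->
  jac f x i j = 'D_(delta_mx 0 i) (fun y => f y 0 j) x.
Proof. by move=> df; rewrite mxE derive_coord. Qed.

Definition slope_mx f x y : 'M[R]_n :=
  \matrix_(i, j) slope (fun z => f z 0 j) i x y.

Lemma slope_mxE f U x y : open U -> class_C 1 U f -> segment_in U x y ->
  f y - f x = (y - x) *m slope_mx f x y.
Proof.
move=> oU Cf sU; apply/rowP => j; rewrite !mxE.
have Cj : class_C 1 U (fun z => f z 0 j) by move: Cf => /(class_C_rV _ _ oU)/(_ j).
rewrite (slopeE Cj sU).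
by apply: eq_bigr => i _; rewrite !mxE.
Qed.

Lemma segment_ball (a x y : 'rV[R]_n) r : ball a r x -> ball a r y ->
  segment_in (ball a r) x y.
Proof.
rewrite -ball_normE /= => ax ay t /andP[t0 t1].
rewrite /ball_ /=.
have -> : a - (x + t *: (y - x)) = (1 - t) *: (a - x) + t *: (a - y).
  rewrite scalerBl scale1r opprD addrA -!addrA; congr (_ + (_ + _)).
  rewrite -!scalerN -scalerDr; congr (_ *: _).
  by rewrite !opprB addrA subrK.
apply: le_lt_trans (ler_normD _ _) _; rewrite !normrZ !ger0_norm ?subr_ge0 //.
have [->|t_n0] := eqVneq t 0; first by rewrite subr0 mul1r mul0r addr0.
have h1 : (1 - t) * `|a - x| <= (1 - t) * r by rewrite ler_wpM2l ?subr_ge0 // ltW.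
have h2 : t * `|a - y| < t * r by rewrite ltr_pM2l // lt_def t_n0.
lra.
Qed.

(** Everything rests on f y - f x = (y - x) *m [slope_mx f x y], whose matrix is close to the
    Jacobian at [x0] when x and y are. Hence [phi], the identity minus f *m A, contracts by 1/2,
    which gives injectivity and an open image. Inverting the slope matrix gives an increment formula
    for the inverse map. *)
Theorem inverse_function f U x0 : open U -> U x0 -> smooth U f ->
  jac f x0 \in unitmx ->
  exists V g, [/\ open V, V x0, V `<=` U, open (f @` V) &
    [/\ smooth (f @` V) g, forall x, V x -> g (f x) = x &
        forall x, V x -> jac f x \in unitmx]].
Proof.
move=> oU Ux0 sf uJ; have Cf := sf 1; have /class_CS[df Df] := Cf.
(* With entries bounded by [e], an n by n matrix at most halves the norm of a row vector
   ([mulmx_norm_le]). *)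
pose A := invmx (jac f x0); pose e : R := (2 * n%:R)^-1.
have e0 : 0 < e by rewrite invr_gt0 mulr_gt0.
pose E x y := 1%:M - slope_mx f x y *m A.
have sx0 : segment_in U x0 x0 by move=> t _; rewrite subrr scaler0 addr0.
have E0 : E x0 x0 = 0.
  rewrite /E (_ : slope_mx f x0 x0 = jac f x0) ?mulmxV ?subrr //.
  by apply/matrixP => i j; rewrite [LHS]mxE slopexx jacE //; exact: df.
have nE : \forall p \near (x0, x0), forall i j, `|E p.1 p.2 i j| < e.
  apply: near_forall_ord => i; apply: near_forall_ord => j.
  have cE : {for (x0, x0), continuous (fun p => E p.1 p.2 i j)}.
    rewrite (_ : (fun p => _) = fun p : 'rV[R]_n * 'rV[R]_n => (1%:M i j : R) +
        \sum_k - A k j * slope (fun z => f z 0 k) i p.1 p.2); last first.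
      apply/funext => p; rewrite !mxE -sumrN; congr (_ + _).
      by apply: eq_bigr => k _; rewrite mxE mulNr mulrC.
    apply: contD; first exact: cont_cst.
    apply: cont_sum => k _; apply: contM; first exact: cont_cst.
    have Ck : class_C 1 U (fun z => f z 0 k).
      by move: Cf => /(class_C_rV _ _ oU)/(_ k).
    have := @slope_cont R n (fun z => f z 0 k) i U ('rV[R]_n * 'rV[R]_n)%type
      fst snd (x0, x0) oU Ck.
    by apply; [exact: cont_fst|exact: cont_snd|exact: sx0].
  have /cvgrPdist_lt/(_ e e0) := cE; apply: filterS => p.
  by rewrite /= E0 [X in `|X - _|]mxE sub0r normrN.
have [r r0 [BU BE]] : exists2 r : R, 0 < r & ball x0 r `<=` U /\
    forall x y : 'rV[R]_n, ball x0 r x -> ball x0 r y -> forall i j, `|E x y i j| < e.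
  have [[P Q] /= [Px Qx] PQ] := nE.
  have : nbhs x0 (P `&` Q `&` U).
    by apply: filterI; [exact: filterI|exact: open_nbhs_nbhs].
  move=> /nbhs_ballP[r /= r0 rB]; exists r => //; split=> [x /rB[]//|x y bx by_].
  have [[Px' _] _] := rB _ bx; have [[_ Qy] _] := rB _ by_.
  exact: (PQ (x, y)).
pose B : set 'rV[R]_n := ball x0 r; pose phi (x : 'rV[R]_n) := x - f x *m A.
have oB : open B by exact: ball_open.
have sB (x y : 'rV[R]_n) : B x -> B y -> segment_in U x y.
  by move=> bx by_ t t01; apply: BU; exact: segment_ball.
have phiE (x y : 'rV[R]_n) : B x -> B y -> phi y - phi x = (y - x) *m E x y.
  move=> bx by_; rewrite mulmxBr mulmx1 mulmxA -(slope_mxE oU Cf (sB x y bx by_)).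
  by rewrite mulmxBl /phi !opprD !opprK addrACA.
have normE (v x y : 'rV[R]_n) : B x -> B y -> `|v *m E x y| <= 2^-1 * `|v|.
  move=> bx by_; apply: le_trans (mulmx_norm_le _ (ltW e0) _) _.
    by move=> i j; rewrite ltW //; exact: BE.
  by rewrite /e invfM mulrCA mulfV ?mulr1 // pnatr_eq0.
have phiB (x y : 'rV[R]_n) : B x -> B y -> `|phi y - phi x| <= 2^-1 * `|y - x|.
  by move=> bx by_; rewrite phiE //; exact: normE.
have half0 (a : R) : 0 <= a -> a <= 2^-1 * a -> a = 0.
  move=> a0 ah; apply/le_anti; rewrite a0 andbT; lra.
have uM (x y : 'rV[R]_n) : B x -> B y -> slope_mx f x y \in unitmx.
  (* A kernel vector of the slope matrix is fixed by [E x y], which halves norms, so it is zero. *)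
  move=> bx by_; rewrite -row_free_unit -kermx_eq0; apply/rowV0P => v /sub_kermxP vM.
  have vE : v = v *m E x y by rewrite mulmxBr mulmx1 mulmxA vM mul0mx subr0.
  by apply/normr0_eq0/half0 => //; rewrite {1}vE; exact: normE.
have uA : A \in unitmx by rewrite unitmx_inv.
have lipA (x y : 'rV[R]_n) : B x -> B y -> `|y - x| <= 2 * `|(f y - f x) *m A|.
  move=> bx by_; have := phiB x y bx by_.
  have -> : phi y - phi x = (y - x) - (f y - f x) *m A.
    by rewrite /phi mulmxBl !opprD !opprK addrACA.
  have := ler_normD (y - x - (f y - f x) *m A) ((f y - f x) *m A).
  by rewrite subrK => h1 h2; lra.
have injB (x y : 'rV[R]_n) : B x -> B y -> f x = f y -> x = y.
  move=> bx by_ fxy; have := lipA x y bx by_.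
  by rewrite fxy subrr mul0mx normr0 mulr0 normr_le0 subr_eq0 => /eqP.
pose Y := f @` B.
have oY : open Y.
  rewrite openE => _ [x1 Bx1 <-]; rewrite /interior.
  have [rho /= rho0 rhoB] : exists2 rho : R, 0 < rho & forall x, `|x1 - x| <= rho -> B x.
    have : nbhs x1 B by apply: open_nbhs_nbhs.
    move=> /nbhs_ballP[rho /= rho0 rhoB]; exists (rho / 2); first by rewrite divr_gt0.
    move=> x xr; apply: rhoB; rewrite -ball_normE /ball_ /=.
    by rewrite (le_lt_trans xr) // ltr_pdivrMr // ltr_pMr // ltr1n.
  have cA : {for f x1, continuous (fun y : 'rV[R]_n => y *m A)}.
    exact/differentiable_continuous/differentiable_mulmx.
  have rho20 : 0 < 2^-1 * rho by rewrite mulr_gt0 // invr_gt0.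
  have /cvgrPdist_le/(_ _ rho20) := cA; apply: filterS => y yA.
  (* Since x - phi x = f x *m A, solving for [y *m A] gives f x = y. *)
  have [|x bx xE] := perturbed_id_onto rho0 rhoB phiB (z := y *m A).
    by rewrite /phi subKr distrC.
  exists x => //; apply: (can_inj (mulmxK uA)).
  by rewrite -xE /phi subKr.
pose g (y : 'rV[R]_n) := xget x0 (B `&` [set x | f x = y]).
have gP (y : 'rV[R]_n) : Y y -> B (g y) /\ f (g y) = y.
  by move=> [x bx fx]; rewrite /g; case: xgetP => [z -> []//|/(_ x)[]].
have gf (x : 'rV[R]_n) : B x -> g (f x) = x.
  by move=> bx; have [bg fg] := gP (f x) (ex_intro2 _ _ x bx erefl); exact: injB.
have cg : class_C 0 Y g.
  move=> y Yy; have cA : {for y, continuous (fun y : 'rV[R]_n => y *m A)}.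
    exact/differentiable_continuous/differentiable_mulmx.
  apply: (cont_dominated (K := 2) _ cA) => //.
  have : nbhs y Y by apply: open_nbhs_nbhs.
  apply: filterS => y' Yy'; have [[bg fg] [bg' fg']] := (gP y Yy, gP y' Yy').
  by rewrite -mulmxBl -{2}fg -{2}fg'; exact: lipA.
have dg (y v : 'rV[R]_n) : Y y -> differentiable g y /\ 'D_v g y = v *m invmx (jac f (g y)).
  move=> Yy; have [bg fg] := gP y Yy.
  have jE : slope_mx f (g y) (g y) = jac f (g y).
    by apply/matrixP => i j; rewrite [LHS]mxE slopexx jacE //; exact/df/BU.
  pose Y0 := [set h : 'rV[R]_n | Y (h + y)].
  have cs (h : 'rV[R]_n) : {for h, continuous (fun h : 'rV[R]_n => h + y)}.
    by apply: contD; [exact: cont_id|exact: cont_cst].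
  have oY0 : open Y0 by apply: open_comp oY => h _; exact: cs.
  have Y00 : Y0 0 by rewrite /Y0 /= add0r.
  pose M (h : 'rV[R]_n) := slope_mx f (g y) (g (h + y)).
  have CM i j : class_C 0 Y0 (fun h => M h i j).
    move=> h Y0h; rewrite /M /slope_mx.
    rewrite (_ : (fun _ => _) = fun h : 'rV[R]_n =>
       slope (fun z => f z 0 j) i (g y) (g (h + y))); last first.
      by apply/funext => k; rewrite mxE.
    have Cj : class_C 1 U (fun z => f z 0 j) by move: Cf => /(class_C_rV _ _ oU)/(_ j).
    have [bgh _] := gP _ Y0h.
    apply: (slope_cont oU Cj); [exact: cont_cst| |exact: sB].
    by apply: (cont_comp (f := fun h : 'rV[R]_n => h + y)); [exact: cs|exact: cg].
  have uMh (h : 'rV[R]_n) : Y0 h -> M h \in unitmx by move=> /gP[bgh _]; exact: uM.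
  have CI i j := class_C_invmx i j oY0 uMh CM.
  (* Hadamard's formula for [f] between [g y] and [g (h + y)] reads h = (g (h + y) - g y) *m M h.
     Inverting [M h] expresses the increment of [g] with coefficients continuous in h. *)
  have key j : differentiable (fun y => g y 0 j) y /\
      forall v, 'D_v (fun y => g y 0 j) y = \sum_i v 0 i * invmx (M 0) i j.
    apply: caratheodory (fun i h => invmx (M h) i j) _ _ _ => [|i]; last exact: CI.
    have : nbhs (0 : 'rV[R]_n) Y0 by apply: open_nbhs_nbhs.
    apply: filterS => h Y0h; have [bgh fgh] := gP _ Y0h.
    have : h = (g (h + y) - g y) *m M h.
      by rewrite -(slope_mxE oU Cf (sB _ _ bg bgh)) fgh fg addrK.
    have := mulmxK (uMh h Y0h) (g (h + y) - g y); move=> + hE; rewrite -hE => hI.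
    have -> : g (h + y) 0 j - g y 0 j = (g (h + y) - g y) 0 j by rewrite !mxE.
    rewrite -hI.
    by rewrite mxE.
  have dgy : differentiable g y by apply/differentiable_coordP => j; have [] := key j.
  split=> //; apply/rowP => j; rewrite -derive_coord // (key j).2.
  by rewrite [RHS]mxE /M add0r jE.
have ujac (x : 'rV[R]_n) : B x -> jac f x \in unitmx.
  move=> bx; rewrite (_ : jac f x = slope_mx f x x); first exact: uM.
  by apply/matrixP => i j; rewrite [RHS]mxE slopexx jacE //; exact/df/BU.
(* The derivative of [g] is a smooth function of [g], hence as regular as [g] itself. *)
have sg : smooth Y g.
  elim=> [|k IH]; first exact: cg.
  split=> [y Yy|v]; first by have [] := dg y 0 Yy.
  apply: (@class_C_eq _ _ _ _ _ (fun y => v *m invmx (jac f (g y)))) => //.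
    by move=> y Yy; have [_ ->] := dg y v Yy.
  apply/class_C_rV => // j.
  apply: (@class_C_eq _ _ _ _ _ (fun y => \sum_i v 0 i * invmx (jac f (g y)) i j)) => //.
    by move=> y Yy; rewrite mxE.
  apply: class_C_sum => // i _; apply: class_CM => //; first exact: class_C_cst.
  have uY y : Y y -> jac f (g y) \in unitmx by move=> /gP[bg _]; exact: ujac.
  refine (class_C_invmx (M := fun y => jac f (g y)) i j oY uY _) => i' j'.
  have YB y : Y y -> B (g y) by move=> /gP[].
  refine (class_C_comp (g := fun x => jac f x i' j') oY oB YB IH _).
  refine (class_C_eq (f := fun x => ('D_(delta_mx 0 i') f x) 0 j') oB _ _).
    by move=> x _; rewrite mxE.
  have /class_CS[_ /(_ (delta_mx 0 i'))] := sf k.+1.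
  by move=> /(class_C_sub BU)/(class_C_rV _ _ oB)/(_ j').
exists B, g; split=> //; exact: ballxx.
Unshelve. all: by end_near. Qed.

End InverseFunction.

(** * Radial primitives *)

Section Dilation.
Context {R : realType} {n : nat}.
Variable J : pred 'I_n.
Implicit Types (Q : set 'rV[R]_n) (q v : 'rV[R]_n) (s t : R).

Definition tang : 'M[R]_n := diag_mx (\row_j (J j)%:R).

Lemma tangE q j : (q *m tang) 0 j = if J j then q 0 j else 0.
Proof. by rewrite mul_mx_diag !mxE; case: (J j); rewrite ?mulr1 ?mulr0. Qed.

(** A homothety in the [J]-coordinates; the others act as parameters, so radial constructions are
    carried out in all slices at once. Written as an affine function of [s], it is a line in the
    sense of [is_derive_line]. *)
Definition dil s q := q - q *m tang + s *: (q *m tang).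

Lemma dilE s q j : dil s q 0 j = if J j then s * q 0 j else q 0 j.
Proof.
have E (a b c : 'rV[R]_n) : (a - b + s *: c) 0 j = a 0 j - b 0 j + s * c 0 j.
  by rewrite !mxE.
rewrite /dil E !tangE.
by case: (J j); rewrite ?subrr ?add0r // mulr0 subr0 addr0.
Qed.

Lemma dil1 q : dil 1 q = q.
Proof. by apply/rowP => j; rewrite dilE mul1r if_same. Qed.

Lemma dil_dil s t q : dil s (dil t q) = dil (s * t) q.
Proof. by apply/rowP => j; rewrite !dilE; case: (J j); rewrite ?mulrA. Qed.

Lemma dil_tang s q : dil s q *m tang = s *: (q *m tang).
Proof. by apply/rowP => j; rewrite [RHS]mxE !tangE dilE; case: (J j); rewrite ?mulr0. Qed.

Lemma dil_basis s i : dil s (delta_mx 0 i) = (if J i then s else 1) *: delta_mx 0 i.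
Proof.
apply/rowP => j; rewrite dilE !mxE eqxx /=.
have [->|] := eqVneq j i; first by case: (J i); rewrite ?mulr1.
by rewrite !mulr0 if_same.
Qed.

Lemma dil_norm s q : 0 <= s <= 1 -> `|dil s q| <= `|q|.
Proof.
move=> /andP[s0 s1]; apply: row_norm_le => // j; rewrite dilE.
case: (J j); last exact: coord_le_norm.
rewrite normrM ger0_norm //.
by apply: le_trans (coord_le_norm q 0 j); rewrite ler_piMl.
Qed.

Definition star Q := forall s q, 0 <= s <= 1 -> Q q -> Q (dil s q).

Lemma star_ball r : star (ball 0 r).
Proof.
move=> s q s01; rewrite -ball_normE /ball_ /= !sub0r !normrN.
by apply: le_lt_trans; exact: dil_norm.
Qed.

Definition dil_row (r : 'rV[R]_(1 + n)) : 'rV[R]_n := dil (r 0 (lshift n 0)) (rsubmx r).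

Lemma dil_row_mx s q : dil_row (row_mx s%:M q) = dil s q.
Proof. by rewrite /dil_row row_mxKr row_mxEl mxE. Qed.

Lemma class_C_dil_row k : class_C k setT dil_row.
Proof.
have oT : open (setT : set 'rV[R]_(1 + n)) by exact: openT.
apply/class_C_rV => // j.
have Cr : class_C k setT (fun r : 'rV[R]_(1 + n) => (rsubmx r) 0 j).
  refine (class_C_eq (f := fun r => r 0 (rshift 1 j)) oT _ _).
    by move=> r _; rewrite mxE.
  exact: class_C_coord.
have [Jj|nJj] := boolP (J j).
  refine (class_C_eq (f := fun r => r 0 (lshift n 0) * (rsubmx r) 0 j) oT _ _).
    by move=> r _; rewrite /dil_row dilE Jj.
  by apply: class_CM => //; exact: class_C_coord.
by apply: class_C_eq oT _ Cr => r _; rewrite /dil_row dilE (negbTE nJj).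
Qed.

Lemma derive_dil_row s q v : 'D_(row_mx 0 v) dil_row (row_mx s%:M q) = dil s v.
Proof.
have [d _] := @class_C_dil_row 1.
have dq := d (row_mx s%:M q) I.
apply/rowP => j; rewrite -derive_coord // dilE.
have dc : differentiable (fun r : 'rV[R]_(1 + n) => r 0 (rshift 1 j)) (row_mx s%:M q).
  exact: differentiable_coord.
have E : 'D_(row_mx 0 v) (fun r : 'rV[R]_(1 + n) => r 0 (rshift 1 j)) (row_mx s%:M q) = v 0 j.
  by rewrite (derive_coord _ _ (f := id)) // derive_id row_mxEr.
case: ifP => Jj.
  have -> : (fun r => dil_row r 0 j) = fun r => r 0 (lshift n 0) * r 0 (rshift 1 j).
    by apply/funext => r; rewrite /dil_row dilE Jj mxE.
  have dl : differentiable (fun r : 'rV[R]_(1 + n) => r 0 (lshift n 0)) (row_mx s%:M q).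
    exact: differentiable_coord.
  rewrite (diffsM dl dc).2 E (derive_coord _ _ (f := id)) // derive_id.
  by rewrite !row_mxEl !mxE mulr0 addr0.
have -> : (fun r => dil_row r 0 j) = fun r => r 0 (rshift 1 j) => //.
by apply/funext => r; rewrite /dil_row dilE Jj mxE.
Qed.

Lemma dil_cont (p : R * 'rV[R]_n) :
  {for p, continuous (fun p : R * 'rV[R]_n => dil p.1 p.2)}.
Proof.
apply: cont_row => j.
have cj (x : R * 'rV[R]_n) : {for x, continuous (fun p : R * 'rV[R]_n => p.2 0 j)}.
  by apply: cont_coord; exact: cont_snd.
have [Jj|nJj] := boolP (J j).
  rewrite (_ : (fun _ => _) = fun p : R * 'rV[R]_n => p.1 * p.2 0 j).
    by apply: contM; [exact: cont_fst|exact: cj].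
  by apply/funext => y; rewrite dilE Jj.
rewrite (_ : (fun _ => _) = fun p : R * 'rV[R]_n => p.2 0 j) //.
by apply/funext => y; rewrite dilE (negbTE nJj).
Qed.

Definition avg (g : 'rV[R]_n -> R) q := int01 (fun s => g (dil s q)).

Lemma class_C_avg k Q g : open Q -> star Q -> class_C k Q g -> class_C k Q (avg g).
Proof.
move=> oQ sQ Cg; pose S := [set r | Q (dil_row r)].
have oS : open S.
  by apply: open_comp oQ => r _; apply: (class_C_cont (class_C_dil_row 0)).
have SQ : slab S Q by move=> s q s01 Qq; rewrite /S /= dil_row_mx; exact: sQ.
have CG : class_C k S (fun r => g (dil_row r)).
  apply: (class_C_comp oS oQ _ _ Cg) => //.
  by apply: class_C_sub (class_C_dil_row k).
apply: class_C_eq oQ _ (class_C_int_param oS oQ SQ CG) => q Qq.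
by rewrite /int_param; under eq_int01 => s _ do rewrite dil_row_mx.
Qed.

Lemma derive_avg Q g q v : open Q -> star Q -> class_C 1 Q g -> Q q ->
  'D_v (avg g) q = int01 (fun s => 'D_(dil s v) g (dil s q)).
Proof.
move=> oQ sQ Cg Qq; pose S := [set r | Q (dil_row r)].
have oS : open S.
  by apply: open_comp oQ => r _; apply: (class_C_cont (class_C_dil_row 0)).
have SQ : slab S Q by move=> s p s01 Qp; rewrite /S /= dil_row_mx; exact: sQ.
have CG : class_C 1 S (fun r => g (dil_row r)).
  have CS : class_C 1 S dil_row by apply: class_C_sub (class_C_dil_row 1).
  by refine (class_C_comp oS oQ _ CS Cg) => r.
have E : avg g = int_param (fun r => g (dil_row r)).
  by apply/funext => p; rewrite /int_param; under eq_int01 => s _ do rewrite dil_row_mx.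
rewrite E (int_param_diff oS oQ SQ CG Qq).2; apply: eq_int01 => s s01.
have [d _] := @class_C_dil_row 1.
have [dg _] := Cg.
have dgs : differentiable g (dil_row (row_mx s%:M q)).
  by apply: dg; rewrite dil_row_mx; exact: sQ.
by rewrite (derive_comp (f := dil_row) (g := g) _ (d _ I) dgs) derive_dil_row dil_row_mx.
Qed.

Lemma cont01_dil Q (g : 'rV[R]_n -> R) q : star Q -> class_C 0 Q g -> Q q ->
  cont01 (fun s => g (dil s q)).
Proof.
move=> sQ cg Qq.
apply: (cont01_comp (a := fun p : R * 'rV[R]_n => dil p.1 p.2) cg) => t t01.
  exact: dil_cont.
exact: sQ.
Qed.

Lemma is_derive_dil Q (g : 'rV[R]_n -> R) q s : class_C 1 Q g -> Q (dil s q) ->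
  is_derive s 1 (fun s => g (dil s q)) ('D_(q *m tang) g (dil s q)).
Proof. by move=> [dg _] Qq; apply: is_derive_line; exact: dg. Qed.

(** The integrand is the derivative of s |-> s * g (dil s q). *)
Lemma avg_radial Q (g : 'rV[R]_n -> R) q : star Q -> class_C 1 Q g -> Q q ->
  int01 (fun s => g (dil s q) + s * 'D_(q *m tang) g (dil s q)) = g q.
Proof.
move=> sQ Cg Qq; have /class_CS[_ Dg] := Cg.
rewrite -[RHS]subr0 -[in RHS](dil1 q) -(mul0r (g (dil 0 q))) -[in RHS](mul1r (g _)).
apply: (@int01_FTC2 _ _ (fun s => s * g (dil s q))) => [s s01|s s01].
  apply: contD; first exact: (cont01_dil sQ (class_CW Cg)).
  apply: contM; first exact: cont_id.
  exact: (cont01_dil sQ (Dg _)).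
have dg := is_derive_dil Cg (sQ s q s01 Qq).
have := is_deriveM (is_derive_id s 1) dg.
by rewrite /GRing.scale /= mulr1 addrC.
Qed.

(** The integral of the one-form with coefficients [a j] along the ray s |-> [dil s q], as in the
    homotopy operator of the Poincare lemma. *)
Definition radial (a : 'I_n -> 'rV[R]_n -> R) q := \sum_(j | J j) q 0 j * avg (a j) q.

Lemma class_C_radial k Q a : open Q -> star Q -> (forall j, J j -> class_C k Q (a j)) ->
  class_C k Q (radial a).
Proof.
move=> oQ sQ Ca; apply: class_C_sum => // j Jj; apply: class_CM => //.
  exact: class_C_coord.
by apply: class_C_avg => //; exact: Ca.
Qed.

Lemma tang_sum q : q *m tang = \sum_(j | J j) q 0 j *: delta_mx 0 j.
Proof.
rewrite [LHS]row_sum_delta [RHS]big_mkcond; apply: eq_bigr => j _ /=.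
by rewrite tangE; case: (J j) => //; rewrite scale0r.
Qed.

Lemma derive_tang (g : 'rV[R]_n -> R) p q : differentiable g p ->
  'D_(q *m tang) g p = \sum_(j | J j) q 0 j * 'D_(delta_mx 0 j) g p.
Proof.
move=> dg; rewrite deriveE // tang_sum linear_sum; apply: eq_bigr => j _.
by rewrite linearZ deriveE.
Qed.

(** Differentiating [radial a] gives the mean of [a i] plus the means of s q_j D_i a_j. Closedness
    turns D_i a_j into D_j a_i, and [avg_radial] sums the result. *)
Theorem poincare Q (a : 'I_n -> 'rV[R]_n -> R) i q : open Q -> star Q ->
  (forall j, J j -> class_C 1 Q (a j)) ->
  (forall i j p, J i -> J j -> Q p ->
     'D_(delta_mx 0 i) (a j) p = 'D_(delta_mx 0 j) (a i) p) ->
  J i -> Q q -> 'D_(delta_mx 0 i) (radial a) q = a i q.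
Proof.
move=> oQ sQ Ca clos Ji Qq.
have Cav j : J j -> class_C 1 Q (avg (a j)) by move=> Jj; exact: class_C_avg (Ca j Jj).
have dav j : J j -> differentiable (avg (a j)) q by move=> /Cav[d _]; exact: d.
have dc j : differentiable (fun q : 'rV[R]_n => q 0 j) q by exact: differentiable_coord.
have dt j : J j -> differentiable (fun q : 'rV[R]_n => q 0 j * avg (a j) q) q.
  by move=> /dav dj; have [] := diffsM (dc j) dj.
have cD j v : J j -> cont01 (fun s => 'D_v (a j) (dil s q)).
  by move=> /Ca/class_CS[_ Da]; exact: (cont01_dil sQ (Da v)).
rewrite /radial (diffs_sum _ dt).2 -(avg_radial sQ (Ca i Ji) Qq).
have -> : \sum_(j | J j) 'D_(delta_mx 0 i) (fun q => q 0 j * avg (a j) q) q =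
    avg (a i) q + \sum_(j | J j) q 0 j * 'D_(delta_mx 0 i) (avg (a j)) q.
  rewrite (eq_bigr (fun j => avg (a j) q * (delta_mx 0 i : 'rV[R]_n) 0 j +
     q 0 j * 'D_(delta_mx 0 i) (avg (a j)) q)); last first.
    move=> j /dav dj; rewrite (diffsM (dc j) dj).2 (derive_coord _ _ (f := id)) //.
    by rewrite derive_id addrC.
  rewrite big_split /=; congr (_ + _).
  rewrite (bigD1 i) //= mxE !eqxx mulr1 big1 ?addr0 // => j /andP[_ ji].
  by rewrite mxE (negbTE ji) andbF mulr0.
rewrite int01D; last 2 first.
- by apply: (cont01_dil sQ (class_CW (Ca i Ji))).
- by move=> s s01; apply: contM; [exact: cont_id|exact: cD].
congr (_ + _).
rewrite (eq_bigr (fun j => int01 (fun s => q 0 j * (s * 'D_(delta_mx 0 j) (a i) (dil s q))))).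
  rewrite -int01_sum; last first.
    move=> j Jj s s01; apply: contM; first exact: cont_cst.
    by apply: contM; [exact: cont_id|exact: cD].
  apply: eq_int01 => s s01; have [da _] := Ca i Ji.
  rewrite derive_tang; last by apply: da; exact: sQ.
  by rewrite mulr_sumr; apply: eq_bigr => j _; rewrite mulrCA.
move=> j Jj; rewrite int01Z; last first.
  by move=> s s01; apply: contM; [exact: cont_id|exact: cD].
congr (_ * _); rewrite (derive_avg _ oQ sQ (Ca j Jj) Qq); apply: eq_int01 => s s01.
have [da _] := Ca j Jj; have dja := da _ (sQ s q s01 Qq).
rewrite dil_basis Ji -(clos i j) //; last exact: sQ.
by rewrite !deriveE // linearZ.
Qed.

(** Along the ray through [q], [radial a] is by construction a primitive of the form. This is the
    differential content of the integral equation solved in [picard]. *)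
Lemma derive_radial_tang Q (a : 'I_n -> 'rV[R]_n -> R) q : open Q -> star Q ->
  (forall j, J j -> class_C 1 Q (a j)) -> Q q ->
  'D_(q *m tang) (radial a) q = \sum_(j | J j) q 0 j * a j q.
Proof.
move=> oQ sQ Ca Qq.
have dav j : J j -> differentiable (avg (a j)) q.
  by move=> Jj; have [d _] := class_C_avg oQ sQ (Ca j Jj); exact: d.
have dc j : differentiable (fun q : 'rV[R]_n => q 0 j) q by exact: differentiable_coord.
have dt j : J j -> differentiable (fun q : 'rV[R]_n => q 0 j * avg (a j) q) q.
  by move=> /dav dj; have [] := diffsM (dc j) dj.
rewrite /radial (diffs_sum _ dt).2; apply: eq_bigr => j Jj.
rewrite (diffsM (dc j) (dav j Jj)).2 (derive_coord _ _ (f := id)) // derive_id.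
rewrite tangE Jj [avg _ _ * _]mulrC -mulrDr; congr (_ * _).
have Cj := Ca j Jj; have /class_CS[_ Dj] := Cj.
rewrite -(avg_radial sQ Cj Qq) int01D; last 2 first.
- exact: (cont01_dil sQ (class_CW Cj)).
- move=> s s01; apply: contM; first exact: cont_id.
  exact: (cont01_dil sQ (Dj _)).
rewrite addrC; congr (_ + _); rewrite (derive_avg _ oQ sQ Cj Qq).
apply: eq_int01 => s s01; have [da _] := Cj; have dja := da _ (sQ s q s01 Qq).
have -> : dil s (q *m tang) = s *: (q *m tang).
  by apply/rowP => l; rewrite dilE [RHS]mxE tangE; case: (J l); rewrite ?mulr0.
by rewrite !deriveE // linearZ.
Qed.

End Dilation.

(** * The Frobenius theorem *)

Section UniformFixpoint.
Context {R : realType}.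

Lemma half_pow_small (K e : R) : 0 < e -> exists n, K * 2^-1 ^+ n < e.
Proof.
move=> e0; have h1 : `|2^-1 : R| < 1 by rewrite ger0_norm ?invr_ge0 // invf_lt1 ?ltr1n.
have /cvgrPdist_lt/(_ _ e0) := cvg_geometric K h1.
move=> /filter_ex[n]; rewrite sub0r normrN => Kn; exists n.
exact: le_lt_trans (ler_norm _) Kn.
Qed.

Lemma le_half_pow (K a b : R) : (forall n, a <= b + K * 2^-1 ^+ n) -> a <= b.
Proof.
move=> ab; apply/ler_addgt0Pl => e e0; have [n Kn] := half_pow_small K e0.
by apply: le_trans (ab n) _; rewrite addrC lerD2r ltW.
Qed.

Definition admissible {T : topologicalType} (Q : set T) (c : R) (u : T -> R) :=
  (forall q, Q q -> {for q, continuous u}) /\ (forall q, Q q -> `|u q| <= c).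

Lemma uniform_fixpoint {T : topologicalType} (Q : set T) (c : R)
    (F : (T -> R) -> T -> R) (u0 : T -> R) : open Q -> admissible Q c u0 ->
  (forall u, admissible Q c u -> admissible Q c (F u)) ->
  (forall u v (M : R), admissible Q c u -> admissible Q c v ->
     (forall q, Q q -> `|u q - v q| <= M) ->
     forall q, Q q -> `|F u q - F v q| <= 2^-1 * M) ->
  exists2 u, admissible Q c u & forall q, Q q -> u q = F u q.
Proof.
move=> oQ a0 aF cF; pose U n := iter n F u0; pose e n : R := 2^-1 ^+ n.
have aU n : admissible Q c (U n) by elim: n => //= n IH; exact: aF.
have eS n : e n.+1 = 2^-1 * e n by rewrite /e exprS.
have step n q : Q q -> `|U n.+1 q - U n q| <= 2 * c * e n.
  elim: n q => [|n IH] q Qq.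
    rewrite /e expr0 mulr1 mulr_natl mulr2n (le_trans (ler_normB _ _)) //.
    by apply: lerD; [exact: (aU 1%N).2|exact: (aU 0%N).2].
  rewrite eS mulrCA.
  exact: (cF (U n.+1) (U n) _ (aU n.+1) (aU n) IH q Qq).
(* Successive iterates differ by at most 2 c 2^-n, so the remaining steps after the n-th add up to
   at most 4 c 2^-n. *)
pose V q n := U n q - 4 * c * e n; pose W q n := U n q + 4 * c * e n.
have c0 q : Q q -> 0 <= c by move=> /(aU 0%N).2; exact: le_trans.
have e0 n : 0 <= e n by rewrite exprn_ge0 // invr_ge0.
have Vnd q m n : Q q -> (m <= n)%N -> V q m <= V q n.
  move=> Qq /subnK <-; elim: (n - m)%N => // k IH; apply: le_trans IH _.
  rewrite addSn /V eS; have := step (k + m)%N q Qq; rewrite ler_norml => /andP[+ _].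
  lra.
have Wni q m n : Q q -> (m <= n)%N -> W q n <= W q m.
  move=> Qq /subnK <-; elim: (n - m)%N => // k IH; apply: le_trans _ IH.
  rewrite addSn /W eS; have := step (k + m)%N q Qq; rewrite ler_norml => /andP[_].
  lra.
have VW q m n : Q q -> V q m <= W q n.
  move=> Qq; apply: (@le_trans _ _ (V q (maxn m n))); first by rewrite Vnd // leq_maxl.
  apply: (@le_trans _ _ (W q (maxn m n))); last by rewrite Wni // leq_maxr.
  have h : 0 <= 4 * c * e (maxn m n) by rewrite !mulr_ge0 // (c0 q Qq).
  rewrite /V /W; lra.
(* [V q] increases, [W q] decreases and they have the same limit: no completeness
   of a function space is needed. *)
pose u q := sup (range (V q)).
have uU q n : Q q -> `|u q - U n q| <= 4 * c * e n.
  move=> Qq; rewrite ler_norml; apply/andP; split.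
    rewrite lerBrDr addrC; apply: sup_ubound; last by exists n.
    by exists (W q 0%N) => _ [m _ <-]; exact: VW.
  rewrite lerBlDr addrC; apply: sup_le_ub; first by exists (V q 0%N); exists 0%N.
  by move=> _ [m _ <-]; exact: VW.
have au : admissible Q c u.
  split=> q Qq; last first.
    apply: (@le_half_pow (4 * c)) => n.
    rewrite -(subrK (U n q) (u q)) (le_trans (ler_normD _ _)) // addrC lerD ?uU //.
    exact: (aU n).2.
  apply/cvgrPdist_lt => d d0; have d30 : 0 < d / 3 by rewrite divr_gt0.
  have [n nd] := half_pow_small (4 * c) d30.
  have /cvgrPdist_lt/(_ _ d30) Ud := (aU n).1 q Qq.
  have nQ : nbhs q Q by apply: open_nbhs_nbhs.
  near=> q'; have Qq' : Q q' by near: q'.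
  have h1 := le_lt_trans (uU q n Qq) nd; have h2 := le_lt_trans (uU q' n Qq') nd.
  have h3 : `|U n q - U n q'| < d / 3 by near: q'.
  have -> : u q - u q' = (u q - U n q) - (u q' - U n q') + (U n q - U n q').
    ring.
  apply: le_lt_trans (ler_normD _ _) _; have := ler_normB (u q - U n q) (u q' - U n q').
  lra.
exists u => // q Qq; apply/eqP; rewrite -subr_eq0 -normr_le0.
apply: (@le_half_pow (4 * c)) => n; rewrite add0r.
have h1 : `|F u q - U n.+1 q| <= 2^-1 * (4 * c * e n).
  exact: (cF u (U n) _ au (aU n) (fun q' Qq' => uU q' n Qq') q Qq).
have h2 := uU q n.+1 Qq; rewrite eS in h2.
have -> : u q - F u q = (u q - U n.+1 q) - (F u q - U n.+1 q) by ring.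
apply: le_trans (ler_normB _ _) _; rewrite -/(e n); lra.
Unshelve. all: by end_near. Qed.

End UniformFixpoint.

(** * Solving the leaf system along rays *)

Section RadialODE.
Context {R : realType} {n' : nat}.
Local Notation n := n'.+1.
Implicit Types (q y : 'rV[R]_n) (u : 'rV[R]_n -> R).

(** Coordinate 0 is transverse to the leaves: it labels the slices and is the unknown of the
    system. *)
Definition leafdir : pred 'I_n := fun j => j != 0.
Local Notation J := leafdir.
Local Notation e0 := (delta_mx 0 0 : 'rV[R]_n).

Definition graph u q : 'rV[R]_n := u q *: e0 + q *m tang J.

Lemma graphE u q j : graph u q 0 j = if J j then q 0 j else u q.
Proof.
have E (a b : 'rV[R]_n) (s : R) : (s *: a + b) 0 j = s * a 0 j + b 0 j by rewrite !mxE.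
rewrite /graph E tangE /leafdir mxE !eqxx /=.
by case: (eqVneq j 0) => _ /=; rewrite ?mulr1 ?mulr0 ?addr0 ?add0r.
Qed.

Lemma graph_norm u q (c : R) : `|u q| <= c -> `|q| <= c -> `|graph u q| <= c.
Proof.
move=> uc qc; apply: row_norm_le => [|j]; first exact: le_trans qc.
by rewrite graphE; case: ifP => // _; apply: le_trans (coord_le_norm _ _ _) qc.
Qed.

Lemma class_C_graph k Q u : open Q -> class_C k Q u -> class_C k Q (graph u).
Proof.
move=> oQ Cu; apply/class_C_rV => // j.
have [Jj|nJj] := boolP (J j).
  refine (class_C_eq (f := fun q => q 0 j) oQ _ _); last exact: class_C_coord.
  by move=> q _; rewrite graphE Jj.
by apply: class_C_eq oQ _ Cu => q _; rewrite graphE (negbTE nJj).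
Qed.

Lemma ball0E (r : R) (x : 'rV[R]_n) : ball 0 r x <-> `|x| < r.
Proof. by rewrite -ball_normE /ball_ /= sub0r normrN. Qed.

Lemma near0_bound (f : 'rV[R]_n -> R) : {for 0, continuous f} ->
  exists M r : R, [/\ 0 < M, 0 < r & forall x, `|x| < r -> `|f x| <= M].
Proof.
move=> cf; exists (`|f 0| + 1).
have /cvgrPdist_lt/(_ 1 ltr01) := cf.
move=> /nbhs_ballP[r /= r0 rf]; exists r; split=> [|//|x xr].
  by rewrite ltr_wpDl.
have := rf x; rewrite -ball_normE /ball_ /= sub0r normrN => /(_ xr) h.
rewrite -(subrK (f 0) (f x)) (le_trans (ler_normD _ _)) // addrC lerD2l.
by rewrite distrC ltW.
Qed.

Lemma slope_le (f : 'rV[R]_n -> R) i U x y (L : R) : class_C 1 U f -> segment_in U x y ->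
  (forall z, U z -> `|'D_(delta_mx 0 i) f z| <= L) -> `|slope f i x y| <= L.
Proof.
move=> /class_CS[_ Df] sU fL; apply: ler_norm_int01 => [|t t01].
  exact: cont01_line sU (Df _).
exact/fL/sU.
Qed.

Lemma radial_le (a b : 'I_n -> 'rV[R]_n -> R) (r M : R) q : 0 <= M ->
  (forall j, J j -> class_C 0 (ball 0 r) (a j)) ->
  (forall j, J j -> class_C 0 (ball 0 r) (b j)) ->
  (forall j q, J j -> ball 0 r q -> `|a j q - b j q| <= M) -> ball 0 r q ->
  `|radial J a q - radial J b q| <= n%:R * r * M.
Proof.
move=> M0 ca cb abM Qq; have Qr : `|q| < r by exact/ball0E.
have sQ := @star_ball R n J r.
rewrite /radial -sumrB (le_trans (ler_norm_sum _ _ _)) //.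
apply: (@le_trans _ _ (\sum_(j | J j) r * M)).
  apply: ler_sum => j Jj; rewrite -mulrBr normrM.
  apply: ler_pM => //; first exact: le_trans (coord_le_norm _ _ _) (ltW Qr).
  have c1 := cont01_dil sQ (ca j Jj) Qq; have c2 := cont01_dil sQ (cb j Jj) Qq.
  rewrite /avg -int01B //; apply: ler_norm_int01 => s s01.
    by apply: contD; [exact: c1|apply: continuousN; exact: c2].
  by apply: abM => //; exact: sQ.
have r0 : 0 <= r by apply: le_trans (ltW Qr).
apply: (@le_trans _ _ (\sum_(j < n) r * M)).
  by rewrite big_mkcond; apply: ler_sum => j _; case: ifP => // _; exact: mulr_ge0.
by rewrite sumr_const card_ord -[leLHS]mulr_natl mulrA.
Qed.

(* The equation on [H] is the integral form of
   d/ds H(dil s q) = sum_j q_j P_j(graph H (dil s q)) along the ray s |-> dil s q. *)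
Lemma picard (P : 'I_n -> 'rV[R]_n -> R) (U : set 'rV[R]_n) : open U -> U 0 ->
  (forall j, J j -> class_C 1 U (P j)) ->
  exists r : R, exists2 H : 'rV[R]_n -> R, 0 < r /\ class_C 0 (ball 0 r) H &
    forall q, ball 0 r q -> U (graph H q) /\
      H q = q 0 0 + radial J (fun j q => P j (graph H q)) q.
Proof.
move=> oU U0 CP.
have [M [rho [M0 rho0 rhoU PM DM]]] : exists M rho : R, [/\ 0 < M, 0 < rho,
    ball 0 rho `<=` U,
    forall j y, J j -> ball 0 rho y -> `|P j y| <= M &
    forall j y, J j -> ball 0 rho y -> `|'D_e0 (P j) y| <= M].
  have cP j : J j -> {for 0, continuous (P j)}.
    by move=> Jj; apply: (class_C_cont (CP j Jj)).
  have cD j : J j -> {for 0, continuous ('D_e0 (P j))}.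
    by move=> Jj; have /class_CS[_ /(_ e0)] := CP j Jj; apply.
  (* One continuous function dominating all the quantities to be bounded. *)
  pose f0 y := 1 + \sum_(j | J j) (`|P j y| + `|'D_e0 (P j) y|).
  have [M [r [M0 r0 fM]]] : exists M r : R, [/\ 0 < M, 0 < r & forall x, `|x| < r -> `|f0 x| <= M].
    apply: near0_bound; apply: contD; first exact: cont_cst.
    apply: cont_sum => j Jj.
    have cn (z : R) : {for z, continuous (fun x : R => `|x|)} by exact: norm_continuous.
    by apply: contD; [exact: (cont_comp (cP j Jj) (cn _))|exact: (cont_comp (cD j Jj) (cn _))].
  have : nbhs (0 : 'rV[R]_n) U by apply: open_nbhs_nbhs.
  move=> /nbhs_ballP[r' /= r'0 r'U].
  have fle j y : J j -> ball 0 (Num.min r r') y -> `|P j y| + `|'D_e0 (P j) y| <= M.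
    move=> Jj /ball0E; rewrite lt_min => /andP[yr _].
    apply: le_trans (fM y yr); apply: le_trans (ler_norm _).
    rewrite /f0 (bigD1 j) //= addrCA -[leLHS]addr0 lerD2l addr_ge0 //.
    by apply: sumr_ge0 => i _; rewrite addr_ge0.
  exists M, (Num.min r r'); split=> //.
  - by rewrite lt_min r0.
  - by move=> y /ball0E; rewrite lt_min => /andP[_ yr']; apply: r'U; exact/ball0E.
  - by move=> j y Jj /(fle j y Jj); apply: le_trans; rewrite lerDl.
  - by move=> j y Jj /(fle j y Jj); apply: le_trans; rewrite lerDr.
(* [c] bounds the candidate solutions and keeps their graphs in the ball of radius [rho]. The three
   bounds on [r] below give in turn: initial value at most c / 2, integral at most c / 2, and
   contraction factor at most 1/2. *)
pose c := rho / 2; pose K := n%:R * M; have K0 : 0 < K by rewrite mulr_gt0.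
pose r := Num.min (c / 2) (Num.min (c / 2 / K) (2^-1 / K)).
have c0 : 0 < c by rewrite divr_gt0.
have r0 : 0 < r by rewrite !lt_min !divr_gt0 ?invr_gt0.
have rc : r <= c / 2 by rewrite ge_min lexx.
have rK1 : K * r <= c / 2.
  by rewrite mulrC -ler_pdivlMr // !ge_min lexx orbT.
have rK2 : K * r <= 2^-1.
  by rewrite mulrC -ler_pdivlMr // !ge_min lexx !orbT.
pose Q : set 'rV[R]_n := ball 0 r.
have oQ : open Q by exact: ball_open.
have sQ : star J Q := @star_ball R n J r.
have GU u q : admissible Q c u -> Q q -> ball 0 rho (graph u q).
  move=> [_ uc] Qq; apply/ball0E; apply: (@le_lt_trans _ _ c).
    apply: graph_norm; first exact: uc.
    have /ball0E : Q q := Qq; move=> /ltW qr; apply: le_trans qr _; lra.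
  by rewrite /c ltr_pdivrMr // ltr_pMr // ltr1n.
have cPG u j : admissible Q c u -> J j -> class_C 0 Q (fun q => P j (graph u q)).
  move=> au Jj.
  refine (class_C_comp (W := ball 0 rho) oQ (ball_open _ _) _ _ _).
  - by move=> q; exact: GU.
  - have cu : class_C 0 Q u by case: au.
    exact: (class_C_graph oQ cu).
  - exact: class_C_sub rhoU (class_CW (CP j Jj)).
pose F u q := q 0 0 + radial J (fun j q => P j (graph u q)) q.
have [||u v N au av uv q Qq|H [cH Hc] HE] :=
    @uniform_fixpoint R _ Q c F (fun q => q 0 0) oQ.
- split=> q Qq; first exact: coord_continuous.
  apply: le_trans (coord_le_norm _ _ _) _.
  have /ball0E : Q q := Qq; move=> /ltW qr; apply: le_trans qr _; lra.
- move=> u au; split=> q Qq.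
    apply: contD; first exact: coord_continuous.
    have CR : class_C 0 Q (radial J (fun j q => P j (graph u q))).
      by apply: (class_C_radial oQ sQ) => j; exact: cPG.
    exact: CR.
  have qr : `|q| < r by exact/ball0E.
  rewrite (le_trans (ler_normD _ _)) //.
  have h1 := coord_le_norm q 0 0.
  have rad0 : radial J (fun _ _ => 0) q = 0.
    by rewrite /radial big1 // => j _; rewrite /avg int01_cst mulr0.
  have := @radial_le (fun j q => P j (graph u q)) (fun _ _ => 0) r M q (ltW M0).
  rewrite rad0 subr0 => h2.
  have h3 : `|radial J (fun j q => P j (graph u q)) q| <= n%:R * r * M.
    apply: h2 => //.
    - by move=> j; exact: cPG.
    - by move=> j _; exact: class_C_cst.
    - by move=> j p Jj Qp; rewrite subr0; apply: PM => //; exact: GU.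
  have h4 : n%:R * r * M = K * r by rewrite /K; ring.
  lra.
- have N0 : 0 <= N by apply: le_trans (uv q Qq).
  rewrite /F opprD addrACA subrr add0r.
  apply: le_trans (@radial_le _ _ r (M * N) q _ _ _ _ Qq) _.
  - by rewrite mulr_ge0 // ltW.
  - by move=> j Jj; exact: cPG.
  - by move=> j Jj; exact: cPG.
  - move=> j p Jj Qp; have CPj := class_C_sub rhoU (CP j Jj).
    have sg : segment_in (ball 0 rho) (graph v p) (graph u p).
      by apply: segment_ball; exact: GU.
    (* The two graph points differ only in coordinate 0, so only that term of Hadamard's formula
       survives; hence the bound on ['D_e0 (P j)] suffices. *)
    rewrite (slopeE CPj sg) (bigD1 0) //= big1 ?addr0.
      rewrite normrM mulrC; apply: ler_pM => //.
        by apply: (slope_le CPj sg) => z; exact: DM.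
      have -> : (graph u p - graph v p) 0 0 = u p - v p; last exact: uv.
      by rewrite mxE [X in _ + X]mxE !graphE.
    move=> i i0; have -> : (graph u p - graph v p) 0 i = 0; last by rewrite mul0r.
    by rewrite mxE [X in _ + X]mxE !graphE /leafdir i0 subrr.
  - rewrite mulrA ler_wpM2r //; apply: le_trans rK2.
    by rewrite le_eqVlt /K; apply/orP; left; apply/eqP; ring.
- exists r, H; first by split.
  move=> q Qq; split; last exact: HE.
  by apply: rhoU; apply: GU.
Qed.

End RadialODE.

(** * Scalar linear equations *)

Section LinearODE.
Context {R : realType}.

(** The hypothesis is the integral form of d' = A d + B with d(0) = [d0]; the conclusion comes from
    multiplying by the integrating factor exp(-K), where K is the primitive of A vanishing at 0. *)
Lemma linear_ode (A B d : R -> R) (d0 : R) : cont01 A -> cont01 B -> cont01 d ->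
  (forall t, 0 <= t <= 1 ->
     d t = d0 + t * int01 (fun u => A (u * t) * d (u * t) + B (u * t))) ->
  expR (- int01 A) * d 1 =
  d0 + int01 (fun t => expR (- (t * int01 (fun u => A (u * t)))) * B t).
Proof.
move=> cA cB cd dE.
have [K [K0 dK KE]] := int01_prim cA.
have cg : cont01 (fun t => A t * d t + B t).
  by move=> t t01; apply: contD; [apply: contM; [exact: cA|exact: cd]|exact: cB].
have [N [N0 dN NE]] := int01_prim cg.
have t1 : 0 <= (1 : R) <= 1 by rewrite ler01 lexx.
have dNE t : 0 <= t <= 1 -> d t = d0 + N t by move=> t01; rewrite NE // dE.
have K1 : int01 A = K 1.
  by rewrite KE // mul1r; apply: eq_int01 => u _; rewrite mulr1.
have cK : cont01 K by move=> t /dK/is_derive_cont.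
(* [d] is only controlled on [0, 1]; [d0 + N] agrees with it there and has two-sided derivatives at
   the end points too. *)
have dE' (t : R) : 0 <= t <= 1 ->
    is_derive t 1 (fun t => expR (- K t) * (d0 + N t)) (expR (- K t) * B t).
  move=> t01; have dKt := dK t t01; have dNt := dN t t01.
  have deK : is_derive t 1 (fun t => expR (- K t)) (expR (- K t) * - A t).
    exact: (@is_derive1_comp _ expR (fun t => - K t)).
  have dN' : is_derive t 1 (fun t => d0 + N t) (0 + (A t * d t + B t)).
    exact: (@is_deriveD _ _ _ (cst d0) N).
  have := is_deriveM deK dN'; congr is_derive.
  by rewrite /GRing.scale /= -dNE //; ring.
have -> : int01 (fun t => expR (- (t * int01 (fun u => A (u * t)))) * B t) =
    int01 (fun t => expR (- K t) * B t).
  by apply: eq_int01 => t t01; rewrite KE.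
rewrite (int01_FTC2 (F := fun t => expR (- K t) * (d0 + N t))) //; last first.
  move=> t t01; apply: contM; last exact: cB.
  apply: (cont_comp (f := fun t => - K t)); last exact: continuous_expR.
  by apply: continuousN; exact: cK.
by rewrite K0 oppr0 expR0 mul1r N0 addr0 -dNE // K1; ring.
Qed.

End LinearODE.

(** * Smooth dependence of the solution on the initial value *)

Section Avg2.
Context {R : realType} {n : nat}.
Variable J : pred 'I_n.
Local Notation V := 'rV[R]_n.
Local Notation VV := (V * V)%type.
Implicit Types (Q : set V).

Definition square Q : set VV := [set z | Q z.1 /\ Q z.2].

(** The analogue of [avg] for functions of two points moving along their rays simultaneously;
    increment formulas have such coefficients. *)
Definition avg2 (g : VV -> R) (z : VV) : R :=
  int01 (fun s => g (dil J s z.1, dil J s z.2)).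

Lemma open_square Q : open Q -> open (square Q).
Proof.
move=> oQ; apply: (@openI VV (fst @^-1` Q) (snd @^-1` Q)).
  by apply: open_comp => // z _; exact: cont_fst.
by apply: open_comp => // z _; exact: cont_snd.
Qed.

Lemma dil2_cont (p : R * VV) :
  {for p, continuous (fun p : R * VV => (dil J p.1 p.2.1, dil J p.1 p.2.2))}.
Proof.
apply: cont_pair.
  apply: (@cont_comp _ (R * V)%type V (fun p : R * VV => (p.1, p.2.1))
    (fun p => dil J p.1 p.2)); last exact: dil_cont.
  apply: cont_pair; first exact: cont_fst.
  by apply: (@cont_comp _ VV V snd fst); [exact: cont_snd|exact: cont_fst].
apply: (@cont_comp _ (R * V)%type V (fun p : R * VV => (p.1, p.2.2))
  (fun p => dil J p.1 p.2)); last exact: dil_cont.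
apply: cont_pair; first exact: cont_fst.
by apply: (@cont_comp _ VV V snd snd); [exact: cont_snd|exact: cont_snd].
Qed.

Lemma avg2_cont Q (g : VV -> R) : open Q -> star J Q ->
  (forall z, square Q z -> {for z, continuous g}) ->
  forall z, square Q z -> {for z, continuous (avg2 g)}.
Proof.
move=> oQ sQ cg z Qz.
have nz : nbhs z (square Q) by apply: open_nbhs_nbhs; split=> //; exact: open_square.
apply: (@int01_comp_cont R VV VV g
  (fun p : R * VV => (dil J p.1 p.2.1, dil J p.1 p.2.2)) (square Q) z cg).
  by apply: filterS nz => y _ t _; exact: dil2_cont.
by apply: filterS nz => y [Qy1 Qy2] t t01; split; exact: sQ.
Qed.

Lemma cont01_avg2 Q (g : VV -> R) z : star J Q ->
  (forall z, square Q z -> {for z, continuous g}) -> square Q z ->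
  cont01 (fun s => g (dil J s z.1, dil J s z.2)).
Proof.
move=> sQ cg [Q1 Q2].
apply: (cont01_comp (a := fun p : R * VV => (dil J p.1 p.2.1, dil J p.1 p.2.2)) (S := square Q) cg).
  by move=> t t01; exact: dil2_cont.
by move=> t t01; split; exact: sQ.
Qed.

End Avg2.

Section Regularity.
Context {R : realType} {n' : nat}.
Local Notation n := n'.+1.
Local Notation V := 'rV[R]_n.
Local Notation VV := (V * V)%type.
Local Notation J := (@leafdir n').
Local Notation e0 := (delta_mx 0 0 : V).
Implicit Types (q p y : V).

Variables (P : 'I_n -> V -> R) (U Q : set V) (H : V -> R).
Hypotheses (oU : open U) (segU : forall x y, U x -> U y -> segment_in U x y).
Hypotheses (sP : forall j, J j -> smooth U (P j)).
Hypotheses (oQ : open Q) (sQ : star J Q) (cH : class_C 0 Q H).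
Hypotheses (HU : forall q, Q q -> U (graph H q)).
Hypothesis HE : forall q, Q q -> H q = q 0 0 + radial J (fun j q => P j (graph H q)) q.

Local Notation G := (graph H).

(** For z = (q, p), the difference d(s) = H (dil s p) - H (dil s q) solves d' = a d + B. By
    Hadamard's formula, a(s) is the sum of q_j times [kappa 0 j] at the dilated pair, and B(s) the
    sum of (p_i - q_i) times [b i] there. [W] is the integral of a over [0, 1]. *)
Let kappa i j (z : VV) := slope (P j) i (G z.1) (G z.2).
Let W (z : VV) := \sum_(j | J j) z.1 0 j * avg2 J (kappa 0 j) z.
Let b i (z : VV) := P i (G z.2) + \sum_(j | J j) z.1 0 j * kappa i j z.

Let cG q : Q q -> {for q, continuous G}.
Proof. exact: (class_C_graph oQ cH). Qed.

Let cG1 (z : VV) : square Q z -> {for z, continuous (fun z : VV => G z.1)}.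
Proof.
by move=> [Q1 _]; apply: (@cont_comp _ V V fst G); [exact: cont_fst|exact: cG].
Qed.

Let cG2 (z : VV) : square Q z -> {for z, continuous (fun z : VV => G z.2)}.
Proof.
by move=> [_ Q2]; apply: (@cont_comp _ V V snd G); [exact: cont_snd|exact: cG].
Qed.

Let c1 (z : VV) j : {for z, continuous (fun z : VV => z.1 0 j)}.
Proof. by apply: cont_coord; exact: cont_fst. Qed.

Let ckappa i j : J j -> forall z, square Q z -> {for z, continuous (kappa i j)}.
Proof.
move=> Jj z Qz.
apply: (@slope_cont R n (P j) i U VV (fun z => G z.1) (fun z => G z.2) z oU (sP Jj 1%N)).
- exact: cG1.
- exact: cG2.
- by have [Q1 Q2] := Qz; apply: segU; exact: HU.
Qed.

Let cW z : square Q z -> {for z, continuous W}.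
Proof.
move=> Qz; apply: cont_sum => j Jj; apply: contM; first exact: c1.
exact: (avg2_cont oQ sQ (ckappa (i := 0) Jj) Qz).
Qed.

Let cb i z : J i -> square Q z -> {for z, continuous (b i)}.
Proof.
move=> Ji Qz; apply: contD.
  apply: (@cont_comp VV V R (fun z : VV => G z.2) (P i)); first exact: cG2.
  by apply: (class_C_cont (sP Ji 0%N)); apply: HU; exact: Qz.2.
by apply: cont_sum => j Jj; apply: contM; [exact: c1|exact: ckappa].
Qed.

Let A (z : VV) (s : R) :=
  \sum_(j | J j) z.1 0 j * kappa 0 j (dil J s z.1, dil J s z.2).

Let cA z : square Q z -> cont01 (A z).
Proof.
move=> Qz s s01; apply: cont_sum => j Jj; apply: contM; first exact: cont_cst.
exact: (cont01_avg2 sQ (ckappa (i := 0) Jj) Qz).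
Qed.

Let intA z : square Q z -> int01 (A z) = W z.
Proof.
move=> Qz; rewrite /A int01_sum; last first.
  move=> j Jj s s01; apply: contM; first exact: cont_cst.
  exact: (cont01_avg2 sQ (ckappa (i := 0) Jj) Qz).
apply: eq_bigr => j Jj; rewrite int01Z //.
exact: (cont01_avg2 sQ (ckappa (i := 0) Jj) Qz).
Qed.

(** [W] at the pair dilated by [t] is the integral of the coefficient from 0 to [t]. So the
    integrating factor at time [t] is again a function of the dilated pair, as [avg2] requires. *)
Let Wdil z t : 0 <= t <= 1 -> square Q z ->
  W (dil J t z.1, dil J t z.2) = t * int01 (fun u => A z (u * t)).
Proof.
move=> t01 Qz; have Qt : square Q (dil J t z.1, dil J t z.2).
  by split; apply: sQ => //; case: Qz.
rewrite -(intA Qt) -int01Z; last first.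
  move=> u u01; apply: (@cont_comp R R R (fun u => u * t) (A z)).
    exact: mulrr_continuous.
  apply: (cA Qz); move: u01 t01 => /andP[u0 u1] /andP[t0 t1].
  by rewrite mulr_ge0 // mulr_ile1.
apply: eq_int01 => u _; rewrite /A mulr_sumr; apply: eq_bigr => j Jj.
by rewrite /= !dil_dil dilE Jj mulrA.
Qed.

Let PG z j : J j -> square Q z ->
  P j (G z.2) - P j (G z.1) = (H z.2 - H z.1) * kappa 0 j z +
    \sum_(i | J i) (z.2 0 i - z.1 0 i) * kappa i j z.
Proof.
move=> Jj [Q1 Q2].
rewrite (slopeE (sP Jj 1%N) (segU (HU Q1) (HU Q2))) (bigD1 0) //=.
have E i : (G z.2 - G z.1) 0 i = G z.2 0 i - G z.1 0 i by rewrite mxE [X in _ + X]mxE.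
congr (_ + _); first by rewrite E !graphE /leafdir eqxx.
by apply: eq_bigr => i i0; rewrite E !graphE /leafdir i0.
Qed.

Let cEb i z : J i -> square Q z -> {for z, continuous (fun z => expR (- W z) * b i z)}.
Proof.
move=> Ji Qz; apply: contM; last exact: cb.
apply: (@cont_comp VV R R (fun z => - W z) expR); last exact: continuous_expR.
by apply: continuousN; exact: cW.
Qed.

(* By Hadamard's lemma the difference of two solutions solves a linear equation
   whose coefficients are slopes of the P_j; its explicit solution is an exact
   increment formula with continuous coefficients, hence differentiability. *)
Lemma solution_increment q p : Q q -> Q p -> H p - H q =
  expR (W (q, p)) * ((p 0 0 - q 0 0) +
    \sum_(i | J i) (p 0 i - q 0 i) * avg2 J (fun z => expR (- W z) * b i z) (q, p)).
Proof.
move=> Qq Qp; pose z : VV := (q, p); have Qz : square Q z by [].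
pose zs s : VV := (dil J s q, dil J s p).
have Qzs s : 0 <= s <= 1 -> square Q (zs s) by move=> s01; split; exact: sQ.
have [a [ca aW aWd aE]] : exists a : R -> R, [/\ cont01 a, int01 a = W z,
    forall t, 0 <= t <= 1 -> W (zs t) = t * int01 (fun u => a (u * t)) &
    forall s, a s = \sum_(j | J j) q 0 j * kappa 0 j (zs s)].
  exists (A z); split=> //; [exact: cA|exact: intA|].
  by move=> t t01; exact: (Wdil t01 Qz).
pose d s := H (dil J s p) - H (dil J s q).
pose B s := \sum_(i | J i) (p 0 i - q 0 i) * b i (zs s).
have cbs i : J i -> cont01 (fun s => b i (zs s)).
  by move=> Ji; exact: (cont01_avg2 sQ (fun z => cb (z := z) Ji) Qz).
have cEbs i : J i -> cont01 (fun s => expR (- W (zs s)) * b i (zs s)).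
  by move=> Ji; exact: (cont01_avg2 sQ (fun z => cEb (z := z) Ji) Qz).
have cB : cont01 B.
  move=> s s01; apply: cont_sum => i Ji; apply: contM; first exact: cont_cst.
  exact: cbs.
have cd : cont01 d.
  move=> s s01; apply: contD; first exact: (cont01_dil sQ cH Qp).
  by apply: continuousN; exact: (cont01_dil sQ cH Qq).
have cP x j : Q x -> J j -> cont01 (fun s => P j (G (dil J s x))).
  move=> Qx Jj; apply: (cont01_dil (g := fun x => P j (G x)) sQ _ Qx).
  exact: (class_C_comp oQ oU HU (class_C_graph oQ cH) (sP Jj 0%N)).
have Hdil x (t : R) : 0 <= t <= 1 -> Q x -> H (dil J t x) = x 0 0 +
    t * \sum_(j | J j) x 0 j * int01 (fun u => P j (G (dil J (u * t) x))).
  move=> t01 Qx; rewrite HE; last exact: sQ.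
  rewrite dilE /=; congr (_ + _); rewrite /radial mulr_sumr; apply: eq_bigr => j Jj.
  rewrite dilE Jj mulrA /avg.
  by under eq_int01 => u _ do rewrite dil_dil.
have scale01 (t u : R) : 0 <= t <= 1 -> 0 <= u <= 1 -> 0 <= u * t <= 1.
  by move=> /andP[t0 t1] /andP[u0 u1]; rewrite mulr_ge0 // mulr_ile1.
have csc (f : R -> R) (t : R) : 0 <= t <= 1 -> cont01 f -> cont01 (fun u => f (u * t)).
  move=> t01 cf u u01; apply: (@cont_comp R R R (fun u => u * t) f).
    exact: mulrr_continuous.
  by apply: cf; exact: scale01.
have dE (t : R) : 0 <= t <= 1 -> d t = (p 0 0 - q 0 0) +
    t * int01 (fun u => a (u * t) * d (u * t) + B (u * t)).
  move=> t01; rewrite /d !Hdil // opprD addrACA; congr (_ + _).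
  rewrite -mulrBr; congr (_ * _); rewrite -sumrB.
  rewrite (eq_bigr (fun j => int01 (fun u => p 0 j * P j (G (dil J (u * t) p)) -
      q 0 j * P j (G (dil J (u * t) q))))); last first.
    move=> j Jj; have c1' := csc _ t t01 (cP p j Qp Jj); have c2' := csc _ t t01 (cP q j Qq Jj).
    rewrite int01B; last 2 first.
    - by move=> u u01; apply: contM; [exact: cont_cst|exact: c1'].
    - by move=> u u01; apply: contM; [exact: cont_cst|exact: c2'].
    by rewrite !int01Z.
  rewrite -int01_sum; last first.
    move=> j Jj u u01; apply: contD.
      by apply: contM; [exact: cont_cst|exact: (csc _ t t01 (cP p j Qp Jj))].
    apply: continuousN.
    by apply: contM; [exact: cont_cst|exact: (csc _ t t01 (cP q j Qq Jj))].
  apply: eq_int01 => u u01; have ut01 := scale01 t u t01 u01.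
  move: (u * t) ut01 => s s01; have Qs := Qzs s s01.
  rewrite aE /B /b mulr_suml.
  under [X in _ = _ + X]eq_bigr do rewrite mulrDr mulr_sumr.
  rewrite [X in _ = _ + X]big_split /= addrCA exchange_big -big_split -big_split /=.
  apply: eq_bigr => j Jj; have := PG Jj Qs; rewrite /zs /=.
  set Pp := P j (G (dil J s p)); set Pq := P j (G (dil J s q)) => PE.
  (* The first term changes the direction of the ray; the second compares [P j] at the two graph
     points, where [PG] separates the contribution of d from that of the p_i - q_i. *)
  have -> : p 0 j * Pp - q 0 j * Pq = (p 0 j - q 0 j) * Pp + q 0 j * (Pp - Pq) by ring.
  rewrite PE mulrDr; congr (_ + (_ + _)); first by rewrite /d mulrA mulrAC.
  rewrite mulr_sumr; apply: eq_bigr => i Ji; rewrite !dilE Ji Jj; ring.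
have t1 : 0 <= (1 : R) <= 1 by rewrite ler01 lexx.
have d1 : H p - H q = d 1 by rewrite /d (dil1 J p) (dil1 J q).
have key : expR (- W z) * (H p - H q) = (p 0 0 - q 0 0) +
    int01 (fun t => expR (- W (zs t)) * B t).
  rewrite d1 -aW; have -> : int01 (fun t => expR (- W (zs t)) * B t) =
      int01 (fun t => expR (- (t * int01 (fun u => a (u * t)))) * B t).
    by apply: eq_int01 => t t01; rewrite aWd.
  exact: linear_ode ca cB cd dE.
have SE : \sum_(i | J i) (p 0 i - q 0 i) *
      avg2 J (fun z => expR (- W z) * b i z) (q, p) =
    int01 (fun t => expR (- W (zs t)) * B t).
  apply: etrans.
    apply: eq_bigr => i Ji; rewrite /avg2 -int01Z; [exact: erefl|exact: cEbs].
  rewrite -int01_sum; last first.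
    by move=> i Ji s s01; apply: contM; [exact: cont_cst|exact: (cEbs i Ji)].
  apply: eq_int01 => s s01; rewrite /B mulr_sumr.
  by apply: eq_bigr => i Ji; rewrite mulrCA.
rewrite SE -[LHS]mul1r -(expRxMexpNx_1 (W z)) -[LHS]mulrA.
exact: (congr1 (fun x => expR (W z) * x) key).
Qed.

(** [Wd] and [gd] are the diagonal values of [W] and of exp(-W) b, where slopes become partial
    derivatives. *)
Let Wd q := radial J (fun j x => 'D_e0 (P j) (G x)) q.
Let gd i q := expR (- Wd q) *
  (P i (G q) + \sum_(j | J j) q 0 j * 'D_(delta_mx 0 i) (P j) (G q)).

Let kappaxx i j q : kappa i j (q, q) = 'D_(delta_mx 0 i) (P j) (G q).
Proof. exact: slopexx. Qed.

Let Wxx q : W (q, q) = Wd q.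
Proof.
apply: eq_bigr => j Jj; congr (_ * _); apply: eq_int01 => s _; exact: kappaxx.
Qed.

Let Ebxx i q : expR (- W (q, q)) * b i (q, q) = gd i q.
Proof.
rewrite /gd -Wxx; congr (_ * (_ + _)).
by apply: eq_bigr => j Jj; rewrite -kappaxx.
Qed.

Lemma derive_solution q v : Q q -> differentiable H q /\
  'D_v H q = expR (Wd q) * (v 0 0 + \sum_(i | J i) v 0 i * avg J (gd i) q).
Proof.
move=> Qq; pose pr (h : V) : VV := (q, h + q).
(* Coordinate 0 enters only through the initial value, hence the coefficient 1 instead of an
   average. *)
pose C (i : 'I_n) h := expR (W (pr h)) *
  (if J i then avg2 J (fun z => expR (- W z) * b i z) (pr h) else 1).
have pr0 : pr 0 = (q, q) by rewrite /pr add0r.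
have cpr h : {for h, continuous pr}.
  apply: cont_pair; first exact: cont_cst.
  by apply: contD; [exact: cont_id|exact: cont_cst].
have Qpr0 : square Q (pr 0) by rewrite pr0.
have cC i : {for 0, continuous (C i)}.
  apply: contM.
    apply: (@cont_comp V R R (fun h => W (pr h)) expR); last exact: continuous_expR.
    by apply: (@cont_comp V VV R pr W); [exact: cpr|exact: cW].
  have [Ji|_] := boolP (J i); last exact: cont_cst.
  apply: (@cont_comp V VV R pr (avg2 J (fun z => expR (- W z) * b i z))); first exact: cpr.
  exact: (avg2_cont oQ sQ (fun z => cEb (z := z) Ji) Qpr0).
have [|dH DH] := @caratheodory R n H C q _ cC.
  have nQ : nbhs (0 : V) [set h | Q (h + q)].
    apply: open_nbhs_nbhs; split; last by rewrite /= add0r.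
    apply: open_comp oQ => h _.
    by apply: contD; [exact: cont_id|exact: cont_cst].
  apply: filterS nQ => h Qh; rewrite (solution_increment Qq Qh).
  rewrite [RHS](bigD1 0) //= /C /leafdir eqxx /= mulr1 mulrDr.
  have E i : (h + q) 0 i - q 0 i = h 0 i by rewrite mxE addrK.
  rewrite E mulrC; congr (_ + _); rewrite mulr_sumr; apply: eq_bigr => i i0.
  by rewrite E i0 mulrCA.
split=> //; rewrite DH (bigD1 0) //= /C /leafdir eqxx /= mulr1 pr0 Wxx mulrDr.
rewrite mulrC; congr (_ + _); rewrite mulr_sumr; apply: eq_bigr => i i0.
rewrite i0 mulrCA; congr (_ * (_ * _)); apply: eq_int01 => s _.
exact: Ebxx.
Qed.

Lemma derive_solution0 : Q 0 -> 'D_e0 H 0 = 1.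
Proof.
move=> Q0; have [_ ->] := derive_solution e0 Q0.
have -> : Wd 0 = 0 by rewrite /Wd /radial big1 // => j _; rewrite mxE mul0r.
rewrite expR0 mul1r mxE !eqxx big1 ?addr0 // => j.
by rewrite /leafdir mxE => /negbTE ->; rewrite andbF mul0r.
Qed.

(** The derivative formula involves [H] only through values of the [P j] and their first derivatives
    on its graph. If [H] is of class C^k, so is the formula, and [H] is of class C^(k+1). *)
Lemma smooth_solution : smooth Q H.
Proof.
elim=> [|k IH]; first exact: cH.
have CG := class_C_graph oQ IH.
have CPG j : J j -> class_C k Q (fun q => P j (G q)).
  by move=> Jj; exact: (class_C_comp oQ oU HU CG (sP Jj k)).
have CDPG i j : J j -> class_C k Q (fun q => 'D_(delta_mx 0 i) (P j) (G q)).
  move=> Jj; have /class_CS[_ /(_ (delta_mx 0 i)) CD] := sP Jj k.+1.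
  exact: (class_C_comp oQ oU HU CG CD).
have CWd : class_C k Q Wd by apply: class_C_radial => // j; exact: CDPG.
have Cgd i : J i -> class_C k Q (gd i).
  move=> Ji; apply: class_CM => //; first by apply: class_C_expR => //; exact: class_CN.
  apply: class_CD => //; first exact: CPG.
  apply: class_C_sum => // j Jj; apply: class_CM => //; first exact: class_C_coord.
  exact: CDPG.
split=> [q Qq|v]; first by have [] := derive_solution 0 Qq.
refine (class_C_eq (f := fun q => expR (Wd q) *
  (v 0 0 + \sum_(i | J i) v 0 i * avg J (gd i) q)) oQ _ _).
  by move=> q Qq; have [_ ->] := derive_solution v Qq.
apply: class_CM => //; first exact: class_C_expR.
apply: class_CD => //; first exact: class_C_cst.
apply: class_C_sum => // i Ji; apply: class_CM => //; first exact: class_C_cst.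
by apply: class_C_avg => //; exact: Cgd.
Qed.

End Regularity.

(** * From the radial equation to the full leaf system *)

Section Frobenius.
Context {R : realType} {n' : nat}.
Local Notation n := n'.+1.
Local Notation V := 'rV[R]_n.
Local Notation J := (@leafdir n').
Local Notation e0 := (delta_mx 0 0 : V).
Implicit Types (q y v : V).

Definition leaf_frame (P : 'I_n -> V -> R) j y : V := delta_mx 0 j + P j y *: e0.

Lemma tang_basis (J : pred 'I_n) i : J i -> (delta_mx 0 i : V) *m tang J = delta_mx 0 i.
Proof.
move=> Ji; apply/rowP => l; rewrite tangE mxE eqxx /=.
have [->|_] := eqVneq l i; first by rewrite Ji.
by rewrite if_same.
Qed.

Lemma derive_graph (Q : set V) (H : V -> R) q v : open Q -> class_C 1 Q H -> Q q ->
  differentiable (graph H) q /\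
  'D_v (graph H) q = 'D_v H q *: e0 + v *m tang J.
Proof.
move=> oQ CH Qq; have CG := class_C_graph oQ CH.
have /class_CS[dG _] := CG; have [dH _] := CH; split; first exact: dG.
apply/rowP => j; rewrite -derive_coord; last exact: dG.
have E (a c : V) (s : R) : (s *: a + c) 0 j = s * a 0 j + c 0 j by rewrite !mxE.
rewrite E tangE mxE eqxx /=.
have [Jj|nJj] := boolP (J j).
  have -> : (fun q => graph H q 0 j) = (fun q => q 0 j).
    by apply/funext => x; rewrite graphE Jj.
  rewrite (derive_coord _ _ (f := id)) // derive_id.
  by move: Jj; rewrite /leafdir => /negbTE ->; rewrite mulr0 add0r.
have -> : (fun q => graph H q 0 j) = H.
  by apply/funext => x; rewrite graphE (negbTE nJj).
by move: nJj; rewrite /leafdir negbK => /eqP ->; rewrite eqxx mulr1 addr0.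
Qed.

Variables (P : 'I_n -> V -> R) (U Q : set V) (H : V -> R).
Hypotheses (oU : open U) (sP : forall j, J j -> smooth U (P j)).
Hypotheses (oQ : open Q) (sQ : star J Q) (sH : smooth Q H).
Hypotheses (HU : forall q, Q q -> U (graph H q)).
Hypothesis HE : forall q, Q q -> H q = q 0 0 + radial J (fun j q => P j (graph H q)) q.

Local Notation G := (graph H).

(** The bracket of two such fields is the difference of the two sides times [e0], so the hypothesis
    says that the fields commute. *)
Hypothesis integrable : forall i j y, J i -> J j -> U y ->
  'D_(leaf_frame P i y) (P j) y = 'D_(leaf_frame P j y) (P i) y.

(** The defect of [H] in the j-th equation of the leaf system. *)
Let m j q := 'D_(delta_mx 0 j) H q - P j (G q).

Let CPG k j : J j -> class_C k Q (fun q => P j (G q)).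
Proof.
move=> Jj; have CG := class_C_graph oQ (sH k).
exact: (class_C_comp oQ oU HU CG (sP Jj k)).
Qed.

Let Cm k j : J j -> class_C k Q (m j).
Proof.
move=> Jj; apply: class_CB => //; last exact: CPG.
by have /class_CS[_] := sH k.+1; apply.
Qed.

(** Differentiating the integral equation along the ray shows that the defect vanishes on the radial
    direction. *)
Let sum_m q : Q q -> \sum_(j | J j) q 0 j * m j q = 0.
Proof.
move=> Qq; have [dH _] := sH 1%N.
under eq_bigr do rewrite mulrBr.
rewrite sumrB -(derive_tang J _ (dH q Qq)).
have Crad : class_C 1 Q (radial J (fun j q => P j (G q))).
  by apply: class_C_radial => // j; exact: CPG.
have [dr _] := Crad.
have dc : differentiable (fun q : V => q 0 0) q by exact: differentiable_coord.
rewrite (derive_eq_on _ oQ HE Qq) (diffsD dc (dr q Qq)).2.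
rewrite (derive_coord _ _ (f := id)) // derive_id tangE /= add0r.
apply/eqP; rewrite subr_eq0; apply/eqP.
by apply: (derive_radial_tang oQ sQ _ Qq) => j; exact: CPG.
Qed.

Let derive_PG i j q : J i -> J j -> Q q -> 'D_(delta_mx 0 i) (fun q => P j (G q)) q =
  'D_(leaf_frame P i (G q)) (P j) (G q) + m i q * 'D_e0 (P j) (G q).
Proof.
move=> Ji Jj Qq; have [dGq DGq] := derive_graph (delta_mx 0 i) oQ (sH 1%N) Qq.
have [dP _] := sP Jj 1%N; have dPq := dP _ (HU Qq).
rewrite (derive_comp (f := G) (g := P j) _ dGq dPq) DGq tang_basis //.
have -> : 'D_(delta_mx 0 i) H q *: e0 + (delta_mx 0 i : V) =
    leaf_frame P i (G q) + m i q *: e0.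
  by rewrite /leaf_frame -addrA -scalerDl /m [P _ _ + _]addrC subrK addrC.
by rewrite !(deriveE _ dPq) linearD linearZ.
Qed.

(** Differentiating [sum_m] in direction [i] controls the D_i m_j; exchanging indices turns them
    into D_j m_i, which form the radial derivative of [m i]. *)
Let radial_m i q : J i -> Q q ->
  m i q + 'D_(q *m tang J) (m i) q =
  (\sum_(j | J j) q 0 j * 'D_e0 (P j) (G q)) * m i q.
Proof.
move=> Ji Qq.
have dm j : J j -> differentiable (m j) q by move=> /(Cm 1)[d _]; exact: d.
have dc j : differentiable (fun q : V => q 0 j) q by exact: differentiable_coord.
have dt j : J j -> differentiable (fun q : V => q 0 j * m j q) q.
  by move=> /dm dj; have [] := diffsM (dc j) dj.
have E0 : m i q + \sum_(j | J j) q 0 j * 'D_(delta_mx 0 i) (m j) q = 0.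
  have E1 : 'D_(delta_mx 0 i) (fun q => \sum_(j | J j) q 0 j * m j q) q = 0.
    by rewrite (derive_eq_on (g := fun=> 0) _ oQ sum_m Qq) derive_cst.
  rewrite -[RHS]E1 (diffs_sum _ dt).2.
  rewrite [RHS](eq_bigr (fun j => m j q * (delta_mx 0 i : V) 0 j +
     q 0 j * 'D_(delta_mx 0 i) (m j) q)); last first.
    move=> j /dm dj; rewrite (diffsM (dc j) dj).2 (derive_coord _ _ (f := id)) //.
    by rewrite derive_id addrC.
  rewrite [RHS]big_split /=; congr (_ + _).
  rewrite (bigD1 i) //= mxE !eqxx mulr1 big1 ?addr0 // => j /andP[_ ji].
  by rewrite mxE (negbTE ji) andbF mulr0.
have Dm j l : J j -> J l -> 'D_(delta_mx 0 l) (m j) q =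
    'D_(delta_mx 0 l) ('D_(delta_mx 0 j) H) q -
    ('D_(leaf_frame P l (G q)) (P j) (G q) + m l q * 'D_e0 (P j) (G q)).
  move=> Jj Jl; have /class_CS[_ DH] := sH 2.
  have [d1 _] := DH (delta_mx 0 j); have [d2 _] := CPG 1 Jj.
  by rewrite (diffsB (d1 q Qq) (d2 q Qq)).2 derive_PG.
(* The second derivatives of [H] cancel by symmetry and the terms along leaf frames by [integrable];
   only terms linear in the defect remain. *)
have swap j : J j -> 'D_(delta_mx 0 j) (m i) q = 'D_(delta_mx 0 i) (m j) q -
    m j q * 'D_e0 (P i) (G q) + m i q * 'D_e0 (P j) (G q).
  move=> Jj; rewrite !Dm // (schwarz _ _ oQ (sH 2) Qq).
  rewrite (integrable Ji Jj (HU Qq)); ring.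
rewrite (derive_tang J _ (dm i Ji)).
rewrite (eq_bigr (fun j => q 0 j * 'D_(delta_mx 0 i) (m j) q -
  (q 0 j * m j q) * 'D_e0 (P i) (G q) + (q 0 j * 'D_e0 (P j) (G q)) * m i q)); last first.
  by move=> j Jj; rewrite swap //; ring.
rewrite big_split /= sumrB -!mulr_suml sum_m // mul0r subr0 addrA E0 add0r //.
Qed.

(* The defect s (D_i H - P_i)(dil s q) solves a homogeneous linear equation
   vanishing at s = 0. *)
Theorem frobenius q i : Q q -> J i -> 'D_(delta_mx 0 i) H q = P i (G q).
Proof.
move=> Qq Ji; apply/eqP; rewrite -subr_eq0 -/(m i q).
pose A s := \sum_(j | J j) q 0 j * 'D_e0 (P j) (G (dil J s q)).
pose d (s : R) := s * m i (dil J s q).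
have cdil (f : V -> R) : class_C 0 Q f -> cont01 (fun s => f (dil J s q)).
  by move=> cf; exact: (cont01_dil sQ cf Qq).
have cA : cont01 A.
  move=> s s01; apply: cont_sum => j Jj; apply: contM; first exact: cont_cst.
  apply: (cdil (fun x => 'D_e0 (P j) (G x))) s01.
  have /class_CS[_ /(_ e0) CD] := sP Jj 1%N.
  exact: (class_C_comp oQ oU HU (class_C_graph oQ (sH 0%N)) CD).
have cd : cont01 d.
  by move=> s s01; apply: contM; [exact: cont_id|exact: (cdil _ (Cm 0 Ji))].
have dd (s : R) : 0 <= s <= 1 -> is_derive s 1 d (A s * d s).
  move=> s01; have Qs := sQ s01 Qq; have [dm _] := Cm 1 Ji.
  have := is_deriveM (is_derive_id s 1) (is_derive_dil (Cm 1 Ji) Qs).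
  congr is_derive; rewrite /GRing.scale /= mulr1 addrC.
  have : 'D_(dil J s q *m tang J) (m i) (dil J s q) =
      s * 'D_(q *m tang J) (m i) (dil J s q).
    by rewrite dil_tang !(deriveE _ (dm _ Qs)) linearZ.
  move=> <-; rewrite (radial_m Ji Qs) /A /d mulrA; congr (_ * _).
  by rewrite mulr_suml; apply: eq_bigr => j Jj; rewrite dilE Jj; ring.
(* The zero function is kept as an explicit inhomogeneous term so that [linear_ode] applies; at time
   1 it then yields [m i q] = 0. *)
have dE (t : R) : 0 <= t <= 1 ->
    d t = 0 + t * int01 (fun u => A (u * t) * d (u * t) + (fun=> 0) (u * t)).
  move=> t01; have scale01 (u : R) : 0 <= u <= 1 -> 0 <= u * t <= 1.
    by move: t01 => /andP[t0 t1] /andP[u0 u1]; rewrite mulr_ge0 // mulr_ile1.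
  have cAd : cont01 (fun u => A (u * t) * d (u * t) + (fun=> 0) (u * t)).
    move=> u u01; apply: contD; last exact: cont_cst.
    have cmul : {for u, continuous (fun u : R => u * t)} by exact: mulrr_continuous.
    apply: contM; first by apply: (cont_comp cmul); exact/cA/scale01.
    by apply: (cont_comp cmul); exact/cd/scale01.
  rewrite -int01Z // add0r (_ : d t = d (1 * t) - d (0 * t)); last first.
    have d00 : d 0 = 0 by rewrite /d mul0r.
    by rewrite mul1r (mul0r t) d00 subr0.
  apply/esym; apply: (@int01_FTC2 _ _ (fun u => d (u * t))).
    by move=> u u01; apply: contM; [exact: cont_cst|exact: cAd].
  move=> u u01; rewrite addr0 mulrC.
  by apply: (@is_derive1_comp _ d (fun u => u * t)); [exact/dd/scale01|exact: is_derive_mulr].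
have c0 : cont01 (fun=> 0 : R) by move=> s _; exact: cont_cst.
have := linear_ode cA c0 cd dE.
have -> : int01 (fun t => expR (- (t * int01 (fun u => A (u * t)))) * (fun=> 0) t) = 0.
  by rewrite -[RHS]int01_cst; apply: eq_int01 => t _; rewrite mulr0.
rewrite addr0 /d (dil1 J q) mul1r => /eqP.
by rewrite mulf_eq0 (negbTE (lt0r_neq0 (expR_gt0 _))).
Qed.

End Frobenius.

Theorem leaf_parametrization {R : realType} {n : nat} (P : 'I_n.+1 -> 'rV[R]_n.+1 -> R)
    (U : set 'rV[R]_n.+1) : open U -> U 0 ->
  (forall j, leafdir j -> smooth U (P j)) ->
  (forall i j y, leafdir i -> leafdir j -> U y ->
     'D_(leaf_frame P i y) (P j) y = 'D_(leaf_frame P j y) (P i) y) ->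
  exists (r : R) (G : 'rV[R]_n.+1 -> 'rV[R]_n.+1), [/\ 0 < r, smooth (ball 0 r) G,
    G 0 = 0, 'D_(delta_mx 0 0) G 0 = delta_mx 0 0 &
    forall q, ball 0 r q -> U (G q) /\
      forall j, leafdir j -> 'D_(delta_mx 0 j) G q = leaf_frame P j (G q)].
Proof.
move=> oU U0 sP intP.
have : nbhs (0 : 'rV[R]_n.+1) U by apply: open_nbhs_nbhs.
move=> /nbhs_ballP[rho /= rho0 rhoU].
(* Passing to a ball makes the domain convex, as Hadamard's formula between two graph points
   requires. *)
pose B : set 'rV[R]_n.+1 := ball 0 rho.
have oB : open B by exact: ball_open.
have sPB j : leafdir j -> smooth B (P j).
  by move=> Jj k; exact: class_C_sub rhoU (sP j Jj k).
have B0 : B 0 by exact: ballxx.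
have [r [H [r0 cH] HE]] := picard oB B0 (fun j Jj => sPB j Jj 1%N).
pose Q : set 'rV[R]_n.+1 := ball 0 r.
have oQ : open Q by exact: ball_open.
have Q0 : Q 0 by exact: ballxx.
have sQ : star leafdir Q by exact: star_ball.
have HB q : Q q -> B (graph H q) by move=> /HE[].
have HE2 q : Q q -> H q = q 0 0 + radial leafdir (fun j q => P j (graph H q)) q.
  by move=> /HE[].
have sgB (x y : 'rV[R]_n.+1) : B x -> B y -> segment_in B x y by exact: segment_ball.
have sH := smooth_solution oB sgB sPB oQ sQ cH HB HE2.
have D0 := derive_solution0 oB sgB sPB oQ sQ cH HB HE2 Q0.
have intB i j y : leafdir i -> leafdir j -> B y ->
    'D_(leaf_frame P i y) (P j) y = 'D_(leaf_frame P j y) (P i) y.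
  by move=> Ji Jj By; apply: intP => //; exact: rhoU.
have DG q v : Q q -> 'D_v (graph H) q = 'D_v H q *: delta_mx 0 0 + v *m tang leafdir.
  by move=> Qq; have [_] := derive_graph v oQ (sH 1%N) Qq.
exists r, (graph H); split=> //.
- by move=> k; exact: class_C_graph.
- have H0 : H 0 = 0.
    rewrite HE2 // mxE add0r /radial big1 // => j _.
    by rewrite mxE mul0r.
  by rewrite /graph H0 scale0r mul0mx addr0.
- rewrite DG // D0 scale1r -[RHS]addr0; congr (_ + _).
  apply/rowP => j; rewrite tangE !mxE /leafdir eqxx /=.
  by case: (j == 0).
- move=> q Qq; split=> [|j Jj]; first exact/rhoU/HB.
  rewrite DG // tang_basis // /leaf_frame addrC; congr (_ + _ *: _).
  exact: (frobenius oB sPB oQ sQ sH HB HE2 intB).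
Qed.

(** * Changes of one coordinate *)

Section Smooth.
Context {R : realType}.

Lemma smooth_sub {n} {V : normedModType R} (U W : set 'rV[R]_n) (f : 'rV[R]_n -> V) :
  W `<=` U -> smooth U f -> smooth W f.
Proof. by move=> WU sf k; exact: class_C_sub WU (sf k). Qed.

Lemma smooth_eq {n} {V : normedModType R} (U : set 'rV[R]_n) (f g : 'rV[R]_n -> V) :
  open U -> (forall q, U q -> f q = g q) -> smooth U f -> smooth U g.
Proof. by move=> oU fg sf k; exact: class_C_eq oU fg (sf k). Qed.

Lemma smooth_comp {n m l} (U : set 'rV[R]_n) (W : set 'rV[R]_m)
    (f : 'rV[R]_n -> 'rV[R]_m) (g : 'rV[R]_m -> 'rV[R]_l) : open U -> open W ->
  (forall x, U x -> W (f x)) -> smooth U f -> smooth W g -> smooth U (fun x => g (f x)).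
Proof. by move=> oU oW UW sf sg k; exact: class_C_compV oU oW UW (sf k) (sg k). Qed.

Lemma smooth_compR {n m} (U : set 'rV[R]_n) (W : set 'rV[R]_m)
    (f : 'rV[R]_n -> 'rV[R]_m) (g : 'rV[R]_m -> R) : open U -> open W ->
  (forall x, U x -> W (f x)) -> smooth U f -> smooth W g -> smooth U (fun x => g (f x)).
Proof. by move=> oU oW UW sf sg k; exact: class_C_comp oU oW UW (sf k) (sg k). Qed.

Lemma smooth_coord {n m} (U : set 'rV[R]_n) (f : 'rV[R]_n -> 'rV[R]_m) j : open U ->
  smooth U f -> smooth U (fun x => f x 0 j : R).
Proof. by move=> oU sf k; have /(class_C_rV _ _ oU)/(_ j) := sf k. Qed.

Lemma smooth_diff {n} {V : normedModType R} (U : set 'rV[R]_n) (f : 'rV[R]_n -> V) p :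
  smooth U f -> U p -> differentiable f p.
Proof. by move=> /(_ 1%N)[d _] Up; exact: d. Qed.

Lemma smooth_cont {n} {V : normedModType R} (U : set 'rV[R]_n) (f : 'rV[R]_n -> V) p :
  smooth U f -> U p -> {for p, continuous f}.
Proof. by move=> /(_ 0%N); exact. Qed.

Lemma smooth_derive {n} {V : normedModType R} (U : set 'rV[R]_n) (f : 'rV[R]_n -> V) v :
  smooth U f -> smooth U ('D_v f).
Proof. by move=> sf k; have [_] := sf k.+1; apply. Qed.

Lemma open_preimage {n m} (U : set 'rV[R]_n) (W : set 'rV[R]_m)
    (f : 'rV[R]_n -> 'rV[R]_m) : open U -> open W -> class_C 0 U f ->
  open [set x | U x /\ W (f x)].
Proof.
move=> oU oW cf; rewrite openE => x [Ux Wfx]; rewrite /interior.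
have nU : nbhs x U by apply: open_nbhs_nbhs.
have nW : nbhs (f x) W by apply: open_nbhs_nbhs.
by apply: filterI => //; exact: cf x Ux _ nW.
Qed.

Lemma unitmx_inj n (M : 'M[R]_n) : (forall v : 'rV[R]_n, v *m M = 0 -> v = 0) ->
  M \in unitmx.
Proof.
move=> inj; rewrite -row_free_unit -kermx_eq0; apply/rowV0P => v /sub_kermxP.
exact: inj.
Qed.

End Smooth.

Section CoordinateChange.
Context {R : realType} {n' : nat}.
Local Notation n := n'.+1.

(* [g] is the inverse of the change of coordinates that replaces the [i]-th
   coordinate by [f]. *)
Lemma coordinate_change (i : 'I_n) (f : 'rV[R]_n -> R) (U : set 'rV[R]_n) :
  open U -> U 0 -> smooth U f -> f 0 = 0 -> 'D_(delta_mx 0 i) f 0 != 0 ->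
  exists (Y : set 'rV[R]_n) (g : 'rV[R]_n -> 'rV[R]_n),
    [/\ open Y, Y 0, smooth Y g, g 0 = 0 &
        forall y, Y y -> [/\ U (g y), f (g y) = y 0 i &
          forall j, j != i -> g y 0 j = y 0 j]].
Proof.
move=> oU U0 sf f0 Df.
pose h (q : 'rV[R]_n) : 'rV[R]_n := q + (f q - q 0 i) *: delta_mx 0 i.
have hE q j : h q 0 j = if j == i then f q else q 0 j.
  have E (a c : 'rV[R]_n) (s : R) : (a + s *: c) 0 j = a 0 j + s * c 0 j by rewrite !mxE.
  rewrite /h E mxE eqxx /=; case: eqVneq => [->|_]; last by rewrite mulr0 addr0.
  by rewrite mulr1 addrC subrK.
have sh : smooth U h.
  move=> k; apply/class_C_rV => // j; have [ji|ji] := eqVneq j i.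
    by apply: class_C_eq oU _ (sf k) => q _; rewrite hE ji eqxx.
  by apply: class_C_eq oU _ (class_C_coord k U j) => q _; rewrite hE (negbTE ji).
have dh := smooth_diff sh U0; have df := smooth_diff sf U0.
have uJ : jac h 0 \in unitmx.
  apply: unitmx_inj => v; rewrite -derive_jac // => Dv.
  have vj j : j != i -> v 0 j = 0.
    move=> ji; have : ('D_v h 0) 0 j = 0 by rewrite Dv mxE.
    rewrite -derive_coord //.
    have -> : (fun q => h q 0 j) = (fun q : 'rV[R]_n => q 0 j).
      by apply/funext => q; rewrite hE (negbTE ji).
    by rewrite (derive_coord _ _ (f := id)) // derive_id.
  have vE : v = v 0 i *: delta_mx 0 i.
    apply/rowP => j; rewrite !mxE eqxx /=; have [->|ji] := eqVneq j i.
      by rewrite mulr1.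
    by rewrite vj // mulr0.
  have : ('D_v h 0) 0 i = 0 by rewrite Dv mxE.
  rewrite -derive_coord //.
  have -> : (fun q => h q 0 i) = f by apply/funext => q; rewrite hE eqxx.
  rewrite vE deriveE // linearZ -deriveE // => /eqP.
  by rewrite mulf_eq0 (negbTE Df) orbF => /eqP ->; rewrite scale0r.
have [V [g [oV V0 VU oY [sg gh _]]]] := inverse_function oU U0 sh uJ.
have h0 : h 0 = 0.
  apply/rowP => j; rewrite hE f0 mxE; by case: ifP.
exists (h @` V), g; split=> //; first by exists 0.
- by rewrite -{1}h0 gh.
- move=> _ [q Vq <-]; rewrite gh // hE eqxx; split=> //; first exact: VU.
  by move=> j ji; rewrite hE (negbTE ji).
Qed.

End CoordinateChange.

(** * Brackets of fields annihilating a function *)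

Section Bracket.
Context {R : realType} {n : nat}.
Implicit Types (X Y : 'rV[R]_n -> 'rV[R]_n) (h : 'rV[R]_n -> R).

Lemma derive_along X h (N : set 'rV[R]_n) p u : open N -> class_C 1 N X -> class_C 2 N h ->
  N p -> 'D_u (fun q => 'D_(X q) h q) p = 'D_('D_u X p) h p + 'D_u ('D_(X p) h) p.
Proof.
move=> oN CX Ch Np; have /class_CS[dh Dh] := Ch; have [dX _] := CX.
have dDh j : differentiable ('D_(delta_mx 0 j) h) p.
  by have [d _] := Dh (delta_mx 0 j); exact: d.
have dXj j : differentiable (fun q => X q 0 j) p.
  by apply: (differentiable_coordP _ _).1; exact: dX.
have E v q : N q -> 'D_v h q = \sum_j v 0 j * 'D_(delta_mx 0 j) h q.
  by move=> Nq; rewrite derive_basis //; exact: dh.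
have dt j : true -> differentiable (fun q => X q 0 j * 'D_(delta_mx 0 j) h q) p.
  by move=> _; have [] := diffsM (dXj j) (dDh j).
have dt' j : true -> differentiable (fun q => X p 0 j * 'D_(delta_mx 0 j) h q) p.
  by move=> _; have [] := diffsZ (X p 0 j) (dDh j).
rewrite (derive_eq_on (g := fun q => \sum_j X q 0 j * 'D_(delta_mx 0 j) h q) _ oN _ Np); last first.
  by move=> q Nq; exact: E.
rewrite (derive_eq_on (f := 'D_(X p) h)
  (g := fun q => \sum_j X p 0 j * 'D_(delta_mx 0 j) h q) _ oN _ Np); last first.
  by move=> q Nq; exact: E.
rewrite (diffs_sum _ dt).2 (diffs_sum _ dt').2 E // -big_split /=.
apply: eq_bigr => j _.
have DX : 'D_u (fun q => X q 0 j) p = ('D_u X p) 0 j by apply: derive_coord; exact: dX.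
rewrite (diffsM (dXj j) (dDh j)).2 (diffsZ _ (dDh j)).2 DX addrC.
by congr (_ + _); exact: mulrC.
Qed.

(** [X, Y] h = X (Y h) - Y (X h): [derive_along] computes both terms, and the parts with second
    derivatives of [h] cancel by [schwarz]. *)
Lemma bracket_kernel X Y h (N : set 'rV[R]_n) p : open N -> class_C 1 N X ->
  class_C 1 N Y -> class_C 2 N h -> (forall q, N q -> 'D_(X q) h q = 0) ->
  (forall q, N q -> 'D_(Y q) h q = 0) -> N p ->
  'D_('D_(X p) Y p - 'D_(Y p) X p) h p = 0.
Proof.
move=> oN CX CY Ch X0 Y0 Np; have [dh _] := Ch; have dhp := dh p Np.
have E1 := derive_along (X p) oN CY Ch Np; have E2 := derive_along (Y p) oN CX Ch Np.
rewrite (derive_eq_on (g := fun=> 0) _ oN Y0 Np) derive_cst in E1.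
rewrite (derive_eq_on (g := fun=> 0) _ oN X0 Np) derive_cst in E2.
rewrite (schwarz _ _ oN Ch Np) in E1.
have -> : 'D_('D_(X p) Y p - 'D_(Y p) X p) h p =
    'D_('D_(X p) Y p) h p - 'D_('D_(Y p) X p) h p.
  by rewrite !(deriveE _ dhp) linearB.
by move/esym/eqP: E1; rewrite addr_eq0 => /eqP ->;
  move/esym/eqP: E2; rewrite addr_eq0 => /eqP ->; rewrite subrr.
Qed.

End Bracket.

(** * Integrable structures are involutive and leafwise closed *)

Section Chart.
Context {R : realType} {B : body R}.

Lemma in_chartE {V : normedModType R} (f : B -> V) x : in_chart f (chart x) = f x.
Proof.
rewrite /in_chart; apply: xget_subset1; first by exists x.
by move=> _ _ [y /chart_inj -> <-] [y' /chart_inj -> <-].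
Qed.

Lemma chart_image (W : set B) x : (chart @` W) (chart x) -> W x.
Proof. by move=> [x' Wx' /chart_inj <-]. Qed.

Lemma E23P (u : 'rV[R]_3) : (u \in @E23 R) = (u 0 i1 == 0).
Proof.
apply/idP/eqP => [/mem_span2[s [t ->]]|u0]; first by rewrite !mxE /= !mulr0 addr0.
apply/mem_span2; exists (u 0 i2), (u 0 i3).
by rewrite {1}(row3E u) u0 scale0r add0r.
Qed.

Lemma coordinate_frame_jac (y : B -> 'rV[R]_3) z x :
  coordinate_frame y z x = jac z (y x).
Proof. by []. Qed.

Section LocalCoordinates.
Variables (W : set B) (y : B -> 'rV[R]_3) (z : 'rV[R]_3 -> 'rV[R]_3).
Hypothesis yz : local_coordinates W y z.
Local Notation yy := (in_chart y).

(** The chain rule for the composition of [z] with [y] in the chart, which is the identity: the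
    derivative of [y] along [X] lists the components of [X] in the coordinate frame. *)
Lemma derive_coordinates x X : W x ->
  X = 'D_X yy (chart x) *m coordinate_frame y z x.
Proof.
case: yz => oW oyW sy sz zy Wx.
have cx : (chart @` W) (chart x) by exists x.
have dy : differentiable yy (chart x) by exact: smooth_diff sy cx.
have yW : (y @` W) (yy (chart x)) by rewrite in_chartE; exists x.
have dz : differentiable z (yy (chart x)) by exact: smooth_diff sz yW.
have E : 'D_X (fun p => z (yy p)) (chart x) = X.
  rewrite (derive_eq_on (g := id) _ (chart_open oW) _ cx) ?derive_id //.
  by move=> _ [x' Wx' <-]; rewrite in_chartE zy.
rewrite coordinate_frame_jac -(in_chartE y x).
have := derive_jac ('D_X yy (chart x)) dz.
by move=> <-; exact: (etrans (esym E) (derive_comp X dy dz)).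
Qed.

Variables (D : B -> {vspace tangent R}) (w : dual_field D) (O : B -> @form3 R).
Hypothesis yF : forall x, W x -> G1B_structure w O x (coordinate_frame y z x).

Lemma mem_coordinates x X : W x -> (X \in D x) = (('D_X yy (chart x)) 0 i1 == 0).
Proof.
move=> Wx; have [uF <- _ _ _] := yF Wx.
by rewrite {1}(derive_coordinates X Wx) mem_E23 // E23P.
Qed.

Lemma dual_eval_coordinates x X : W x -> X \in D x ->
  dual_eval w x X = ('D_X yy (chart x)) 0 i2.
Proof.
move=> Wx DX; rewrite {1}(derive_coordinates X Wx).
by apply: dual_eval_frame (yF Wx) _; rewrite E23P -mem_coordinates.
Qed.

End LocalCoordinates.

Section Forward.
Variables (D : B -> {vspace tangent R}) (w : dual_field D) (O : B -> @form3 R).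
Hypothesis intP : integrable_structure (G1B_structure w O).

Lemma integrable_involutive : involutive_distribution D.
Proof.
move=> N X Y oN [sX DX] [sY DY] x Nx.
have [W [y [z [yz Wx yF]]]] := intP x; have [oW _ sy _ _] := yz.
rewrite (mem_coordinates yz yF _ Wx) /lie_bracket.
have oM : open (chart @` (N `&` W)) by apply: chart_open; exact: openI.
have sub1 : chart @` (N `&` W) `<=` chart @` N by move=> _ [q [? ?] <-]; exists q.
have sub2 : chart @` (N `&` W) `<=` chart @` W by move=> _ [q [? ?] <-]; exists q.
have Mx : (chart @` (N `&` W)) (chart x) by exists x.
have dy : differentiable (in_chart y) (chart x).
  by apply: smooth_diff sy _; exists x.
have sy1 : smooth (chart @` (N `&` W)) (fun p => in_chart y p 0 i1 : R).
  by apply: smooth_coord => //; exact: smooth_sub sub2 sy.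
have K (Z : B -> tangent R) : (forall x, N x -> Z x \in D x) ->
    forall q, (chart @` (N `&` W)) q ->
    'D_(in_chart Z q) (fun p => in_chart y p 0 i1 : R) q = 0.
  move=> DZ _ [x' [Nx' Wx'] <-]; rewrite in_chartE derive_coord; last first.
    by apply: smooth_diff sy _; exists x'.
  by apply/eqP; rewrite -(mem_coordinates yz yF _ Wx'); exact: DZ.
rewrite -derive_coord //.
have /= := bracket_kernel oM (smooth_sub sub1 sX 1%N) (smooth_sub sub1 sY 1%N)
  (sy1 2%N) (K _ DX) (K _ DY) Mx.
by rewrite !in_chartE => ->.
Qed.

Lemma integrable_leafwise_closed : leafwise_closed w.
Proof.
move=> x0 U s [oU ss Ds] _ u Uu v v'.
have [W [y [z [yz Wx yF]]]] := intP (s u); have [oW _ sy _ _] := yz.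
pose N := [set q | U q /\ (chart @` W) (chart (s q))].
have oN : open N by exact: (open_preimage (f := chart \o s) oU (chart_open oW) (ss 0%N)).
have Nu : N u by split=> //; exists (s u).
have NU : N `<=` U by move=> q [].
have sN : smooth N (chart \o s) by exact: smooth_sub NU ss.
have sy2 : smooth (chart @` W) (fun p => in_chart y p 0 i2 : R).
  by apply: smooth_coord => //; exact: chart_open.
(* The second coordinate along the surface; the pulled back form is its differential on the part [N]
   of the domain that [s] maps into [W]. *)
pose f q : R := in_chart y (chart (s q)) 0 i2.
have sf : smooth N f.
  exact: (smooth_compR (f := chart \o s) oN (chart_open oW) (fun q (h : N q) => h.2) sN sy2).
have E v1 q : N q -> pullback w s q v1 = 'D_v1 f q.
  move=> [Uq Wq]; have Wsq := chart_image Wq.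
  rewrite /pullback (dual_eval_coordinates yz yF Wsq); last first.
    by apply/(Ds q Uq); exists v1.
  have ds : differentiable (chart \o s) q by exact: smooth_diff ss Uq.
  have dy : differentiable (in_chart y) ((chart \o s) q) by exact: smooth_diff sy Wq.
  have dy2 : differentiable (fun p => in_chart y p 0 i2 : R) ((chart \o s) q).
    by exact: smooth_diff sy2 Wq.
  rewrite -derive_coord //; symmetry.
  exact: (derive_comp v1 ds dy2).
have Dv := derive_eq_on v oN (E v') Nu; have Dv' := derive_eq_on v' oN (E v) Nu.
exact: (etrans Dv (etrans (schwarz v v' oN (sf 2%N) Nu) (esym Dv'))).
Qed.

End Forward.
End Chart.

Section SmoothAlgebra.
Context {R : realType} {n : nat}.
Variables (U : set 'rV[R]_n).
Hypothesis oU : open U.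

Lemma smoothM (f g : 'rV[R]_n -> R) : smooth U f -> smooth U g -> smooth U (fun y => f y * g y).
Proof. by move=> sf sg k; exact: class_CM oU (sf k) (sg k). Qed.

Lemma smoothD {V : normedModType R} (f g : 'rV[R]_n -> V) :
  smooth U f -> smooth U g -> smooth U (fun y => f y + g y).
Proof. by move=> sf sg k; exact: class_CD oU (sf k) (sg k). Qed.

Lemma smoothB {V : normedModType R} (f g : 'rV[R]_n -> V) :
  smooth U f -> smooth U g -> smooth U (fun y => f y - g y).
Proof. by move=> sf sg k; exact: class_CB oU (sf k) (sg k). Qed.

Lemma smoothZl {V : normedModType R} (f : 'rV[R]_n -> R) (u : V) :
  smooth U f -> smooth U (fun y => f y *: u).
Proof. by move=> sf k; exact: class_CZl oU (sf k). Qed.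

End SmoothAlgebra.

(** * Normal form of an involutive, leafwise closed structure *)

Section Planes.
Context {R : realType}.

Lemma plane_span (D : {vspace 'rV[R]_3}) u v : \dim D = 2 -> u \in D -> v \in D ->
  u != 0 -> v \notin <[u]>%VS -> <<[:: u; v]>>%VS = D.
Proof.
move=> dimD Du Dv u0 vu; apply/eqP; rewrite eqEdim dimD; apply/andP; split.
  by apply/subvP => a /mem_span2[s [t ->]]; rewrite memvD ?memvZ.
have : free [:: v; u] by rewrite free_cons span_seq1 vu /= seq1_free.
rewrite /free => /eqP fE; rewrite (eq_span (Y := [:: v; u])) ?fE //.
by move=> a; rewrite !inE orbC.
Qed.

End Planes.

Section AdaptedFrame.
Context {R : realType} {B : body R}.
Variables (D : B -> {vspace tangent R}) (w : dual_field D).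

Lemma dual_eval0 x : dual_eval w x 0 = 0.
Proof. by rewrite /dual_eval !linear0. Qed.

(** The nonzero value on the second row later makes the primitive of the form a valid second
    coordinate. *)
Lemma adapted_frame x : \dim (D x) = 2 -> (exists2 v, v \in D x & dual_eval w x v != 0) ->
  exists F : 'M[R]_3, [/\ F \in unitmx, D x = <<[:: row i2 F; row i3 F]>>%VS &
    dual_eval w x (row i2 F) != 0].
Proof.
move=> dimD [v2 Dv2 wv2].
have v20 : v2 != 0 by apply: contraNneq wv2 => ->; rewrite dual_eval0.
have [v3 Dv3 v3v2] : exists2 v3, v3 \in D x & v3 \notin <[v2]>%VS.
  apply/subvPn/negP => /dimvS; rewrite dimD dim_vline v20; by [].
have [v1 _ Dv1] : exists2 v1, v1 \in (fullv : {vspace 'rV[R]_3}) & v1 \notin D x.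
  by apply/subvPn/negP => /dimvS; rewrite dimD dimvf /dim.
have DE : D x = <<[:: v2; v3]>>%VS by rewrite (plane_span dimD Dv2 Dv3 v20 v3v2).
pose F : 'M[R]_3 := \matrix_i [tuple v1; v2; v3]`_i.
have r1 : row i1 F = v1 by rewrite rowK.
have r2 : row i2 F = v2 by rewrite rowK.
have r3 : row i3 F = v3 by rewrite rowK.
exists F; rewrite r2 r3; split=> //.
apply: unitmx_inj => v.
rewrite {1}(row3E v) !mulmxDl -!scalemxAl -!row_basis r1 r2 r3 => v0.
have a0 : v 0 i1 = 0.
  apply: contraNeq Dv1 => a0; rewrite -[v1](scalerK a0) memvZ //.
  move/eqP: v0; rewrite -addrA addr_eq0 => /eqP ->.
  by rewrite memvN memvD ?memvZ.
have c0 : v 0 i3 = 0.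
  apply: contraNeq v3v2 => c0; rewrite -[v3](scalerK c0) memvZ //.
  move/eqP: v0; rewrite a0 scale0r add0r addrC addr_eq0 => /eqP ->.
  by rewrite memvN memvZ ?memv_line.
move/eqP: v0; rewrite a0 c0 !scale0r addr0 add0r scaler_eq0 (negbTE v20) orbF => /eqP b0.
by rewrite (row3E v) a0 b0 c0 !scale0r !addr0.
Qed.

End AdaptedFrame.

(** * Affine coordinates centred at a point *)

Section AffineCoordinates.
Context {R : realType} {B : body R}.
Variables (x0 : B) (F : 'M[R]_3).

Definition affine (y : 'rV[R]_3) : 'rV[R]_3 := chart x0 + y *m F.
Definition affine_inv (p : 'rV[R]_3) : 'rV[R]_3 := (p - chart x0) *m invmx F.
(** The point of the body with affine coordinates [y]; the default [x0] is taken when [affine y] is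
    outside the range of the chart. *)
Definition affine_point (y : 'rV[R]_3) : B := xget x0 [set x | chart x = affine y].
Definition affine_dom (W : set B) := affine @^-1` (chart @` W).

Lemma affineE : F \in unitmx -> forall p, affine (affine_inv p) = p.
Proof. by move=> uF p; rewrite /affine /affine_inv mulmxKV // addrC subrK. Qed.

Lemma affine_invE : F \in unitmx -> forall y, affine_inv (affine y) = y.
Proof. by move=> uF y; rewrite /affine /affine_inv addrC addKr mulmxK. Qed.

Lemma affine_pointE x : F \in unitmx -> affine_point (affine_inv (chart x)) = x.
Proof.
move=> uF; rewrite /affine_point affineE //; apply: xget_subset1 => //.
by move=> a b /= <- /chart_inj.
Qed.

Lemma chart_affine_point W y : affine_dom W y -> chart (affine_point y) = affine y /\ W (affine_point y).
Proof.
move=> [x Wx xy]; have -> : affine_point y = x; last by [].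
by rewrite /affine_point -xy; apply: xget_subset1 => // a b /= /chart_inj -> /chart_inj.
Qed.

Lemma smooth_affine U : open U -> smooth U affine.
Proof. by move=> oU k; apply: class_CD => //; [exact: class_C_cst|exact: class_C_mulmx]. Qed.

Lemma smooth_affine_inv U : open U -> smooth U affine_inv.
Proof.
move=> oU k; apply: class_C_eq oU _ (class_CB oU (class_C_mulmx k (invmx F) oU)
  (class_C_cst k U (chart x0 *m invmx F))) => p _.
by rewrite /affine_inv mulmxBl.
Qed.

Lemma open_affine_dom W : open W -> open (affine_dom W).
Proof.
move=> oW; apply: open_comp; last exact: chart_open.
by move=> y _; exact: smooth_cont (smooth_affine openT) _.
Qed.

Lemma smooth_affine_point {m} W (f : B -> 'rV[R]_m) : open W -> smooth_on W f ->
  smooth (affine_dom W) (fun y => f (affine_point y)).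
Proof.
move=> oW sf; have oV := open_affine_dom oW.
apply: (smooth_eq (f := fun y => in_chart f (affine y)) oV) => [y Vy|].
  by rewrite -(chart_affine_point Vy).1 in_chartE.
exact: (smooth_comp oV (chart_open oW) (fun y (h : affine_dom W y) => h)
  (smooth_affine oV) sf).
Qed.

Lemma smooth_affine_pointR W (f : B -> R) : open W -> smooth_on W f ->
  smooth (affine_dom W) (fun y => f (affine_point y)).
Proof.
move=> oW sf; have oV := open_affine_dom oW.
apply: (smooth_eq (f := fun y => in_chart f (affine y)) oV) => [y Vy|].
  by rewrite -(chart_affine_point Vy).1 in_chartE.
exact: (smooth_compR oV (chart_open oW) (fun y (h : affine_dom W y) => h)
  (smooth_affine oV) sf).
Qed.

Lemma affine0 : affine 0 = chart x0.
Proof. by rewrite /affine mul0mx addr0. Qed.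

Lemma affine_dom0 W : W x0 -> affine_dom W 0.
Proof. by move=> Wx; rewrite /affine_dom /= affine0; exists x0. Qed.

Lemma affine_point0 : affine_point 0 = x0.
Proof.
by rewrite /affine_point affine0; apply: xget_subset1 => // a b /= /chart_inj -> /chart_inj.
Qed.

Lemma smooth_mulmxr {n m l} (U : set 'rV[R]_n) (f : 'rV[R]_n -> 'rV[R]_m) (M : 'M[R]_(m, l)) :
  open U -> smooth U f -> smooth U (fun y => f y *m M).
Proof.
move=> oU sf; have sM : smooth setT (fun y : 'rV[R]_m => y *m M).
  by move=> k; apply: class_C_mulmx; exact: openT.
by have := smooth_comp oU openT (fun _ _ => I) sf sM.
Qed.

End AffineCoordinates.

(** * The distribution as a graph over its plane at the centre *)

Section DistributionSlopes.
Context {R : realType} {B : body R}.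
Variables (D : B -> {vspace tangent R}) (x0 : B) (F : 'M[R]_3).
Hypotheses (uF : F \in unitmx) (D0 : D x0 = <<[:: row i2 F; row i3 F]>>%VS).

Lemma distribution_slopes : distribution2 D ->
  exists (U : set 'rV[R]_3) (P : 'I_3 -> 'rV[R]_3 -> R),
    [/\ open U, U 0, U `<=` affine_dom x0 F setT, forall j, smooth U (P j) &
        forall y (u : 'rV[R]_3), U y -> (u *m F \in D (affine_point x0 F y)) =
           (u 0 i1 == u 0 i2 * P i2 y + u 0 i3 * P i3 y)].
Proof.
move=> [_ /(_ x0)[W [X [Y [oW Wx0 sX sY DXY]]]]].
pose V := affine_dom x0 F W; have oV : open V by exact: open_affine_dom.
pose a (y : 'rV[R]_3) : 'rV[R]_3 := X (affine_point x0 F y) *m invmx F.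
pose b (y : 'rV[R]_3) : 'rV[R]_3 := Y (affine_point x0 F y) *m invmx F.
have sa : smooth V a by apply: smooth_mulmxr => //; exact: smooth_affine_point.
have sb : smooth V b by apply: smooth_mulmxr => //; exact: smooth_affine_point.
have ca j : smooth V (fun y => a y 0 j : R) by exact: smooth_coord.
have cb j : smooth V (fun y => b y 0 j : R) by exact: smooth_coord.
have mem y (u : 'rV[R]_3) : V y ->
    u *m F \in D (affine_point x0 F y) <-> exists s t, u = s *: a y + t *: b y.
  move=> /chart_affine_point[_ Wy]; rewrite DXY //; split.
    move=> /mem_span2[s [t E]]; exists s, t; apply: (can_inj (mulmxK uF)).
    by rewrite E mulmxDl -!scalemxAl !mulmxKV.
  move=> [s [t ->]]; apply/mem_span2; exists s, t.
  by rewrite mulmxDl -!scalemxAl !mulmxKV.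
(* The minor that decides whether the plane spanned by [a y] and [b y] is a graph over the last two
   coordinates. *)
pose d y : R := a y 0 i2 * b y 0 i3 - a y 0 i3 * b y 0 i2.
have sd : smooth V d.
  by apply: (smoothB oV); [exact: (smoothM oV (ca i2) (cb i3))|exact: (smoothM oV (ca i3) (cb i2))].
have V0 : V 0 by exact: affine_dom0.
have C y (v : 'rV[R]_3) (p q : R) j : v = p *: a y + q *: b y ->
  v 0 j = p * a y 0 j + q * b y 0 j.
  by move=> ->; rewrite [LHS]mxE; congr (_ + _); exact: mxE.
have d0 : d 0 != 0.
  have /(mem 0 _ V0)[s [t E]] : basis_vec i2 *m F \in D (affine_point x0 F 0).
    rewrite affine_point0 D0; apply/mem_span2; exists 1, 0.
    by rewrite !row_basis scale1r scale0r addr0.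
  have /(mem 0 _ V0)[s' [t' E']] : basis_vec i3 *m F \in D (affine_point x0 F 0).
    rewrite affine_point0 D0; apply/mem_span2; exists 0, 1.
    by rewrite !row_basis scale1r scale0r add0r.
  (* At the centre e_2 and e_3 are combinations of [a 0] and [b 0]; take determinants. *)
  apply/eqP => dz; have : (s * t' - t * s') * d 0 = 1.
    have -> : (s * t' - t * s') * d 0 =
      (s * a 0 0 i2 + t * b 0 0 i2) * (s' * a 0 0 i3 + t' * b 0 0 i3) -
      (s * a 0 0 i3 + t * b 0 0 i3) * (s' * a 0 0 i2 + t' * b 0 0 i2).
      by rewrite /d; ring.
    by rewrite -!(C _ _ _ _ _ E) -!(C _ _ _ _ _ E') !mxE /= mulr1 mul0r subr0.
  by rewrite dz mulr0 => /eqP; rewrite eq_sym oner_eq0.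
pose U := [set y | V y /\ d y != 0].
have UV : U `<=` V by move=> y [].
have oU : open U.
  rewrite openE => y [Vy dy]; rewrite /interior /=; apply: filterI.
    by apply: open_nbhs_nbhs.
  exact: (cvgr_neq0 (d y)) (smooth_cont sd Vy) dy.
(* Cramer's rule for a_1 = a_2 P_2 + a_3 P_3 and b_1 = b_2 P_2 + b_3 P_3. *)
pose P (j : 'I_3) y : R := if j == i2 then
    (b y 0 i3 * a y 0 i1 - a y 0 i3 * b y 0 i1) / d y
  else (a y 0 i2 * b y 0 i1 - b y 0 i2 * a y 0 i1) / d y.
have sdV : smooth U (fun y => (d y)^-1).
  move=> k; apply: class_CV => //; first by move=> y [].
  exact: class_C_sub UV (sd k).
exists U, P; split=> //.
- by move=> y [[x _ xy] _]; exists x.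
- have ca' j : smooth U (fun y => a y 0 j : R) by exact: smooth_sub UV (ca j).
  have cb' j : smooth U (fun y => b y 0 j : R) by exact: smooth_sub UV (cb j).
  move=> j; rewrite /P; case: (j == i2).
    exact: (smoothM oU (smoothB oU (smoothM oU (cb' i3) (ca' i1))
      (smoothM oU (ca' i3) (cb' i1))) sdV).
  exact: (smoothM oU (smoothB oU (smoothM oU (ca' i2) (cb' i1))
    (smoothM oU (cb' i2) (ca' i1))) sdV).
move=> y u [Vy dy]; rewrite /P /=; apply/idP/eqP.
  move/(mem _ _ Vy) => [s [t E]]; rewrite !(C _ _ _ _ _ E).
  by move: dy; rewrite /d => dy; field.
move=> u1; apply/(mem _ _ Vy).
exists ((u 0 i2 * b y 0 i3 - u 0 i3 * b y 0 i2) / d y).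
exists ((a y 0 i2 * u 0 i3 - a y 0 i3 * u 0 i2) / d y).
rewrite [LHS]row3E [RHS]row3E !(C y _ _ _ _ erefl) u1.
by congr (_ *: _ + _ *: _ + _ *: _); move: dy; rewrite /d => dy; field.
Qed.

End DistributionSlopes.

Section LeafFields.
Context {R : realType} {B : body R}.
Variables (D : B -> {vspace tangent R}) (x0 : B) (F : 'M[R]_3).
Hypothesis uF : F \in unitmx.
Variables (U : set 'rV[R]_3) (P : 'I_3 -> 'rV[R]_3 -> R).
Hypotheses (oU : open U) (UV : U `<=` affine_dom x0 F setT)
  (sP : forall j, smooth U (P j)).
Hypothesis memD : forall y (u : 'rV[R]_3), U y -> (u *m F \in D (affine_point x0 F y)) =
  (u 0 i1 == u 0 i2 * P i2 y + u 0 i3 * P i3 y).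

Lemma ord3_0 : (0 : 'I_3) = i1.
Proof. exact: val_inj. Qed.

Lemma leafdirP (j : 'I_3) : leafdir j -> j = i2 \/ j = i3.
Proof.
rewrite /leafdir -val_eqE /=; case: j => [[|[|[|//]]] hj] //= _; [left|right];
  exact: val_inj.
Qed.

Lemma leaf_frameE (j l : 'I_3) y :
  leaf_frame P j y 0 l = (l == j)%:R + P j y * (l == 0)%:R.
Proof. by rewrite /leaf_frame !mxE !eqxx. Qed.

Lemma leaf_frame_mem j y : leafdir j -> U y -> leaf_frame P j y *m F \in D (affine_point x0 F y).
Proof.
move=> /leafdirP[] -> Uy; rewrite memD // !leaf_frameE -!val_eqE /=;
  by rewrite !(mulr1, mulr0, addr0, add0r, mul1r, mul0r).
Qed.

Lemma derive_affine u y : 'D_u (affine x0 F) y = u *m F.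
Proof.
have d : differentiable (affine x0 F) y := smooth_diff (smooth_affine x0 F openT) I.
apply/rowP => l; rewrite -derive_coord //.
pose g (z : 'rV[R]_3) : R := (z *m F) 0 l.
have dg : differentiable g y.
  by apply: (differentiable_coordP _ _).1; exact: differentiable_mulmx.
have E : (fun z => affine x0 F z 0 l) = (fun z => chart x0 0 l + g z).
  by apply/funext => z; rewrite /affine mxE.
have dc : differentiable (fun=> chart x0 0 l : R) y by exact: differentiable_cst.
rewrite E (diffsD dc dg).2 derive_cst add0r.
rewrite (derive_coord _ _ (f := fun z => z *m F)); last exact: differentiable_mulmx.
by rewrite derive_mulmx.
Qed.

(** The leaf frame carried over to the body, where involutivity is formulated. *)
Definition leaf_field j (x : B) : 'rV[R]_3 :=
  leaf_frame P j (affine_inv x0 F (chart x)) *m F.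

Definition leaf_dom : set B := [set x | U (affine_inv x0 F (chart x))].

Lemma open_leaf_dom : open leaf_dom.
Proof.
apply: (@open_comp _ _ (affine_inv x0 F \o chart)) => // x _.
apply: (@cont_comp B _ _ chart (affine_inv x0 F)); first exact: chart_continuous.
exact: smooth_cont (smooth_affine_inv x0 F openT) _.
Qed.

Lemma leaf_dom_chart q : (chart @` leaf_dom) q -> U (affine_inv x0 F q).
Proof. by move=> [x Wx <-]. Qed.

Lemma chart_leaf_dom y : U y -> (chart @` leaf_dom) (affine x0 F y).
Proof.
move=> Uy; have [E _] := chart_affine_point (UV Uy).
by exists (affine_point x0 F y); rewrite // /leaf_dom /= E affine_invE.
Qed.

Lemma smooth_leaf_frame j : smooth U (leaf_frame P j).
Proof.
apply: (smoothD oU); first by move=> k; exact: class_C_cst.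
by apply: (smoothZl oU); exact: sP.
Qed.

Lemma leaf_field_chart j q : (chart @` leaf_dom) q ->
  in_chart (leaf_field j) q = leaf_frame P j (affine_inv x0 F q) *m F.
Proof. by move=> [x _ <-]; rewrite in_chartE. Qed.

Lemma leaf_field_section j : leafdir j -> section_of D leaf_dom (leaf_field j).
Proof.
move=> Jj; have oW := chart_open open_leaf_dom; split=> [|x Wx]; last first.
  by rewrite -{2}(affine_pointE x0 x uF); exact: leaf_frame_mem.
apply: (smooth_eq (f := fun q => leaf_frame P j (affine_inv x0 F q) *m F) oW).
  by move=> q Wq; rewrite leaf_field_chart.
apply: smooth_mulmxr => //.
exact: (smooth_comp oW oU leaf_dom_chart (smooth_affine_inv x0 F oW) (smooth_leaf_frame j)).
Qed.

Lemma derive_leaf_field j y u : leafdir j -> U y ->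
  'D_(u *m F) (in_chart (leaf_field j)) (affine x0 F y) =
  ('D_u (P j) y *: delta_mx 0 0) *m F.
Proof.
move=> Jj Uy; have [sX _] := leaf_field_section Jj.
have da : differentiable (affine x0 F) y := smooth_diff (smooth_affine x0 F openT) I.
have dX : differentiable (in_chart (leaf_field j)) (affine x0 F y).
  by apply: smooth_diff sX _; exact: chart_leaf_dom.
have E : 'D_(u *m F) (in_chart (leaf_field j)) (affine x0 F y) =
    'D_u (fun z => in_chart (leaf_field j) (affine x0 F z)) y.
  by rewrite -(derive_affine u y); exact: esym (derive_comp u da dX).
pose g z : 'rV[R]_3 := leaf_frame P j z *m F.
have EU z : U z -> in_chart (leaf_field j) (affine x0 F z) = g z.
  by move=> Uz; rewrite leaf_field_chart ?affine_invE //; exact: chart_leaf_dom.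
have dg : differentiable g y.
  by apply: smooth_diff Uy; apply: smooth_mulmxr => //; exact: smooth_leaf_frame.
rewrite E (derive_eq_on u oU EU Uy).
apply/rowP => l; rewrite -derive_coord //.
set c : R := (delta_mx 0 j *m F : 'rV[R]_3) 0 l.
set e : R := (delta_mx 0 0 *m F : 'rV[R]_3) 0 l.
have gE : (fun z => g z 0 l) = (fun z => c + e * P j z).
  apply/funext => z; rewrite /g /leaf_frame mulmxDl -scalemxAl mulrC.
  by rewrite [LHS]mxE; congr (_ + _); exact: mxE.
have dP : differentiable (P j) y := smooth_diff (sP j) Uy.
have dc : differentiable (fun=> c) y by exact: differentiable_cst.
rewrite gE (diffsD dc (diffsZ e dP).1).2 derive_cst add0r (diffsZ e dP).2.
by rewrite -scalemxAl mulrC [RHS]mxE.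
Qed.

(** The bracket of two leaf fields is a multiple of the transverse vector [delta_mx 0 0 *m F], since
    only the slopes vary. Membership in D, a graph over the other two coordinates, forces the
    multiple to be zero. *)
Lemma slopes_integrable : involutive_distribution D ->
  forall i j y, leafdir i -> leafdir j -> U y ->
  'D_(leaf_frame P i y) (P j) y = 'D_(leaf_frame P j y) (P i) y.
Proof.
move=> invD i j y Ji Jj Uy.
have [Ey _] := chart_affine_point (UV Uy).
have Wy : leaf_dom (affine_point x0 F y) by rewrite /leaf_dom /= Ey affine_invE.
have := invD _ _ _ open_leaf_dom (leaf_field_section Ji) (leaf_field_section Jj) _ Wy.
rewrite /lie_bracket /leaf_field Ey affine_invE //.
rewrite -/(leaf_field j) -/(leaf_field i) (derive_leaf_field _ Jj Uy).
rewrite (derive_leaf_field _ Ji Uy) -mulmxBl -scalerBl memD // !mxE -!val_eqE /=.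
by rewrite !mulr0 mulr1 !mul0r addr0 subr_eq0 => /eqP.
Qed.

End LeafFields.

Section Connected.
Context {R : realType} {V : normedModType R}.

Lemma star_shaped_connected (U : set V) u0 : (forall u, U u -> segment_in U u0 u) ->
  connected U.
Proof.
move=> sU; have [[u1 Uu1]|U0] := pselect (exists u, U u); last first.
  have -> : U = set0 by apply/seteqP; split => // u Uu; apply: U0; exists u.
  exact: connected0.
pose A (u : V) := (fun t : R => u0 + t *: (u - u0)) @` `[0, 1].
have -> : U = \bigcup_(u in U) A u.
  apply/seteqP; split=> [u Uu|p [u Uu [t t01 <-]]].
    by exists u => //; exists 1; [rewrite /= in_itv /= ler01 lexx|rewrite scale1r addrC subrK].
  by apply: sU => //; move: t01; rewrite /= in_itv.
apply: bigcup_connected => [|u Uu].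
  exists u0 => u Uu; exists 0; first by rewrite /= in_itv /= lexx ler01.
  by rewrite scale0r addr0.
apply: connected_continuous_connected; first exact: segment_connected.
apply: continuous_subspaceT => t.
by apply: cont_segment; [exact: cont_id|exact: cont_cst|exact: cont_cst].
Qed.

End Connected.

(** Bridges the values of [pullback], in [R^o], and those of the coefficients below, in [R]. *)
Lemma derive_regular {R : realType} {V : normedModType R} (f : V -> R) (p v : V) :
  'D_v (f : V -> R^o) p = 'D_v f p.
Proof. by []. Qed.

(** * The one-form pulled back to the slices *)

Section LeafSlice.
Context {R : realType} {n : nat}.

Definition slice_mx : 'M[R]_(n, n.+1) := \matrix_(k, l) (l == lift ord0 k)%:R.

Definition slice (s : R) (u : 'rV[R]_n) : 'rV[R]_n.+1 := u *m slice_mx + s *: delta_mx 0 0.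

Lemma slice_mx_delta (k : 'I_n) : delta_mx 0 k *m slice_mx = delta_mx 0 (lift ord0 k) :> 'rV[R]_n.+1.
Proof. by rewrite -rowE; apply/rowP => l; rewrite !mxE. Qed.

Lemma mul_slice_mx (u : 'rV[R]_n) :
  u *m slice_mx = \sum_k u 0 k *: delta_mx 0 (lift ord0 k).
Proof.
rewrite {1}(row_sum_delta u) mulmx_suml; apply: eq_bigr => k _.
by rewrite -scalemxAl slice_mx_delta.
Qed.

Lemma sliceE (q : 'rV[R]_n.+1) : q = slice (q 0 0) (\row_k q 0 (lift ord0 k)).
Proof.
rewrite /slice mul_slice_mx [LHS]row_sum_delta big_ord_recl addrC; congr (_ + _).
by apply: eq_bigr => k _; rewrite mxE.
Qed.

Lemma smooth_slice s U : open U -> smooth U (slice s).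
Proof.
move=> oU k; apply: (class_CD oU); last exact: class_C_cst.
exact: class_C_mulmx.
Qed.

Lemma derive_slice {V : normedModType R} (g : 'rV[R]_n.+1 -> V) s u v : differentiable g (slice s u) ->
  'D_v (fun u => g (slice s u)) u = 'D_(v *m slice_mx) g (slice s u).
Proof.
move=> dg; have [dt Dt] := derive_translate (v *m slice_mx) dg.
exact: (etrans (derive_comp_mulmx v dt) Dt).
Qed.

End LeafSlice.

Section LeafForm.
Context {R : realType} {B : body R}.
Variables (D : B -> {vspace tangent R}) (w : dual_field D) (x0 : B) (F : 'M[R]_3).
Hypothesis uF : F \in unitmx.
Variables (U : set 'rV[R]_3) (P : 'I_3 -> 'rV[R]_3 -> R).
Hypotheses (oU : open U) (UV : U `<=` affine_dom x0 F setT)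
  (sP : forall j, smooth U (P j)).
Hypothesis memD : forall y (u : 'rV[R]_3), U y -> (u *m F \in D (affine_point x0 F y)) =
  (u 0 i1 == u 0 i2 * P i2 y + u 0 i3 * P i3 y).
Variables (r : R) (G : 'rV[R]_3 -> 'rV[R]_3).
Hypotheses (sG : smooth (ball 0 r) G) (UG : forall q, ball 0 r q -> U (G q)).
Hypothesis DG : forall q j, ball 0 r q -> leafdir j ->
  'D_(delta_mx 0 j) G q = leaf_frame P j (G q).

Let oQ : open (ball (0 : 'rV[R]_3) r) := @ball_open _ _ 0 r.

(** By [DG] the argument of the form is the j-th partial derivative of [G] followed by the affine
    map: these are the coefficients of the pullback of omega|_D to the slices. *)
Definition leaf_form j q : R :=
  dual_eval w (affine_point x0 F (G q)) (leaf_frame P j (G q) *m F).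

Lemma smooth_leaf_form j : nonvanishing_dual_section w -> leafdir j ->
  smooth (ball 0 r) (leaf_form j).
Proof.
move=> [wS _] Jj.
have oW := open_leaf_dom x0 F oU.
have sX := wS _ _ oW (leaf_field_section uF oU sP memD Jj).
have sH := smooth_affine_pointR x0 F oW sX.
have GW q : ball 0 r q -> affine_dom x0 F (leaf_dom x0 F U) (G q).
  by move=> /UG Uq; exact: (chart_leaf_dom uF UV Uq).
have := smooth_compR oQ (open_affine_dom oW) GW sG sH.
apply: (smooth_eq oQ) => q Qq.
have [E _] := chart_affine_point (UV (UG Qq)).
by rewrite /leaf_form /leaf_field E affine_invE.
Qed.

Section Slice.
Variable s0 : R.
Let S : set 'rV[R]_2 := [set u | ball 0 r (slice s0 u)].
(** One slice mapped into the body by [G]; its partial derivatives are the leaf frames, so it is an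
    integral surface. *)
Let sigma (u : 'rV[R]_2) : B := affine_point x0 F (G (slice s0 u)).

Let oS : open S.
Proof.
apply: (@open_comp _ _ (slice s0)) => // u _.
exact: smooth_cont (smooth_slice s0 openT) _.
Qed.

Let cS : connected S.
Proof.
have [[u1 Su1]|S0] := pselect (exists u, S u); last first.
  have -> : S = set0 by apply/seteqP; split => // u Uu; apply: S0; exists u.
  exact: connected0.
apply: (star_shaped_connected (u0 := u1)) => u Su t t01.
have := segment_ball Su1 Su t01; rewrite /S /slice /=.
set a := s0 *: _.
have -> : u1 *m slice_mx + a + t *: (u *m slice_mx + a - (u1 *m slice_mx + a)) =
  (u1 + t *: (u - u1)) *m slice_mx + a; last by [].
rewrite mulmxDl -scalemxAl mulmxBl addrAC opprD addrACA subrr addr0.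
by [].
Qed.

Let sigmaE u : S u -> chart (sigma u) = affine x0 F (G (slice s0 u)).
Proof. by move=> Su; have [] := chart_affine_point (UV (UG Su)). Qed.

Let sGs : smooth S (fun u => G (slice s0 u)).
Proof.
by have := smooth_comp oS oQ (fun u (h : S u) => h) (smooth_slice s0 oS) sG.
Qed.

Let DGs u v : S u -> 'D_v (fun u => G (slice s0 u)) u =
  \sum_k v 0 k *: leaf_frame P (lift ord0 k) (G (slice s0 u)).
Proof.
move=> Su; have dG : differentiable G (slice s0 u) := smooth_diff sG Su.
rewrite (derive_slice v dG) deriveE // mul_slice_mx linear_sum.
apply: eq_bigr => k _; rewrite linearZ -(deriveE _ dG) DG //.
Qed.

Let Dsigma u v : S u -> 'D_v (chart \o sigma) u =
  (\sum_k v 0 k *: leaf_frame P (lift ord0 k) (G (slice s0 u))) *m F.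
Proof.
move=> Su.
have dG : differentiable (fun u => G (slice s0 u)) u := smooth_diff sGs Su.
have da : differentiable (affine x0 F) (G (slice s0 u)).
  exact: smooth_diff (smooth_affine x0 F openT) I.
have E := derive_eq_on v (f := chart \o sigma) oS sigmaE Su.
rewrite E (derive_comp v dG da) derive_affine; congr (_ *m F); exact: DGs.
Qed.

Let surface : integral_surface D S sigma.
Proof.
split=> //.
  apply: (smooth_eq (f := fun u => affine x0 F (G (slice s0 u))) oS) => [u Su|].
    exact/esym/sigmaE.
  exact: (smooth_comp oS openT (fun _ _ => I) sGs (smooth_affine x0 F openT)).
move=> u Su X; split=> [DX|[v ->]]; last first.
  rewrite Dsigma // mulmx_suml memv_suml // => k _.
  rewrite -scalemxAl; apply: memvZ.
  by apply: (leaf_frame_mem memD); [|exact: UG].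
have [Y YX] : exists Y, X = Y *m F by exists (X *m invmx F); rewrite mulmxKV.
have Y1 : Y 0 i1 = Y 0 i2 * P i2 (G (slice s0 u)) + Y 0 i3 * P i3 (G (slice s0 u)).
  by apply/eqP; rewrite -memD -?YX //; exact: UG.
exists (\row_k Y 0 (lift ord0 k)); rewrite Dsigma // YX; congr (_ *m F).
rewrite !big_ord_recl big_ord0 addr0 !mxE.
have -> : lift ord0 ord0 = i2 :> 'I_3 by exact: val_inj.
have -> : lift ord0 (lift ord0 ord0) = i3 :> 'I_3 by exact: val_inj.
rewrite {1}(row3E Y) Y1 /leaf_frame ord3_0 /basis_vec.
rewrite !scalerDr !scalerA addrACA scalerDl addrC addrA.
by [].
Qed.

Lemma leaf_form_closed_slice k l u : leafwise_closed w -> S u ->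
  nonvanishing_dual_section w ->
  'D_(delta_mx 0 (lift ord0 k)) (leaf_form (lift ord0 l)) (slice s0 u) =
  'D_(delta_mx 0 (lift ord0 l)) (leaf_form (lift ord0 k)) (slice s0 u).
Proof.
move=> clw Su hw.
(* The connected domain makes the whole image a single plaque, hence one step of the chain
   relation. *)
have SL : sigma @` S `<=` leaf D (sigma u).
  move=> _ [u' Su' <-]; apply: rst_step; exists S, sigma.
  by split; [exact: surface|exact: cS|exists u|exists u'].
have pE (m : 'I_2) q : S q ->
    pullback w sigma q (delta_mx 0 m) = leaf_form (lift ord0 m) (slice s0 q).
  move=> Sq; rewrite /pullback Dsigma // /leaf_form (bigD1 m) //= big1 => [|m' m'm].
    by rewrite mxE !eqxx scale1r addr0.
  by rewrite mxE eqxx (negbTE m'm) scale0r.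
have := clw _ _ _ surface SL u Su (delta_mx 0 k) (delta_mx 0 l).
have dL (m : 'I_2) : differentiable (leaf_form (lift ord0 m)) (slice s0 u).
  have sL : smooth (ball 0 r) (leaf_form (lift ord0 m)) by exact: smooth_leaf_form.
  exact: (smooth_diff sL Su).
have E (m m' : 'I_2) : 'D_(delta_mx 0 m) (fun q => pullback w sigma q (delta_mx 0 m')) u =
    'D_(delta_mx 0 (lift ord0 m)) (leaf_form (lift ord0 m')) (slice s0 u).
  have E0 := derive_regular (fun q => pullback w sigma q (delta_mx 0 m')) u (delta_mx 0 m).
  have E1 := etrans E0 (derive_eq_on (V := R) (delta_mx 0 m) oS (pE m') Su).
  have := derive_slice (delta_mx 0 m) (dL m'); rewrite slice_mx_delta.
  by move=> E2; exact: (etrans E1 E2).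
by move=> H; exact: (etrans (esym (E k l)) (etrans H (E l k))).
Qed.

End Slice.

Lemma leaf_form_closed i j q : nonvanishing_dual_section w -> leafwise_closed w ->
  leafdir i -> leafdir j -> ball 0 r q ->
  'D_(delta_mx 0 i) (leaf_form j) q = 'D_(delta_mx 0 j) (leaf_form i) q.
Proof.
move=> hw clw Ji; have {Ji} [k ->] : exists k, i = lift ord0 k.
  by case: (unliftP ord0 i) Ji => [k ->|->]; [exists k|].
move=> Jj; have {Jj} [l ->] : exists l, j = lift ord0 l.
  by case: (unliftP ord0 j) Jj => [l ->|->]; [exists l|].
by rewrite (sliceE q) => Qq; apply: leaf_form_closed_slice.
Qed.

End LeafForm.

Section CoordinateChangeDerive.
Context {R : realType} {n : nat}.

(** The infinitesimal form of [coordinate_change]: components other than the i-th are preserved, and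
    the i-th becomes the derivative of [f]. *)
Lemma derive_coordinate_change (i : 'I_n) (f : 'rV[R]_n -> R) (U Y : set 'rV[R]_n)
    (g : 'rV[R]_n -> 'rV[R]_n) y v : open Y -> smooth U f -> smooth Y g ->
  (forall y, Y y -> [/\ U (g y), f (g y) = y 0 i & forall j, j != i -> g y 0 j = y 0 j]) ->
  Y y ->
  'D_('D_v g y) f (g y) = v 0 i /\ forall j, j != i -> ('D_v g y) 0 j = v 0 j.
Proof.
move=> oY sf sg gY Yy; have [Ugy _ _] := gY y Yy.
have dg := smooth_diff sg Yy; have df := smooth_diff sf Ugy.
have coordD j : 'D_v (fun q : 'rV[R]_n => q 0 j : R) y = v 0 j.
  by rewrite (derive_coord _ _ (f := id)) // derive_id.
split=> [|j ji].
  rewrite -derive_comp // (derive_eq_on (g := fun q => q 0 i : R) v oY _ Yy) ?coordD //.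
  by move=> q /gY[].
rewrite -derive_coord // (derive_eq_on (g := fun q => q 0 j : R) v oY _ Yy) ?coordD //.
by move=> q /gY[_ _]; apply.
Qed.

Lemma radial0 (J : pred 'I_n) (a : 'I_n -> 'rV[R]_n -> R) : radial J a 0 = 0.
Proof. by rewrite /radial big1 // => j _; rewrite mxE mul0r. Qed.

End CoordinateChangeDerive.

Section VolumeForms.
Context {R : realType}.
Variable T : @form3 R.
Hypothesis altT : alternating3 T.

Lemma alternating3_mulmx (M : 'M[R]_3) u v v' :
  T (u *m M) (v *m M) (v' *m M) = e123 u v v' * T (row i1 M) (row i2 M) (row i3 M).
Proof.
pose T' a b c := T (a *m M) (b *m M) (c *m M).
rewrite !row_basis; apply: (@alternating3E _ T'); case: altT => l1 l2 l3 alt.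
split=> [b c k a a'|a c k b b'|a b k c c'|a b]; last exact: alt.
- by rewrite /T' mulmxDl -scalemxAl l1.
- by rewrite /T' mulmxDl -scalemxAl l2.
- by rewrite /T' mulmxDl -scalemxAl l3.
Qed.

Lemma e123_row (M : 'M[R]_3) : e123 (row i1 M) (row i2 M) (row i3 M) = \det M.
Proof.
congr (\det _); apply/matrixP => i j; rewrite mxE.
by case: i => [[|[|[|//]]] hi] /=; rewrite mxE; congr (M _ _); exact: val_inj.
Qed.

Lemma alternating3_row (M : 'M[R]_3) : T (row i1 M) (row i2 M) (row i3 M) =
  \det M * T (basis_vec i1) (basis_vec i2) (basis_vec i3).
Proof. by rewrite alternating3E // e123_row. Qed.

End VolumeForms.

(** * From parametrizations to local coordinates *)

Section Integrability.
Context {R : realType} {B : body R}.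

Lemma inverse_coordinates (x0 : B) (Y : set 'rV[R]_3) (z : 'rV[R]_3 -> 'rV[R]_3) :
  open Y -> Y 0 -> smooth Y z -> z 0 = chart x0 ->
  (forall y, Y y -> exists x : B, chart x = z y) -> jac z 0 \in unitmx ->
  exists (W : set B) (y : B -> 'rV[R]_3),
    [/\ local_coordinates W y z, W x0 & forall x, W x -> Y (y x)].
Proof.
move=> oY Y0 sz z0 zB uz.
have [V [g [oV V0 VY oZ [sg gz _]]]] := inverse_function oY Y0 sz uz.
pose W : set B := [set x | (z @` V) (chart x)].
have oW : open W.
  by apply: (@open_comp B _ chart) => // x _; exact: chart_continuous.
have yW x : W x -> V (g (chart x)) /\ z (g (chart x)) = chart x.
  by move=> [v Vv vx]; rewrite -vx gz.
have yV : (g \o chart) @` W = V.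
  apply/seteqP; split=> [_ [x /yW[Vx _] <-] //|v Vv].
  have [x xv] := zB v (VY v Vv); exists x; last by rewrite /= xv gz.
  by exists v.
exists W, (g \o chart); split.
- split=> //.
  + by rewrite yV.
  + apply: (smooth_eq (f := g) (chart_open oW)); first by move=> _ [x _ <-]; rewrite in_chartE.
    by apply: smooth_sub sg => _ [x Wx <-].
  + by rewrite yV; exact: smooth_sub VY sz.
  + by move=> x /yW[].
- by exists 0.
- by move=> x /yW[Vx _]; exact: VY.
Qed.

End Integrability.

Lemma sum3 {V : nmodType} (h : 'I_3 -> V) : \sum_i h i = h i1 + (h i2 + h i3).
Proof.
rewrite !big_ord_recl big_ord0 addr0; congr (h _ + (h _ + h _)); exact: val_inj.
Qed.

Lemma derive_basis3 {R : realType} {V : normedModType R} (g : 'rV[R]_3 -> V)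
    (q c : 'rV[R]_3) : differentiable g q ->
  'D_c g q = c 0 i1 *: 'D_(delta_mx 0 i1) g q +
    (c 0 i2 *: 'D_(delta_mx 0 i2) g q + c 0 i3 *: 'D_(delta_mx 0 i3) g q).
Proof.
by move=> dg; rewrite (derive_basis _ dg) sum3.
Qed.

Lemma dual_evalD {R : realType} {B : body R} (D : B -> {vspace tangent R})
    (w : dual_field D) x (s t : R) u v :
  dual_eval w x (s *: u + t *: v) = s * dual_eval w x u + t * dual_eval w x v.
Proof. by rewrite /dual_eval linearD !linearZ /= linearD !linearZ. Qed.

(** * Straightening the distribution and the one-form *)

Section NormalizeForm.
Context {R : realType} {B : body R}.
Variables (D : B -> {vspace tangent R}) (w : dual_field D) (x0 : B) (F : 'M[R]_3).
Hypotheses (uF : F \in unitmx) (D0 : D x0 = <<[:: row i2 F; row i3 F]>>%VS)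
  (wF : dual_eval w x0 (row i2 F) != 0).
Variables (U : set 'rV[R]_3) (P : 'I_3 -> 'rV[R]_3 -> R).
Hypotheses (oU : open U) (UV : U `<=` affine_dom x0 F setT)
  (sP : forall j, smooth U (P j)).
Hypothesis memD : forall y (u : 'rV[R]_3), U y -> (u *m F \in D (affine_point x0 F y)) =
  (u 0 i1 == u 0 i2 * P i2 y + u 0 i3 * P i3 y).
Variables (r : R) (G : 'rV[R]_3 -> 'rV[R]_3).
Hypotheses (sG : smooth (ball 0 r) G) (UG : forall q, ball 0 r q -> U (G q)).
Hypothesis DG : forall q j, ball 0 r q -> leafdir j ->
  'D_(delta_mx 0 j) G q = leaf_frame P j (G q).
Hypotheses (r0 : 0 < r) (G0 : G 0 = 0) (D0G : 'D_(delta_mx 0 i1) G 0 = delta_mx 0 i1).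
Hypotheses (hw : nonvanishing_dual_section w) (clw : leafwise_closed w).

Let oQ : open (ball (0 : 'rV[R]_3) r) := @ball_open _ _ 0 r.
Let Q0 : ball (0 : 'rV[R]_3) r 0 := ballxx 0 r0.
Let leaf2 : leafdir (i2 : 'I_3). Proof. by []. Qed.
Let leaf3 : leafdir (i3 : 'I_3). Proof. by []. Qed.
Local Notation alpha := (leaf_form w x0 F P G).
Let f : 'rV[R]_3 -> R := radial (@leafdir 2) alpha.

Let sa j : leafdir j -> smooth (ball 0 r) (alpha j).
Proof. exact: (smooth_leaf_form uF oU UV sP memD sG UG hw). Qed.

Let stQ : star (@leafdir 2) (ball (0 : 'rV[R]_3) r) := @star_ball R 3 leafdir r.

Let sf : smooth (ball 0 r) f.
Proof. by move=> k; exact: (class_C_radial oQ stQ (fun j Jj => sa Jj k)). Qed.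

Let Df j q : leafdir j -> ball 0 r q -> 'D_(delta_mx 0 j) f q = alpha j q.
Proof.
move=> Jj Qq; apply: (poincare oQ stQ (fun j Jj => sa Jj 1%N) _ Jj Qq).
by move=> l m p Jl Jm Qp; exact: (leaf_form_closed uF oU UV sP memD sG UG DG hw clw).
Qed.

Let DGc (q c : 'rV[R]_3) : ball 0 r q -> 'D_c G q = c 0 i1 *: 'D_(delta_mx 0 i1) G q +
    (c 0 i2 *: leaf_frame P i2 (G q) + c 0 i3 *: leaf_frame P i3 (G q)).
Proof. by move=> Qq; rewrite (derive_basis3 _ (smooth_diff sG Qq)) (DG Qq leaf2) (DG Qq leaf3). Qed.

Let leaf_derive (q c : 'rV[R]_3) : ball 0 r q -> c 0 i1 = 0 ->
  'D_c G q *m F \in D (affine_point x0 F (G q)) /\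
  dual_eval w (affine_point x0 F (G q)) ('D_c G q *m F) = 'D_c f q.
Proof.
move=> Qq c0; rewrite DGc // c0 scale0r add0r mulmxDl -!scalemxAl; split.
  have E j : leafdir j -> leaf_frame P j (G q) *m F \in D (affine_point x0 F (G q)).
    by move=> Jj; apply: (leaf_frame_mem memD) => //; exact: UG.
  by apply: memvD; apply: memvZ; exact: E.
rewrite dual_evalD (derive_basis3 _ (smooth_diff sf Qq)) c0 scale0r add0r.
by rewrite !Df.
Qed.

Let P0 j : leafdir j -> P j 0 = 0.
Proof.
have U0 : U 0 by rewrite -G0; exact: UG.
have E k : row k F \in D x0 ->
    (basis_vec k : 'rV[R]_3) 0 i1 = (basis_vec k : 'rV[R]_3) 0 i2 * P i2 0 + (basis_vec k : 'rV[R]_3) 0 i3 * P i3 0.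
  by move=> Dk; apply/eqP; rewrite -memD // affine_point0 -row_basis.
have R2 : row i2 F \in D x0.
  by rewrite D0; apply/mem_span2; exists 1, 0; rewrite scale1r scale0r addr0.
have R3 : row i3 F \in D x0.
  by rewrite D0; apply/mem_span2; exists 0, 1; rewrite scale1r scale0r add0r.
have := E _ R3; have := E _ R2; rewrite !mxE /=.
rewrite !mul1r !mul0r addr0 add0r => E2 E3.
by move=> /leafdirP[] ->.
Qed.

Lemma normalize_form : exists (Y : set 'rV[R]_3) (Th : 'rV[R]_3 -> 'rV[R]_3),
  [/\ open Y, Y 0, smooth Y Th & [/\ Th 0 = 0, forall y, Y y -> U (Th y),
    forall (y v : 'rV[R]_3), Y y -> v 0 i1 = 0 ->
      'D_v Th y *m F \in D (affine_point x0 F (Th y)) /\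
      dual_eval w (affine_point x0 F (Th y)) ('D_v Th y *m F) = v 0 i2 &
    jac Th 0 \in unitmx]].
Proof.
have f0 : f 0 = 0 by exact: radial0.
have LF0 j : leafdir j -> leaf_frame P j 0 = delta_mx 0 j.
  by move=> Jj; rewrite /leaf_frame P0 // scale0r addr0.
(* At the origin this derivative is the value of omega on the second row of the adapted frame. *)
have D2f : 'D_(delta_mx 0 i2) f 0 != 0.
  by rewrite Df // /leaf_form G0 affine_point0 LF0 // -row_basis.
have [Y [g [oY Y0 sg g0 gY]]] := coordinate_change oQ Q0 sf f0 D2f.
have gQ y : Y y -> ball 0 r (g y) by move=> /gY[].
have sT : smooth Y (fun y => G (g y)) by exact: (smooth_comp oY oQ gQ sg sG).
have DT (y v : 'rV[R]_3) : Y y -> 'D_v (fun y => G (g y)) y = 'D_('D_v g y) G (g y).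
  move=> Yy; have dG := smooth_diff sG (gQ y Yy).
  exact: (derive_comp v (smooth_diff sg Yy) dG).
have Dg (y v : 'rV[R]_3) (Yy : Y y) := derive_coordinate_change v oY sf sg gY Yy.
exists Y, (fun y => G (g y)); split=> //; split=> //.
- by rewrite g0.
- by move=> y Yy; apply: UG; exact: gQ.
- move=> y v Yy v1; have [Df' Dg'] := Dg y v Yy.
  have c1 : ('D_v g y) 0 i1 = 0 by rewrite Dg'.
  have [m1 m2] := leaf_derive (gQ y Yy) c1.
  by split; rewrite DT // m2.
(* [G] is the identity to first order at 0, so a kernel vector satisfies ['D_v g 0] = 0; its
   components then vanish by the formulas [Dg], the second one through [f]. *)
apply: unitmx_inj => v; have dT := smooth_diff sT Y0.
rewrite -derive_jac // DT // DGc; last exact: gQ.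
rewrite g0 G0 D0G !LF0 // => c0.
have [Df' Dg'] := Dg 0 v Y0.
have ci j : ('D_v g 0) 0 j = 0.
  move: c0; set c := 'D_v g 0 => c0.
  have : (c 0 i1 *: delta_mx 0 i1 + (c 0 i2 *: delta_mx 0 i2 + c 0 i3 *: delta_mx 0 i3) : 'rV[R]_3) 0 j = 0 by rewrite c0 mxE.
  by rewrite addrA -(row3E c).
have cz : 'D_v g 0 = 0 by apply/rowP => j; rewrite ci mxE.
apply/rowP => j; rewrite mxE; have [->|ji] := eqVneq j i2; last by rewrite -Dg' // ci.
have df := smooth_diff sf Q0; rewrite -Df' cz g0 (deriveE _ df).
exact: linear0.
Qed.

End NormalizeForm.

Lemma e123_triangular {R : realType} (u v v' : 'rV[R]_3) : u 0 i1 = 1 -> u 0 i2 = 0 ->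
  v 0 i1 = 0 -> v 0 i2 = 1 -> v' 0 i1 = 0 -> v' 0 i2 = 0 -> e123 u v v' = v' 0 i3.
Proof.
move=> u1 u2 v1 v2 v1' v2'; rewrite e123E u1 u2 v1 v2 v1' v2'.
by rewrite !(mulr0, mul0r, mulr1, mul1r, subr0, addr0).
Qed.

(** * Straightening the volume form *)

Section NormalizeVolume.
Context {R : realType} {B : body R}.
Variables (D : B -> {vspace tangent R}) (w : dual_field D) (O : B -> @form3 R).
Hypotheses (dimD : forall x, \dim (D x) = 2) (hO : volume_form O).
Variables (x0 : B) (F : 'M[R]_3).
Hypothesis uF : F \in unitmx.
Variables (Y : set 'rV[R]_3) (Th : 'rV[R]_3 -> 'rV[R]_3).
Hypotheses (oY : open Y) (Y0 : Y 0) (sTh : smooth Y Th) (Th0 : Th 0 = 0)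
  (YV : forall y, Y y -> affine_dom x0 F setT (Th y)) (uTh : jac Th 0 \in unitmx).
Hypothesis Thw : forall y (v : 'rV[R]_3), Y y -> v 0 i1 = 0 ->
  'D_v Th y *m F \in D (affine_point x0 F (Th y)) /\
  dual_eval w (affine_point x0 F (Th y)) ('D_v Th y *m F) = v 0 i2.

Let M y := jac Th y *m F.
Let kap y := affine_point x0 F (Th y).
Let rho y : R := O (kap y) (row i1 (M y)) (row i2 (M y)) (row i3 (M y)).

Lemma smooth_volume_basis :
  smooth_on setT (fun x => O x (basis_vec i1) (basis_vec i2) (basis_vec i3) : R).
Proof.
have [_ sO _] := hO.
have oW : open (chart @` [set: B]) by apply: chart_open; exact: openT.
have sc (c : 'rV[R]_3) : smooth_on setT (fun=> c : tangent R) (B := B).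
  apply: (smooth_eq (f := fun=> c) oW); first by move=> _ [x _ <-]; rewrite in_chartE.
  by move=> k; exact: class_C_cst.
exact: (sO _ _ _ _ openT (sc _) (sc _) (sc _)).
Qed.

Let rhoE y : rho y = \det (M y) * O (kap y) (basis_vec i1) (basis_vec i2) (basis_vec i3).
Proof. by have [alt _ _] := hO; exact: alternating3_row. Qed.

Let row_M y i : row i (M y) = 'D_(delta_mx 0 i) Th y *m F.
Proof. by rewrite /M row_mul rowK. Qed.

Let srho : smooth Y rho.
Proof.
have sH := smooth_affine_pointR x0 F openT smooth_volume_basis.
have oV : open (affine_dom x0 F setT) by apply: open_affine_dom; exact: openT.
have sb := smooth_compR oY oV YV sTh sH.
have sM i j : smooth Y (fun y => M y i j : R).
  apply: (smooth_eq (f := fun y => ('D_(delta_mx 0 i) Th y *m F) 0 j : R) oY).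
    by move=> y _; rewrite -row_M mxE.
  by apply: (smooth_coord _ oY); apply: (smooth_mulmxr F oY); exact: smooth_derive.
have sd : smooth Y (fun y => \det (M y) : R).
  by move=> k; apply: (class_C_det oY) => i j; exact: sM.
by apply: (smooth_eq _ _ (smoothM oY sd sb)) => // y _; rewrite rhoE.
Qed.

Let rho0 : rho 0 != 0.
Proof.
rewrite rhoE mulf_neq0 //.
  by rewrite -unitfE -unitmxE /M unitmx_mul uTh uF.
have [alt _ /(_ (kap 0))[u [v [v']]]] := hO.
by apply: contraNneq => b0; rewrite alternating3E // b0 mulr0.
Qed.

(** The volume value 1 forces the matrix to be invertible, and the values 1 and 0 of the form make
    the last two rows independent; the dimension of D does the rest. *)
Lemma frame_structure x (N : 'M[R]_3) : row i2 N \in D x -> row i3 N \in D x ->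
  dual_eval w x (row i2 N) = 1 -> dual_eval w x (row i3 N) = 0 ->
  O x (row i1 N) (row i2 N) (row i3 N) = 1 -> G1B_structure w O x N.
Proof.
move=> D2 D3 w2 w3 ON; have [alt _ _] := hO.
have uN : N \in unitmx.
  rewrite unitmxE unitfE; apply: contra_eqN ON => /eqP d0.
  by rewrite (alternating3_row (alt x)) d0 mul0r eq_sym oner_eq0.
split=> //; apply: plane_span => //.
  apply: contra_eqN w2 => /eqP ->; by rewrite dual_eval0 eq_sym oner_eq0.
apply/negP => /vlineP[k k3].
have k0 : k = 0.
  have := dual_evalD w x k 0 (row i2 N) 0.
  by rewrite scaler0 addr0 -k3 w3 w2 mulr1 mul0r addr0.
have : basis_vec i3 *m N = 0 by rewrite -row_basis k3 k0 scale0r.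
move/(congr1 (fun u => u *m invmx N)); rewrite mulmxK // mul0mx.
by move/rowP/(_ i3)/eqP; rewrite !mxE eqxx oner_eq0.
Qed.

Lemma normalize_volume : exists (Z : set 'rV[R]_3) (z : 'rV[R]_3 -> 'rV[R]_3),
  [/\ open Z, Z 0, smooth Z z, z 0 = chart x0 & forall y, Z y -> exists2 x : B,
    chart x = z y & G1B_structure w O x (jac z y)].
Proof.
have [r1 r10 rY] : exists2 r1 : R, 0 < r1 & ball (0 : 'rV[R]_3) r1 `<=` Y.
  have : nbhs (0 : 'rV[R]_3) Y by apply: open_nbhs_nbhs.
  by move/nbhs_ballP => [e e0 eY]; exists e.
pose Q := ball (0 : 'rV[R]_3) r1.
have oQ : open Q by exact: ball_open.
have Q0 : Q 0 by exact: ballxx.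
(* With a single radial direction closedness is trivial, and [radial] is the primitive in the third
   coordinate that vanishes where this coordinate is 0. *)
pose J : pred 'I_3 := pred1 i3.
have stQ : star J Q by exact: star_ball.
pose h : 'rV[R]_3 -> R := radial J (fun _ => rho).
have sQ : smooth Q rho by exact: smooth_sub rY srho.
have sh : smooth Q h by move=> k; exact: (class_C_radial oQ stQ (fun _ _ => sQ k)).
have Dh q : Q q -> 'D_(delta_mx 0 i3) h q = rho q.
  move=> Qq; apply: (poincare oQ stQ (fun _ _ => sQ 1%N) _ (eqxx i3) Qq).
  by move=> i j p /eqP -> /eqP ->.
have h0 : h 0 = 0 by exact: radial0.
have D3h : 'D_(delta_mx 0 i3) h 0 != 0 by rewrite Dh.
have [Z [g [oZ Z0 sg g0 gZ]]] := coordinate_change oQ Q0 sh h0 D3h.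
have gY y : Z y -> Y (g y) by move=> /gZ[/rY].
have sT : smooth Z (fun y => Th (g y)) by exact: (smooth_comp oZ oY gY sg sTh).
have sz : smooth Z (fun y => affine x0 F (Th (g y))).
  exact: (smooth_comp oZ openT (fun _ _ => I) sT (smooth_affine x0 F openT)).
exists Z, (fun y => affine x0 F (Th (g y))); split=> //.
  by rewrite g0 Th0 affine0.
move=> y Zy; have [E _] := chart_affine_point (YV (gY y Zy)).
exists (kap (g y)); first exact: E.
have Dg (v : 'rV[R]_3) := derive_coordinate_change v oZ sh sg gZ Zy.
pose c i := 'D_(delta_mx 0 i) g y.
have rowN i : row i (jac (fun y => affine x0 F (Th (g y))) y) = 'D_(c i) Th (g y) *m F.
  have dT := smooth_diff sT Zy; have dTh := smooth_diff sTh (gY y Zy).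
  have da : differentiable (affine x0 F) (Th (g y)).
    exact: smooth_diff (smooth_affine x0 F openT) I.
  rewrite rowK.
  have E1 := derive_comp (delta_mx 0 i) dT da.
  have E2 := derive_comp (delta_mx 0 i) (smooth_diff sg Zy) dTh.
  by rewrite E1 E2 derive_affine.
(* The change of third coordinate keeps the first two components, which are all that [Thw] looks
   at. *)
have cE i j : j != i3 -> c i 0 j = (j == i)%:R.
  by move=> /(Dg (delta_mx 0 i)).2 ->; rewrite mxE eqxx.
have ch i : 'D_(c i) h (g y) = (i == i3)%:R.
  by rewrite (Dg (delta_mx 0 i)).1 mxE eqxx eq_sym.
have [Qgy _ _] := gZ y Zy.
have c3E : c i3 = c i3 0 i3 *: delta_mx 0 i3.
  have c31 : c i3 0 i1 = 0 by exact: cE.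
  have c32 : c i3 0 i2 = 0 by exact: cE.
  by rewrite {1}(row3E (c i3)) c31 c32 !scale0r !add0r.
have c3 : c i3 0 i3 * rho (g y) = 1.
  have dh := smooth_diff sh Qgy.
  have E3 : 'D_(c i3) h (g y) = c i3 0 i3 * 'D_(delta_mx 0 i3) h (g y).
    by rewrite {1}c3E !(deriveE _ dh) linearZ.
  by rewrite -(Dh _ Qgy) -E3; exact: ch i3.
have [D2 w2] := Thw (gY y Zy) (cE i2 i1 isT).
have [D3 w3] := Thw (gY y Zy) (cE i3 i1 isT).
have dTh := smooth_diff sTh (gY y Zy).
have cM i : 'D_(c i) Th (g y) *m F = c i *m M (g y).
  by rewrite (derive_jac _ dTh) /M mulmxA.
have [alt _ _] := hO.
move: rowN; move: (jac _ y) => N rowN; apply: frame_structure; rewrite !rowN.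
- exact: D2.
- exact: D3.
- by rewrite w2; exact: cE.
- by rewrite w3; exact: cE.
(* The matrix of the change is triangular with diagonal 1, 1 and the inverse of the density, so the
   new density is 1 by [c3]. *)
have e : e123 (c i1) (c i2) (c i3) = c i3 0 i3.
  by apply: e123_triangular; exact: cE.
have Oc := alternating3_mulmx (alt (kap (g y))) (M (g y)) (c i1) (c i2) (c i3).
have O1 := etrans Oc (etrans (congr1 (fun t : R => t * rho (g y)) e) c3).
exact: (etrans (f_equal3 (O (kap (g y))) (cM i1) (cM i2) (cM i3)) O1).
Qed.

End NormalizeVolume.

Theorem proposition6p6 (R : realType) (B : body R)
  (D : B -> {vspace tangent R}) (w : dual_field D) (O : B -> @form3 R)
  (hD : distribution2 D) (hw : nonvanishing_dual_section w)
  (hO : volume_form O) :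
  integrable_structure (G1B_structure w O) <-> involutive_distribution D /\ leafwise_closed w.
Proof.
split=> [intP|[invD clw] x0].
  by split; [exact: integrable_involutive intP|exact: integrable_leafwise_closed intP].
have [F [uF D0 wF]] := adapted_frame (hD.1 x0) (hw.2 x0).
have [U [P [oU U0 UV sP memD]]] := distribution_slopes uF D0 hD.
have intE i j y : leafdir i -> leafdir j -> U y ->
  'D_(leaf_frame P i y) (P j) y = 'D_(leaf_frame P j y) (P i) y.
  exact: (slopes_integrable uF oU UV sP memD invD).
have [r [G [r0 sG G0 D0G GU]]] := leaf_parametrization oU U0 (fun j _ => sP j) intE.
have UG q : ball 0 r q -> U (G q) by move=> /GU[].
have DG q j : ball 0 r q -> leafdir j -> 'D_(delta_mx 0 j) G q = leaf_frame P j (G q).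
  by move=> /GU[_]; apply.
rewrite ord3_0 in D0G.
have [Y [Th [oY Y0 sTh [Th0 UTh Thw uTh]]]] :=
  normalize_form uF D0 wF oU UV sP memD sG UG DG r0 G0 D0G hw clw.
have YV y : Y y -> affine_dom x0 F setT (Th y) by move=> /UTh/UV.
have [Z [z [oZ Z0 sz z0 zP]]] := normalize_volume hD.1 hO uF oY Y0 sTh Th0 YV uTh Thw.
have zB y : Z y -> exists x : B, chart x = z y by move=> /zP[x xz _]; exists x.
have uz : jac z 0 \in unitmx by have [x _ []] := zP 0 Z0.
have [W [y [yz Wx WZ]]] := inverse_coordinates oZ Z0 sz z0 zB uz.
exists W, y, z; split; [exact: yz|exact: Wx|move=> x Wx'].
(* [zP] provides the structure at some point above [z (y x)]; injectivity of the chart identifies it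
   with [x]. *)
have [x' xz'] := zP _ (WZ x Wx').
have [_ _ _ _ /(_ x Wx') zyx] := yz.
by have -> : x' = x by apply: chart_inj; rewrite xz' zyx.
Qed.
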